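(* Let $R$ be a ring with $\operatorname{sfli} R$ finite. For every $R^\circ$-module $M$ and all $i\in\mathbb{Z}$, there are isomorphisms $$\check{\operatorname{Tor}}{}^{R}_{i}(M,-)\;\cong\;\widetilde{\operatorname{Tor}}{}^{R}_{i}(M,-)$$ of functors on the category of $R$-modules, where $\check{\operatorname{Tor}}{}^R(M,-)$ denotes complete homology and $\widetilde{\operatorname{Tor}}{}^R(M,-)$ denotes stable homology.
   Context: Rings are associative unital algebras over a fixed commutative ring $\Bbbk$. An $R$-module is a left $R$-module; right $R$-modules are viewed as modules over the opposite ring $R^\circ$. Functors go from $R$-modules to $\Bbbk$-modules. The invariant $\operatorname{sfli}R$ is the supremum of the flat dimensions of all injective $R$-modules. J-completion. A morphism $\upsilon\colon \{U_i\}_{i\in\mathbb Z}\to\{T_i\}_{i\in\mathbb Z}$ of families of covariant functors is a family of natural transformations $\upsilon_i\colon U_i\to T_i$. The J-completion of a family $T=\{T_i\}_{i\in\mathbb Z}$ of covariant functors is a family $\check T=\{\check T_i\}_{i\in\mathbb Z}$ of covariant functors together with a morphism $\tau\colon\check T\to T$ such that (1) $\check T_i(E)=0$ for every injective $R$-module $E$ and every $i$; (2) if $U=\{U_i\}_{i\in\mathbb Z}$ is a family of covariant functors with $U_i(E)=0$ for every injective $R$-module $E$ and all $i$, and $\upsilon\colon U\to T$ is a morphism, then there is a unique morphism $\sigma\colon U\to\check T$ with $\tau\sigma=\upsilon$. It is unique up to unique isomorphism, and it exists for $T=\operatorname{Tor}^R(M,-)=\{\operatorname{Tor}_i^R(M,-)\}_{i\in\mathbb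 Z}$ (with $\operatorname{Tor}_i=0$ for $i<0$). Complete homology. For an $R^\circ$-module $M$, $\check{\operatorname{Tor}}{}^R(M,-)=\{\check{\operatorname{Tor}}{}^R_i(M,-)\}_{i\in\mathbb Z}$ is the J-completion of $\operatorname{Tor}^R(M,-)$. Stable homology. For an $R^\circ$-module $M$ and an $R$-module $N$, let $P\to M$ be a projective resolution and $N\to I$ an injective resolution. The complex $P\otimes_R I$ has components $(P\otimes_R I)_n=\coprod_{i\in\mathbb Z}P_{i+n}\otimes_R I^i$; it is a subcomplex of the complex $P\,\bar\otimes_R I$ with components $(P\,\bar\otimes_R I)_n=\prod_{i\in\mathbb Z}P_{i+n}\otimes_R I^i$ and differential extended by linearity from $p\otimes x\mapsto\partial(p)\otimes x+(-1)^{|p|}p\otimes\partial(x)$, where $|p|$ is the homological degree of $p$. The quotient complex is denoted $P\,\tilde\otimes_R I$, and $\widetilde{\operatorname{Tor}}{}^R_i(M,N)=H_{i+1}(P\,\tilde\otimes_R I)$ for $i\in\mathbb Z$; it is functorial in $N$.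
   Formalization: The J-completion is taken among homological functors (long exact sequences) with morphisms commuting with connecting maps; for mere families of natural transformations it would vanish in negative degrees, and the claim fails for R=Z/4, M=N=Z/2, i=-1. *)

(* Defs.v *)
From HB Require Import structures.
From mathcomp Require Import all_boot all_order all_algebra.
From mathcomp Require Import boolp.

Set Implicit Arguments.
Unset Strict Implicit.
Unset Printing Implicit Defensive.

Import GRing.Theory.
Local Open Scope ring_scope.
Local Open Scope quotient_scope.

Section Linear.
Variable R : pzRingType.

Definition mk_linear (U V : lmodType R) (f : U -> V) (H : linear f) :
    {linear U -> V} :=
  HB.pack f (GRing.isLinear.Build R U V *:%R f H).

Lemma mk_linearE (U V : lmodType R) (f : U -> V) (H : linear f) x :
  mk_linear H x = f x.
Proof. by []. Qed.

Definition exact_seq (A B C : lmodType R) (f : {linear A -> B})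
    (g : {linear B -> C}) : Prop :=
  forall y, g y = 0 <-> exists x, f x = y.

Definition short_exact (A B C : lmodType R) (f : {linear A -> B})
    (g : {linear B -> C}) : Prop :=
  [/\ injective f, exact_seq f g & forall z, exists y, g y = z].

Definition injective_module (E : lmodType R) : Prop :=
  forall (A B : lmodType R) (u : {linear A -> B}) (v : {linear A -> E}),
    injective u -> exists w : {linear B -> E}, forall a, w (u a) = v a.

Definition projective_module (P : lmodType R) : Prop :=
  forall (A B : lmodType R) (u : {linear A -> B}) (v : {linear P -> B}),
    (forall b, exists a, u a = b) ->
    exists w : {linear P -> A}, forall p, u (w p) = v p.

End Linear.

Section Subquotient.
Variables (R : pzRingType) (V : lmodType R).

Record submodule := Submodule {
  smem :> V -> Prop;
  smem0 : smem 0;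
  smemD : forall x y, smem x -> smem y -> smem (x + y);
  smemZ : forall a x, smem x -> smem (a *: x) }.

Lemma smemN (S : submodule) x : S x -> S (- x).
Proof. by rewrite -scaleN1r; apply: smemZ. Qed.

Lemma smemB (S : submodule) x y : S x -> S y -> S (x - y).
Proof. by move=> Sx Sy; apply: smemD => //; apply: smemN. Qed.

Definition subT : submodule.
Proof. by exists (fun _ => True). Defined.

Variables Z B : submodule.

Definition sub_type := {x : V | `[< Z x >]}.
HB.instance Definition _ := Choice.on sub_type.

Definition sub_rel (x y : sub_type) := `[< B (val x - val y) >].

Lemma sub_rel_refl : reflexive sub_rel.
Proof. by move=> x; apply/asboolP; rewrite subrr; apply: smem0. Qed.

Lemma sub_rel_sym : symmetric sub_rel.
Proof.
by move=> x y; apply/asboolP/asboolP => H; rewrite -opprB; apply: smemN.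
Qed.

Lemma sub_rel_trans : transitive sub_rel.
Proof.
move=> y x z /asboolP H1 /asboolP H2; apply/asboolP.
by rewrite -(subrKA (val y)); apply: smemD.
Qed.

Canonical sub_equiv := EquivRel sub_rel sub_rel_refl sub_rel_sym sub_rel_trans.

(* Z / (Z `&` B) *)
Definition subquot : Type := {eq_quot sub_equiv}.
HB.instance Definition _ := Choice.on subquot.
HB.instance Definition _ := EqQuotient.on subquot.

Definition rep (q : subquot) : V := val (repr q).

(* the class of x; by convention it is the class of 0 if x is not in Z *)
Definition cls (x : V) : subquot :=
  \pi_subquot (insubd (exist _ 0 (asboolT (smem0 Z)) : sub_type) x : sub_type).

Lemma repP q : Z (rep q).
Proof. by rewrite /rep; case: (repr q) => x /= /asboolP. Qed.

Lemma cls_rep q : cls (rep q) = q.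
Proof. by rewrite /cls /rep valKd reprK. Qed.

Lemma cls_eq x y : Z x -> Z y -> cls x = cls y <-> B (x - y).
Proof.
move=> Zx Zy; rewrite /cls; split.
  by move/eqmodP/asboolP; rewrite !val_insubd !asboolT.
by move=> H; apply/eqmodP/asboolP; rewrite !val_insubd !asboolT.
Qed.

Lemma rep_cls x : Z x -> B (rep (cls x) - x).
Proof. by move=> Zx; apply/(cls_eq (repP _) Zx); rewrite cls_rep. Qed.

Lemma rep_cls' x : Z x -> B (x - rep (cls x)).
Proof. by move=> Zx; rewrite -opprB; apply/smemN/rep_cls. Qed.

Definition sqadd p q := cls (rep p + rep q).
Definition sqopp p := cls (- rep p).
Definition sqzero := cls 0.
Definition sqscale a p := cls (a *: rep p).

Lemma clsD x y : Z x -> Z y -> sqadd (cls x) (cls y) = cls (x + y).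
Proof.
move=> Zx Zy; apply/cls_eq; try by do ?apply: smemD => //; apply: repP.
by rewrite opprD addrACA; apply: smemD; apply: rep_cls.
Qed.

Lemma clsZ a x : Z x -> sqscale a (cls x) = cls (a *: x).
Proof.
move=> Zx; apply/cls_eq; try by apply: smemZ => //; apply: repP.
by rewrite -scalerBr; apply/smemZ/rep_cls.
Qed.

Lemma subquotP q : exists2 x, Z x & q = cls x.
Proof. by exists (rep q); [apply: repP | rewrite cls_rep]. Qed.

Lemma sqaddA : associative sqadd.
Proof.
move=> p q r; have [x Zx ->] := subquotP p; have [y Zy ->] := subquotP q.
have [z Zz ->] := subquotP r.
by rewrite !clsD ?addrA //; apply: smemD.
Qed.

Lemma sqaddC : commutative sqadd.
Proof. by move=> p q; rewrite /sqadd addrC. Qed.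

Lemma sqadd0 : left_id sqzero sqadd.
Proof.
move=> p; have [x Zx ->] := subquotP p.
by rewrite clsD ?add0r //; apply: smem0.
Qed.

Lemma sqaddN : left_inverse sqzero sqopp sqadd.
Proof.
move=> p; have [x Zx ->] := subquotP p.
have Zr := repP (cls x).
rewrite /sqopp clsD //; last exact: smemN.
apply/cls_eq; [by apply: smemD => //; apply: smemN | exact: smem0 |].
by rewrite subr0 addrC; apply: rep_cls'.
Qed.

HB.instance Definition _ :=
  GRing.isZmodule.Build subquot sqaddA sqaddC sqadd0 sqaddN.

Lemma sqscaleA a b v : sqscale a (sqscale b v) = sqscale (a * b) v.
Proof.
have [x Zx ->] := subquotP v; rewrite !clsZ ?scalerA //; exact: smemZ.
Qed.

Lemma sqscale1 : left_id 1 sqscale.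
Proof. by move=> v; have [x Zx ->] := subquotP v; rewrite clsZ ?scale1r. Qed.

Lemma sqscaleDr : right_distributive sqscale +%R.
Proof.
move=> a p q; have [x Zx ->] := subquotP p; have [y Zy ->] := subquotP q.
rewrite -[cls x + cls y]/(sqadd _ _) clsD // !clsZ //; last exact: smemD.
by rewrite scalerDr -clsD //; apply: smemZ.
Qed.

Lemma sqscaleDl v : {morph sqscale^~ v : a b / a + b}.
Proof.
move=> a b /=; have [x Zx ->] := subquotP v.
by rewrite !clsZ // scalerDl -clsD //; apply: smemZ.
Qed.

HB.instance Definition _ := GRing.Zmodule_isLmodule.Build R subquot
  sqscaleA sqscale1 sqscaleDr sqscaleDl.

Lemma cls_lin a x y : Z x -> Z y -> cls (a *: x + y) = a *: cls x + cls y.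
Proof.
move=> Zx Zy; rewrite -[a *: cls x]/(sqscale _ _) clsZ //.
by rewrite -[RHS]/(sqadd _ _) clsD //; apply: smemZ.
Qed.

Lemma cls_sub x y : Z x -> Z y -> cls (x - y) = cls x - cls y.
Proof. by move=> Zx Zy; rewrite addrC -scaleN1r cls_lin // scaleN1r addrC. Qed.

Lemma cls_eq0 x : Z x -> cls x = 0 <-> B x.
Proof.
by move=> Zx; rewrite -[x in B x]subr0; apply: cls_eq => //; apply: smem0.
Qed.

End Subquotient.

Arguments subquot {R V} Z B.
Arguments cls {R V} Z B x.
Arguments subT {R V}.

Section SubquotientMap.
Variables (R : pzRingType) (V W : lmodType R).
Variables (Z B : submodule V) (Z' B' : submodule W) (f : {linear V -> W}).
Hypothesis fZ : forall x, Z x -> Z' (f x).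
Hypothesis fB : forall x, Z x -> B x -> B' (f x).

Definition sqmap_fun (q : subquot Z B) : subquot Z' B' := cls Z' B' (f (rep q)).

Lemma sqmap_cls x : Z x -> sqmap_fun (cls Z B x) = cls Z' B' (f x).
Proof.
move=> Zx; have Zr := repP (cls Z B x).
apply/cls_eq; try exact: fZ.
by rewrite -linearB; apply: fB; [apply: smemB | apply: rep_cls].
Qed.

Lemma sqmap_linear : linear sqmap_fun.
Proof.
move=> a p q; have [x Zx ->] := subquotP p; have [y Zy ->] := subquotP q.
rewrite -cls_lin // !sqmap_cls //; last by apply: smemD => //; apply: smemZ.
by rewrite linearP cls_lin //; apply: fZ.
Qed.

Definition sqmap : {linear subquot Z B -> subquot Z' B'} :=
  mk_linear sqmap_linear.

End SubquotientMap.

Section Product.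
Variables (R : pzRingType) (T : Type) (V : T -> lmodType R).

Definition dprod : Type := forall t, V t.
HB.instance Definition _ := gen_eqMixin dprod.
HB.instance Definition _ := gen_choiceMixin dprod.

Definition dprod_zero : dprod := fun t => 0.
Definition dprod_opp (x : dprod) : dprod := fun t => - x t.
Definition dprod_add (x y : dprod) : dprod := fun t => x t + y t.
Definition dprod_scale a (x : dprod) : dprod := fun t => a *: x t.

Lemma dprodA : associative dprod_add.
Proof. by move=> x y z; apply/functional_extensionality_dep => t; apply: addrA. Qed.
Lemma dprodC : commutative dprod_add.
Proof. by move=> x y; apply/functional_extensionality_dep => t; apply: addrC. Qed.
Lemma dprod0 : left_id dprod_zero dprod_add.
Proof. by move=> x; apply/functional_extensionality_dep => t; apply: add0r. Qed.
Lemma dprodN : left_inverse dprod_zero dprod_opp dprod_add.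
Proof. by move=> x; apply/functional_extensionality_dep => t; apply: addNr. Qed.
HB.instance Definition _ :=
  GRing.isZmodule.Build dprod dprodA dprodC dprod0 dprodN.

Lemma dprodZA a b v : dprod_scale a (dprod_scale b v) = dprod_scale (a * b) v.
Proof. by apply/functional_extensionality_dep => t; apply: scalerA. Qed.
Lemma dprodZ1 : left_id 1 dprod_scale.
Proof. by move=> v; apply/functional_extensionality_dep => t; apply: scale1r. Qed.
Lemma dprodZr : right_distributive dprod_scale +%R.
Proof. by move=> a x y; apply/functional_extensionality_dep => t; apply: scalerDr. Qed.
Lemma dprodZl v : {morph dprod_scale^~ v : a b / a + b}.
Proof. by move=> a b; apply/functional_extensionality_dep => t; apply: scalerDl. Qed.
HB.instance Definition _ := GRing.Zmodule_isLmodule.Build R dprod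
  dprodZA dprodZ1 dprodZr dprodZl.

Lemma dprodDE (x y : dprod) t : (x + y) t = x t + y t. Proof. by []. Qed.
Lemma dprodNE (x : dprod) t : (- x) t = - x t. Proof. by []. Qed.
Lemma dprodZE a (x : dprod) t : (a *: x) t = a *: x t. Proof. by []. Qed.
Lemma dprod0E t : (0 : dprod) t = 0. Proof. by []. Qed.

End Product.

Section FiniteSupport.
Variables (R : pzRingType) (T : eqType) (V : T -> lmodType R).

(* the coproduct of the V t, inside their product *)
Definition finsupp : submodule (dprod V).
Proof.
refine (@Submodule R (dprod V) (fun x : dprod V =>
  exists s : seq T, forall t, t \notin s -> x t = 0) _ _ _).
- by exists [::].
- move=> x y [s Hs] [s' Hs']; exists (s ++ s') => t.
  by rewrite mem_cat negb_or dprodDE => /andP[/Hs-> /Hs'->]; rewrite addr0.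
- by move=> a x [s Hs]; exists s => t /Hs Ht; rewrite dprodZE Ht scaler0.
Defined.

End FiniteSupport.

(* A k-algebra, not necessarily commutative and possibly zero (the algType of
   the library has 1 != 0): a ring R with a ring morphism from k to the center
   of R. *)
Record kalgebra (k : comPzRingType) := KAlgebra {
  kalg_ring :> pzRingType;
  kalg_in : {rmorphism k -> kalg_ring};
  kalg_central : forall a (r : kalg_ring), kalg_in a * r = r * kalg_in a }.

Section Tensor.
Variables (k : comPzRingType) (R : kalgebra k).

(* A right R-module is a left module over the converse ring R^c: r *: m
   stands for m r. *)
Section TensorDef.
Variables (M : lmodType R^c) (N : lmodType R).

(* Formal sums of pure tensors are represented by sequences of pairs. *)
Inductive tensor_eq : seq (M * N) -> seq (M * N) -> Prop :=
| teq_refl s : tensor_eq s s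
| teq_sym s t : tensor_eq s t -> tensor_eq t s
| teq_trans t s u : tensor_eq s t -> tensor_eq t u -> tensor_eq s u
| teq_cat s s' t t' :
    tensor_eq s s' -> tensor_eq t t' -> tensor_eq (s ++ t) (s' ++ t')
| teq_comm s t : tensor_eq (s ++ t) (t ++ s)
| teq_Dl m m' n : tensor_eq [:: (m + m', n)] [:: (m, n); (m', n)]
| teq_Dr m n n' : tensor_eq [:: (m, n + n')] [:: (m, n); (m, n')]
| teq_0 n : tensor_eq [:: (0, n)] [::]
| teq_bal (r : R) m n :
    tensor_eq [:: ((r : R^c) *: m, n)] [:: (m, r *: n)].

Definition tensor_rel s t := `[< tensor_eq s t >].
Lemma tensor_rel_refl : reflexive tensor_rel.
Proof. by move=> s; apply/asboolP/teq_refl. Qed.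
Lemma tensor_rel_sym : symmetric tensor_rel.
Proof. by move=> s t; apply/asboolP/asboolP; apply: teq_sym. Qed.
Lemma tensor_rel_trans : transitive tensor_rel.
Proof.
by move=> t s u /asboolP H1 /asboolP H2; apply/asboolP/(teq_trans H1 H2).
Qed.
Canonical tensor_equiv :=
  EquivRel tensor_rel tensor_rel_refl tensor_rel_sym tensor_rel_trans.

Definition tensor : Type := {eq_quot tensor_equiv}.
HB.instance Definition _ := Choice.on tensor.
HB.instance Definition _ := EqQuotient.on tensor.

Definition tcls (s : seq (M * N)) : tensor := \pi_tensor s.

Lemma tclsP s t : tcls s = tcls t <-> tensor_eq s t.
Proof.
split; first by move/eqmodP/asboolP.
by move=> H; apply/eqmodP/asboolP.
Qed.

Lemma tclsE (q : tensor) : exists s, q = tcls s.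
Proof. by exists (repr q); rewrite /tcls reprK. Qed.

Lemma tcls_cat s s' t t' :
  tcls s = tcls s' -> tcls t = tcls t' -> tcls (s ++ t) = tcls (s' ++ t').
Proof. by move=> /tclsP H1 /tclsP H2; apply/tclsP/teq_cat. Qed.

Lemma tcls_catC s t : tcls (s ++ t) = tcls (t ++ s).
Proof. exact/tclsP/teq_comm. Qed.

End TensorDef.

Lemma tensor_eq_map (M M' : lmodType R^c) (N N' : lmodType R) (g : M -> M') (h : N -> N') :
  {morph g : x y / x + y} -> {morph h : x y / x + y} ->
  (forall (r : R) m n,
    @tensor_eq M' N' [:: (g ((r : R^c) *: m), h n)] [:: (g m, h (r *: n))]) ->
  forall s t, @tensor_eq M N s t ->
    @tensor_eq M' N' [seq (g p.1, h p.2) | p <- s] [seq (g p.1, h p.2) | p <- t].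
Proof.
move=> gD hD bal s t; elim=> {s t}.
- by move=> s; apply: teq_refl.
- by move=> s t _; apply: teq_sym.
- by move=> s t u _ H1 _ H2; apply: teq_trans H1 H2.
- by move=> s s' t t' _ H1 _ H2; rewrite !map_cat; apply: teq_cat.
- by move=> s t; rewrite !map_cat; apply: teq_comm.
- by move=> m m' n /=; rewrite gD; apply: teq_Dl.
- by move=> m n n' /=; rewrite hD; apply: teq_Dr.
- move=> n /=; have -> : g 0 = 0 by apply: (addrI (g 0)); rewrite -gD !addr0.
  exact: teq_0.
- by move=> r m n /=; apply: bal.
Qed.

Section TensorModule.
Variables (M : lmodType R^c) (N : lmodType R).
Local Notation tensor := (tensor M N).
Local Notation tcls := (@tcls M N).

Definition tneg (s : seq (M * N)) := [seq (- p.1, p.2) | p <- s].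
Definition tscale (a : k) (s : seq (M * N)) :=
  [seq (p.1, kalg_in R a *: p.2) | p <- s].

Lemma tneg_eq s t : tcls s = tcls t -> tcls (tneg s) = tcls (tneg t).
Proof.
move=> /tclsP H; apply/tclsP.
apply: (tensor_eq_map (g := -%R) (h := id)) H => // [x y|r m n].
  by rewrite opprD.
by rewrite -scalerN; apply: teq_bal.
Qed.

Lemma tscale_eq a s t : tcls s = tcls t -> tcls (tscale a s) = tcls (tscale a t).
Proof.
move=> /tclsP H; apply/tclsP.
apply: (tensor_eq_map (g := id) (h := fun n => kalg_in R a *: n)) H => //.
  by move=> x y; rewrite scalerDr.
by move=> r m n; rewrite scalerA kalg_central -scalerA; apply: teq_bal.
Qed.

Definition tens_add (p q : tensor) : tensor := tcls (repr p ++ repr q).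
Definition tens_opp (p : tensor) : tensor := tcls (tneg (repr p)).
Definition tens_zero : tensor := tcls [::].
Definition tens_scale (a : k) (p : tensor) : tensor := tcls (tscale a (repr p)).

Lemma tcls_repr p : tcls (repr p) = p.
Proof. by rewrite /tcls reprK. Qed.

Lemma tens_addE s t : tens_add (tcls s) (tcls t) = tcls (s ++ t).
Proof. by apply: tcls_cat; rewrite tcls_repr. Qed.
Lemma tens_oppE s : tens_opp (tcls s) = tcls (tneg s).
Proof. by apply: tneg_eq; rewrite tcls_repr. Qed.
Lemma tens_scaleE a s : tens_scale a (tcls s) = tcls (tscale a s).
Proof. by apply: tscale_eq; rewrite tcls_repr. Qed.

Lemma tens_addA : associative tens_add.
Proof.
move=> p q r; have [s ->] := tclsE p; have [t ->] := tclsE q.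
by have [u ->] := tclsE r; rewrite !tens_addE catA.
Qed.

Lemma tens_addC : commutative tens_add.
Proof. by move=> p q; apply: tcls_catC. Qed.

Lemma tens_add0 : left_id tens_zero tens_add.
Proof. by move=> p; have [s ->] := tclsE p; rewrite tens_addE. Qed.

Lemma tens_addN : left_inverse tens_zero tens_opp tens_add.
Proof.
move=> p; have [s ->] := tclsE p; rewrite tens_oppE.
elim: s => [|[m n] s IH]; first by rewrite tens_addE.
rewrite [tneg _]/= -cat1s -[(m, n) :: s]cat1s -!tens_addE.
rewrite -tens_addA [tens_add (tcls (tneg s)) _]tens_addC -!tens_addA.
rewrite [tens_add (tcls s) _]tens_addC IH tens_addA [RHS]/tens_zero.
rewrite !tens_addE cats0 /=.
apply/tclsP/(teq_trans (teq_sym (teq_Dl _ _ _))).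
by rewrite addNr; apply: teq_0.
Qed.

HB.instance Definition _ :=
  GRing.isZmodule.Build tensor tens_addA tens_addC tens_add0 tens_addN.

Lemma tclsD s t : tcls (s ++ t) = tcls s + tcls t.
Proof. by rewrite -[RHS]/(tens_add _ _) tens_addE. Qed.

Definition pure (m : M) (n : N) : tensor := tcls [:: (m, n)].

Lemma pureDl m m' n : pure (m + m') n = pure m n + pure m' n.
Proof. by rewrite -tclsD; apply/tclsP/teq_Dl. Qed.
Lemma pureDr m n n' : pure m (n + n') = pure m n + pure m n'.
Proof. by rewrite -tclsD; apply/tclsP/teq_Dr. Qed.
Lemma pure0l n : pure 0 n = 0.
Proof. exact/tclsP/teq_0. Qed.
Lemma pure_bal (r : R) m n : pure ((r : R^c) *: m) n = pure m (r *: n).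
Proof. exact/tclsP/teq_bal. Qed.

Lemma tcls_sum s : tcls s = \sum_(p <- s) pure p.1 p.2.
Proof.
elim: s => [|[m n] s IH]; first by rewrite big_nil.
by rewrite big_cons -cat1s tclsD IH.
Qed.

Lemma tensor_ind (P : tensor -> Prop) :
  P 0 -> (forall m n, P (pure m n)) ->
  (forall p q, P p -> P q -> P (p + q)) -> forall p, P p.
Proof.
move=> P0 P1 PD p; have [s ->] := tclsE p; elim: s => [|[m n] s IH].
  exact: P0.
by rewrite -cat1s tclsD; apply: PD => //; apply: P1.
Qed.

Lemma tens_scaleDr : right_distributive tens_scale +%R.
Proof.
move=> a p q; have [s ->] := tclsE p; have [t ->] := tclsE q.
by rewrite -tclsD !tens_scaleE /tscale map_cat tclsD.
Qed.

Lemma tens_scale_pure a m n :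
  tens_scale a (pure m n) = pure m (kalg_in R a *: n).
Proof. by rewrite tens_scaleE. Qed.

Lemma tens_scale0 a : tens_scale a 0 = 0.
Proof. by rewrite -[0 : tensor]/(tcls [::]) tens_scaleE. Qed.

Lemma tens_scaleA a b v : tens_scale a (tens_scale b v) = tens_scale (a * b) v.
Proof.
elim/tensor_ind: v => [|m n|p q Hp Hq]; first by rewrite !tens_scale0.
  by rewrite !tens_scale_pure scalerA rmorphM.
by rewrite !tens_scaleDr Hp Hq.
Qed.

Lemma tens_scale1 : left_id 1 tens_scale.
Proof.
move=> v; elim/tensor_ind: v => [|m n|p q Hp Hq]; first by rewrite !tens_scale0.
  by rewrite tens_scale_pure rmorph1 scale1r.
by rewrite tens_scaleDr Hp Hq.
Qed.

Lemma tens_scaleDl v : {morph tens_scale^~ v : a b / a + b}.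
Proof.
move=> a b /=; elim/tensor_ind: v => [|m n|p q Hp Hq].
- by rewrite !tens_scale0 addr0.
- by rewrite !tens_scale_pure rmorphD scalerDl pureDr.
- by rewrite !tens_scaleDr Hp Hq addrACA.
Qed.

HB.instance Definition _ := GRing.Zmodule_isLmodule.Build k tensor
  tens_scaleA tens_scale1 tens_scaleDr tens_scaleDl.

Lemma scale_pure (a : k) m n : a *: pure m n = pure m (kalg_in R a *: n).
Proof. exact: tens_scale_pure. Qed.

(* The universal property for balanced biadditive maps. *)
Section Lift.
Variables (A : zmodType) (b : M -> N -> A).
Hypothesis bDl : forall m m' n, b (m + m') n = b m n + b m' n.
Hypothesis bDr : forall m n n', b m (n + n') = b m n + b m n'.
Hypothesis b_bal : forall (r : R) m n, b ((r : R^c) *: m) n = b m (r *: n).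

Definition tlift (p : tensor) : A := \sum_(q <- repr p) b q.1 q.2.

Lemma tlift_eq s t : tensor_eq s t ->
  \sum_(q <- s) b q.1 q.2 = \sum_(q <- t) b q.1 q.2.
Proof.
elim=> {s t} [|s t _ ->|s t u _ -> _ ->|s s' t t' _ H1 _ H2|s t|||n|] //.
- by rewrite !big_cat /= H1 H2.
- by rewrite !big_cat /= addrC.
- by move=> m m' n; rewrite !big_cons !big_nil !addr0 bDl.
- by move=> m n n'; rewrite !big_cons !big_nil !addr0 bDr.
- rewrite !big_cons !big_nil addr0 /=.
  by apply: (addrI (b 0 n)); rewrite -bDl !addr0.
- by move=> r m n; rewrite !big_cons !big_nil !addr0 b_bal.
Qed.

Lemma tlift_cls s : tlift (tcls s) = \sum_(q <- s) b q.1 q.2.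
Proof. exact/tlift_eq/tclsP/tcls_repr. Qed.

Lemma tlift_pure m n : tlift (pure m n) = b m n.
Proof. by rewrite tlift_cls big_seq1. Qed.

Lemma tliftD p q : tlift (p + q) = tlift p + tlift q.
Proof.
have [s ->] := tclsE p; have [t ->] := tclsE q.
by rewrite -tclsD !tlift_cls big_cat.
Qed.

End Lift.
End TensorModule.

Section TensorMap.
Variables (M M' : lmodType R^c) (N N' : lmodType R).
Variables (g : {linear M -> M'}) (h : {linear N -> N'}).

Definition tensor_map : tensor M N -> tensor M' N' :=
  tlift (fun m n => pure (g m) (h n)).

Lemma tensor_mapE m n : tensor_map (pure m n) = pure (g m) (h n).
Proof.
apply: tlift_pure => [x y z|x y z|r x y]; first by rewrite linearD pureDl.
  by rewrite linearD pureDr.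
by rewrite !linearZ pure_bal.
Qed.

Lemma tensor_mapD p q :
  tensor_map (p + q) = tensor_map p + tensor_map q.
Proof.
apply: tliftD => [x y z|x y z|r x y]; first by rewrite linearD pureDl.
  by rewrite linearD pureDr.
by rewrite !linearZ pure_bal.
Qed.

Lemma tensor_map_linear : linear tensor_map.
Proof.
move=> a p q; rewrite tensor_mapD; congr (_ + _).
elim/tensor_ind: p => [|m n|p p' Hp Hp'].
- rewrite scaler0; suff -> : tensor_map 0 = 0 by rewrite scaler0.
  by apply: (addrI (tensor_map 0)); rewrite -tensor_mapD !addr0.
- by rewrite scale_pure !tensor_mapE scale_pure linearZ.
- by rewrite scalerDr !tensor_mapD Hp Hp' scalerDr.
Qed.

HB.instance Definition _ := GRing.isLinear.Build k (tensor M N) (tensor M' N')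
  *:%R tensor_map tensor_map_linear.

End TensorMap.

Lemma tensor_ext M N (A : lmodType k) (f g : {linear tensor M N -> A}) :
  (forall m n, f (pure m n) = g (pure m n)) -> f =1 g.
Proof.
move=> H t; elim/tensor_ind: t => [|m n|p q Hp Hq]; rewrite ?linear0 ?linearD //.
by rewrite Hp Hq.
Qed.

End Tensor.

Section Resolutions.
Variable S : pzRingType.

(* ... -> F 1 -> F 0 -> N -> 0 exact, all F n in the class Q *)
Record left_resolution (Q : lmodType S -> Prop) (N : lmodType S) :=
  LeftResolution {
  lr_obj :> nat -> lmodType S;
  lr_d : forall n, {linear lr_obj n.+1 -> lr_obj n};
  lr_aug : {linear lr_obj 0 -> N};
  lr_class : forall n, Q (lr_obj n);
  lr_aug_surj : forall x, exists y, lr_aug y = x;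
  lr_exact_aug : exact_seq (lr_d 0) lr_aug;
  lr_exact : forall n, exact_seq (lr_d n.+1) (lr_d n) }.

Definition projective_resolution := left_resolution (@projective_module S).

(* 0 -> N -> I 0 -> I 1 -> ... exact, all I n injective *)
Record injective_resolution (N : lmodType S) := InjectiveResolution {
  ir_obj :> nat -> lmodType S;
  ir_d : forall n, {linear ir_obj n -> ir_obj n.+1};
  ir_aug : {linear N -> ir_obj 0};
  ir_injective : forall n, injective_module (ir_obj n);
  ir_aug_inj : injective ir_aug;
  ir_exact_aug : exact_seq ir_aug (ir_d 0);
  ir_exact : forall n, exact_seq (ir_d n) (ir_d n.+1) }.

End Resolutions.

Section Flat.
Variables (k : comPzRingType) (R : kalgebra k).

Definition flat_module (F : lmodType R) : Prop :=
  forall (A B C : lmodType R^c) (f : {linear A -> B}) (g : {linear B -> C}),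
    short_exact f g -> short_exact (tensor_map f (idfun : {linear F -> F}))
                                   (tensor_map g (idfun : {linear F -> F})).

Definition flat_dim_le (N : lmodType R) (d : nat) : Prop :=
  exists F : left_resolution flat_module N,
    forall n, (d < n)%N -> forall x : F n, x = 0.

Definition sfli_le (d : nat) : Prop :=
  forall E : lmodType R, injective_module E -> flat_dim_le E d.

Definition sfli_finite : Prop := exists d, sfli_le d.

End Flat.

Section Functors.
Variables (R : pzRingType) (k : comPzRingType).

Record functor := Functor {
  fobj :> lmodType R -> lmodType k;
  fmap : forall A B : lmodType R, {linear A -> B} -> {linear fobj A -> fobj B};
  fmap_id : forall (A : lmodType R) x, fmap (idfun : {linear A -> A}) x = x;
  fmap_comp : forall (A B C : lmodType R) (g : {linear B -> C})
    (f : {linear A -> B}) x,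
    fmap (g \o f : {linear A -> C}) x = fmap g (fmap f x) }.

Record nat_trans (F G : functor) := NatTrans {
  nt_map :> forall N : lmodType R, {linear F N -> G N};
  nt_natural : forall (A B : lmodType R) (f : {linear A -> B}) x,
    nt_map B (fmap F f x) = fmap G f (nt_map A x) }.

Definition functor_iso (F G : functor) : Prop :=
  exists t : nat_trans F G, forall N, bijective (t N).

(* A homological functor: a family of functors indexed by int with natural
   connecting maps T_(n+1) C -> T_n A that make, for each short exact sequence
   0 -> A -> B -> C -> 0, a long exact sequence.  The index n + 1 is written
   1 + n so that it reduces on nonnegative n. *)
Record homological_functor := HomologicalFunctor {
  hf_fun :> int -> functor;
  hf_conn : forall n (A B C : lmodType R) (f : {linear A -> B})
    (g : {linear B -> C}), short_exact f g ->
    {linear hf_fun (1 + n) C -> hf_fun n A};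
  hf_natural : forall n (A B C A' B' C' : lmodType R)
    (f : {linear A -> B}) (g : {linear B -> C}) (fg : short_exact f g)
    (f' : {linear A' -> B'}) (g' : {linear B' -> C'})
    (fg' : short_exact f' g')
    (a : {linear A -> A'}) (b : {linear B -> B'}) (c : {linear C -> C'}),
    (forall x, b (f x) = f' (a x)) -> (forall x, c (g x) = g' (b x)) ->
    forall z, hf_conn n fg' (fmap (hf_fun (1 + n)) c z)
              = fmap (hf_fun n) a (hf_conn n fg z);
  hf_exact_mid : forall n (A B C : lmodType R) (f : {linear A -> B})
    (g : {linear B -> C}), short_exact f g ->
    exact_seq (fmap (hf_fun n) f) (fmap (hf_fun n) g);
  hf_exact_right : forall n (A B C : lmodType R) (f : {linear A -> B})
    (g : {linear B -> C}) (fg : short_exact f g),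
    exact_seq (fmap (hf_fun (1 + n)) g) (hf_conn n fg);
  hf_exact_left : forall n (A B C : lmodType R) (f : {linear A -> B})
    (g : {linear B -> C}) (fg : short_exact f g),
    exact_seq (hf_conn n fg) (fmap (hf_fun n) f) }.

Record hf_morphism (U T : homological_functor) := HfMorphism {
  hm_map :> forall n, nat_trans (U n) (T n);
  hm_conn : forall n (A B C : lmodType R) (f : {linear A -> B})
    (g : {linear B -> C}) (fg : short_exact f g) z,
    hm_map n A (hf_conn U n fg z) = hf_conn T n fg (hm_map (1 + n) C z) }.

Definition vanishes_on_injectives (U : homological_functor) : Prop :=
  forall n (E : lmodType R), injective_module E -> forall x : U n E, x = 0.

(* Families of functors are homological functors here, and their morphisms
   commute with the connecting maps.  For families of unrelated functors the
   condition below would define ker (T_n N -> T_n E), with N -> E an embedding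
   in an injective module; for T = Tor this is 0 in all degrees n < 0. *)
Definition is_J_completion (T Tc : homological_functor)
    (tau : hf_morphism Tc T) : Prop :=
  vanishes_on_injectives Tc /\
  forall (U : homological_functor) (upsilon : hf_morphism U T),
    vanishes_on_injectives U ->
    exists sigma : hf_morphism U Tc,
      (forall n N x, tau n N (sigma n N x) = upsilon n N x) /\
      forall sigma' : hf_morphism U Tc,
        (forall n N x, tau n N (sigma' n N x) = upsilon n N x) ->
        forall n N x, sigma' n N x = sigma n N x.

End Functors.

Lemma big_support (T : eqType) (V : zmodType) (f : T -> V) (s t : seq T) :
  uniq s -> uniq t -> (forall q, q \notin s -> f q = 0) ->
  (forall q, q \notin t -> f q = 0) -> \sum_(q <- s) f q = \sum_(q <- t) f q.
Proof.
move=> us ut Hs Ht.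
have red r : \sum_(q <- r) f q = \sum_(q <- [seq q <- r | f q != 0]) f q.
  rewrite big_filter (bigID (fun q => f q == 0)) /= big1 ?add0r //.
  by move=> q /eqP.
rewrite (red s) (red t); apply/perm_big/uniq_perm; rewrite ?filter_uniq //.
move=> q; rewrite !mem_filter; case: eqP => //= /eqP fq.
have -> : q \in s by apply: contraNT fq => /Hs ->.
by have -> : q \in t by apply: contraNT fq => /Ht ->.
Qed.

Section DualBasis.
Variables (S : pzRingType) (P : lmodType S).

Let V := fun _ : P => (S^o : lmodType S).

Definition sub0 (W : lmodType S) : submodule W.
Proof.
refine (@Submodule S W (fun x => x = 0) _ _ _) => //.
- by move=> x y -> ->; rewrite addr0.
- by move=> a x ->; rewrite scaler0.
Defined.

Let F : lmodType S := subquot (finsupp V) (sub0 (dprod V)).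

Let coef (x : F) : P -> S := fun q => (rep x : dprod V) q.

Let coef_lin a x y q : coef (a *: x + y) q = a * coef x q + coef y q.
Proof.
rewrite /coef; have [x' Zx ->] := subquotP x; have [y' Zy ->] := subquotP y.
rewrite -cls_lin //.
have E z : finsupp V z -> rep (cls (finsupp V) (sub0 _) z) = z.
  by move=> Zz; exact: (subr0_eq (rep_cls (sub0 (dprod V)) Zz)).
by rewrite !E //; apply: smemD => //; apply: smemZ.
Qed.

Let supp (x : F) : {s : seq P | uniq s /\ forall q, q \notin s -> coef x q = 0}.
Proof.
apply: cid; have [s Hs] := repP x.
by exists (undup s); rewrite undup_uniq; split=> // q; rewrite mem_undup => /Hs.
Qed.

Let tot (x : F) : P := \sum_(q <- sval (supp x)) coef x q *: q.

Let totE x s : uniq s -> (forall q, q \notin s -> coef x q = 0) ->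
  tot x = \sum_(q <- s) coef x q *: q.
Proof.
move=> us Hs; rewrite /tot; case: (supp x) => t [ut Ht] /=.
by apply: big_support => // q; [move/Ht | move/Hs] => ->; rewrite scale0r.
Qed.

Let tot_linear : linear tot.
Proof.
move=> a x y.
have [s1 [_ H1]] := supp x; have [s2 [_ H2]] := supp y.
pose s := undup (s1 ++ s2).
have Hs q : q \notin s -> (coef x q = 0) /\ (coef y q = 0).
  by rewrite mem_undup mem_cat negb_or => /andP[/H1 ? /H2 ?].
have us : uniq s by apply: undup_uniq.
rewrite (totE us); last first.
  by move=> q /Hs[xq yq]; rewrite coef_lin xq yq mulr0 addr0.
rewrite (totE (x := x) us) => [|q /Hs[] //].
rewrite (totE (x := y) us) => [|q /Hs[] //].
rewrite scaler_sumr -big_split; apply: eq_bigr => q _ /=.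
by rewrite coef_lin scalerDl scalerA.
Qed.

Let tot_surj p : exists x, mk_linear tot_linear x = p.
Proof.
pose e : dprod V := fun q => (q == p)%:R.
have Ze : finsupp V e.
  by exists [:: p] => q; rewrite inE /e => /negbTE ->.
pose x : F := cls _ _ e; exists x.
have xE q : coef x q = (q == p)%:R.
  have : rep x = e by exact: (subr0_eq (rep_cls (sub0 (dprod V)) Ze)).
  by rewrite /coef => ->.
rewrite mk_linearE (@totE _ [:: p]) // => [|q].
  by rewrite big_seq1 xE eqxx scale1r.
by rewrite inE xE => /negbTE ->.
Qed.

Lemma dual_basis : projective_module P -> exists phi : P -> P -> S,
  (forall q a x y, phi (a *: x + y) q = a * phi x q + phi y q) /\
  (forall x, exists s, [/\ uniq s, forall q, q \notin s -> phi x q = 0 &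
                           x = \sum_(q <- s) phi x q *: q]).
Proof.
move=> proj; have [w Hw] := proj _ _ (mk_linear tot_linear) idfun tot_surj.
exists (fun x => coef (w x)); split=> [q a x y|x].
  by rewrite linearP coef_lin.
have [s [us Hs]] := supp (w x); exists s; split=> //.
by rewrite -(totE us Hs); have /= -> := Hw x.
Qed.

End DualBasis.

Section ProjectiveTensor.
Variables (k : comPzRingType) (R : kalgebra k) (P : lmodType R^c).
Hypothesis proj : projective_module P.

Lemma proj_coords : exists c : forall N : lmodType R, P -> tensor P N -> N,
  [/\ forall N q, {morph c N q : x y / x + y},
      forall (N N' : lmodType R) (f : {linear N -> N'}) q t,
        c N' q (tensor_map (idfun : {linear P -> P}) f t) = f (c N q t) &
      forall N t, exists s,
        [/\ uniq s, forall q, q \notin s -> c N q t = 0 &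
            t = \sum_(q <- s) pure q (c N q t)]].
Proof.
have [phi [phiL phiS]] := dual_basis proj.
have phiD q x y : phi (x + y) q = phi x q + phi y q.
  by rewrite -[x]scale1r phiL mul1r scale1r.
have phi0 q : phi 0 q = 0 by apply: (addrI (phi 0 q)); rewrite -phiD !addr0.
have phiZ q a x : phi (a *: x) q = a * phi x q.
  by rewrite -[a *: x]addr0 phiL phi0 addr0.
pose b q (N : lmodType R) m (n : N) : N := (phi m q : R) *: n.
have bDl q N m m' n : b q N (m + m') n = b q N m n + b q N m' n.
  by rewrite /b phiD scalerDl.
have bDr q N m n n' : b q N m (n + n') = b q N m n + b q N m n'.
  by rewrite /b scalerDr.
have bbal q N (r : R) m n : b q N ((r : R^c) *: m) n = b q N m (r *: n).
  by rewrite /b phiZ scalerA.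
pose c (N : lmodType R) q (t : tensor P N) := tlift (b q N) t.
have cD N q : {morph c N q : x y / x + y} by exact: (tliftD (bDl q N) (bDr q N) (bbal q N)).
have c0 N q : c N q 0 = 0 by apply: (addrI (c N q 0)); rewrite -cD !addr0.
have cp N q m n : c N q (pure m n) = (phi m q : R) *: n by exact: (tlift_pure (bDl q N) (bDr q N) (bbal q N)).
exists c; split=> // [N N' f q t|N t].
  elim/tensor_ind: t => [|m n|x y Hx Hy]; first by rewrite linear0 !c0 linear0.
    by rewrite /= tensor_mapE !cp linearZ.
  by rewrite !linearD !cD Hx Hy linearD.
elim/tensor_ind: t => [|m n|x y].
- by exists [::]; split=> // [q _|]; rewrite ?c0 ?big_nil.
- have [s [us Hs Es]] := phiS m; exists s; split=> // [q /Hs E|].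
    by rewrite cp E scale0r.
  have pure_sum r : pure (\sum_(q <- r) phi m q *: q) n
                    = \sum_(q <- r) pure (phi m q *: q) n.
    by elim: r => [|q r IH]; rewrite ?big_nil ?pure0l // !big_cons pureDl IH.
  rewrite {1}Es pure_sum; apply: eq_bigr => q _.
  by rewrite pure_bal cp.
- move=> [s1 [us1 H1 E1]] [s2 [us2 H2 E2]].
  pose s := undup (s1 ++ s2).
  have us : uniq s by apply: undup_uniq.
  have Hs q : q \notin s -> (c N q x = 0) /\ (c N q y = 0).
    by rewrite mem_undup mem_cat negb_or => /andP[/H1 ? /H2 ?].
  have pure0r m : pure m 0 = 0 :> tensor P N.
    by apply: (addrI (pure m 0)); rewrite -pureDr !addr0.
  exists s; split=> // [q /Hs[xq yq]|]; first by rewrite cD xq yq addr0.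
  rewrite {1}E1 {1}E2.
  rewrite (@big_support _ _ _ s1 s) //; first last.
  + by move=> q /Hs[-> _]; apply: pure0r.
  + by move=> q /H1->; apply: pure0r.
  rewrite (@big_support _ _ _ s2 s) //; first last.
  + by move=> q /Hs[_ ->]; apply: pure0r.
  + by move=> q /H2->; apply: pure0r.
  by rewrite -big_split; apply: eq_bigr => q _; rewrite cD pureDr.
Qed.

Lemma proj_flat (A B C : lmodType R) (f : {linear A -> B})
    (g : {linear B -> C}) : short_exact f g ->
  short_exact (tensor_map (idfun : {linear P -> P}) f)
              (tensor_map (idfun : {linear P -> P}) g).
Proof.
have [c [cD cM cS]] := proj_coords.
have c0 N q : c N q 0 = 0 by apply: (addrI (c N q 0)); rewrite -cD !addr0.
case=> finj fg gsurj.
have gf x : g (f x) = 0 by apply/fg; exists x.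
split.
- apply: raddf_inj => t Ht; have [s [_ _ ->]] := cS _ t.
  apply: big1_seq => q _; suff -> : c A q t = 0.
    by apply: (addrI (pure q 0)); rewrite -pureDr !addr0.
  by apply: finj; rewrite -cM Ht c0 linear0.
- move=> t; split=> [Ht|[u <-]].
    have Hc q : exists a, f a = c B q t by apply/fg; rewrite -cM Ht c0.
    have [s [_ _ Es]] := cS _ t.
    exists (\sum_(q <- s) pure q (sval (cid (Hc q)))).
    rewrite linear_sum [RHS]Es; apply: eq_bigr => q _ /=.
    by rewrite /= tensor_mapE; case: cid => a /= ->.
  elim/tensor_ind: u => [|m n|x y Hx Hy]; first by rewrite !linear0.
    rewrite /= !tensor_mapE gf.
    by apply: (addrI (pure m 0)); rewrite -pureDr !addr0.
  by rewrite !linearD Hx Hy addr0.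
- move=> t; elim/tensor_ind: t => [|m n|x y [x' <-] [y' <-]].
  + by exists 0; rewrite linear0.
  + by have [b <-] := gsurj n; exists (pure m b); rewrite /= tensor_mapE.
  + by exists (x' + y'); rewrite linearD.
Qed.

End ProjectiveTensor.

Section KerIm.
Variables (S : pzRingType) (A B : lmodType S) (f : {linear A -> B}).

Definition kerS : submodule A.
Proof.
refine (@Submodule S A (fun x => f x = 0) (linear0 f) _ _) => [x y Hx Hy|a x Hx].
  by rewrite linearD Hx Hy addr0.
by rewrite linearZ Hx /= scaler0.
Defined.

Definition imS : submodule B.
Proof.
refine (@Submodule S B (fun y => exists x, f x = y) _ _ _).
- by exists 0; rewrite linear0.
- by move=> _ _ [x <-] [y <-]; exists (x + y); rewrite linearD.
- by move=> a _ [x <-]; exists (a *: x); rewrite linearZ.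
Defined.

End KerIm.

Section Complexes.
Variable S : pzRingType.

Record chain_complex := ChainComplex {
  cc_obj :> nat -> lmodType S;
  cc_d : forall n, {linear cc_obj n.+1 -> cc_obj n};
  cc_dd : forall n x, cc_d n (cc_d n.+1 x) = 0 }.

Record chain_map (X Y : chain_complex) := ChainMap {
  cm_map :> forall n, {linear X n -> Y n};
  cm_comm : forall n x, cm_map n (cc_d X n x) = cc_d Y n (cm_map n.+1 x) }.

Definition cycles (X : chain_complex) n : submodule (X n) :=
  if n is m.+1 return submodule (X n) then kerS (cc_d X m) else subT.

Definition boundaries (X : chain_complex) n : submodule (X n) :=
  imS (cc_d X n).

Definition homology (X : chain_complex) n : lmodType S :=
  subquot (cycles X n) (boundaries X n).

Section Map.
Variables (X Y : chain_complex) (f : chain_map X Y).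

Lemma map_cycles n x : cycles X n x -> cycles Y n (f n x).
Proof. by case: n x => //= n x Hx; rewrite -cm_comm Hx linear0. Qed.

Lemma map_boundaries n x : cycles X n x -> boundaries X n x ->
  boundaries Y n (f n x).
Proof. by move=> _ [y <-]; exists (f n.+1 y); rewrite cm_comm. Qed.

Definition homology_map n : {linear homology X n -> homology Y n} :=
  sqmap (@map_cycles n) (@map_boundaries n).

Lemma homology_mapE n x : cycles X n x ->
  homology_map n (cls (cycles X n) (boundaries X n) x)
  = cls (cycles Y n) (boundaries Y n) (f n x).
Proof. by move=> Hx; apply: (sqmap_cls (@map_cycles n) (@map_boundaries n)). Qed.

End Map.

Local Notation hcls X n x := (cls (cycles X n) (boundaries X n) x).

Section Connecting.
Variables (X Y Z : chain_complex) (f : chain_map X Y) (g : chain_map Y Z).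
Hypothesis fg : forall n, short_exact (f n) (g n).

Lemma gf0 n x : g n (f n x) = 0.
Proof. by case: (fg n) => _ E _; apply/E; exists x. Qed.

Lemma d_cycles (W : chain_complex) n y : cycles W n (cc_d W n y).
Proof. by case: n y => //= n y; apply: cc_dd. Qed.

Lemma cycles_inj n x : cycles Y n (f n x) -> cycles X n x.
Proof.
case: n x => //= n x dx; case: (fg n) => fi _ _.
by apply: fi; rewrite cm_comm dx linear0.
Qed.

Definition snake n (z : Z n.+1) (x : X n) : Prop :=
  exists2 y, g n.+1 y = z & f n x = cc_d Y n y.

Lemma snake_ex n z : cycles Z n.+1 z -> exists x, snake z x.
Proof.
case: (fg n.+1) => _ _ gs; have [y gy] := gs z; move=> /= dz.
case: (fg n) => _ E _; have /E[x fx] : g n (cc_d Y n y) = 0.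
  by rewrite cm_comm gy.
by exists x, y.
Qed.

Lemma snake_cycle n (z : Z n.+1) x : snake z x -> cycles X n x.
Proof.
by move=> [y _ fx]; apply: cycles_inj; rewrite fx; apply: d_cycles.
Qed.

Lemma snake_lin n a (z z' : Z n.+1) x x' :
  snake z x -> snake z' x' -> snake (a *: z + z') (a *: x + x').
Proof.
move=> [y gy fx] [y' gy' fx']; exists (a *: y + y').
  by rewrite linearP gy gy'.
by rewrite !linearP fx fx'.
Qed.

Lemma snake_boundary n (z : Z n.+1) x :
  boundaries Z n.+1 z -> snake z x -> boundaries X n x.
Proof.
move=> [z' dz'] [y gy fx]; case: (fg n.+2) => _ _ gs; have [y' gy'] := gs z'.
case: (fg n.+1) => _ E _.
have /E[x' fx'] : g n.+1 (y - cc_d Y n.+1 y') = 0.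
  by rewrite linearB gy cm_comm gy' dz' subrr.
exists x'; case: (fg n) => fi _ _; apply: fi.
by rewrite cm_comm fx' linearB cc_dd subr0.
Qed.

Definition conn_fun n (q : homology Z n.+1) : homology X n :=
  hcls X n (sval (cid (snake_ex (repP q)))).

Lemma conn_cls n z x : cycles Z n.+1 z -> snake z x ->
  conn_fun (hcls Z n.+1 z) = hcls X n x.
Proof.
move=> Zz zx; rewrite /conn_fun; case: cid => x' /= zx'.
apply/cls_eq; [exact: snake_cycle zx' | exact: snake_cycle zx |].
have := snake_lin (-1) zx zx'; rewrite !scaleN1r ![- _ + _]addrC.
by apply: snake_boundary; apply: rep_cls.
Qed.

Lemma conn_linear n : linear (@conn_fun n).
Proof.
move=> a p q; have [z Zz ->] := subquotP p; have [z' Zz' ->] := subquotP q.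
have [x Hx] := snake_ex Zz; have [x' Hx'] := snake_ex Zz'.
have Zs : cycles Z n.+1 (a *: z + z') by apply: smemD => //; apply: smemZ.
rewrite -cls_lin // (conn_cls Zs (snake_lin a Hx Hx')).
by rewrite (conn_cls Zz Hx) (conn_cls Zz' Hx') cls_lin //; apply: snake_cycle;
  eassumption.
Qed.

Definition conn n : {linear homology Z n.+1 -> homology X n} :=
  mk_linear (@conn_linear n).

Lemma connE n z x : cycles Z n.+1 z -> snake z x ->
  conn n (hcls Z n.+1 z) = hcls X n x.
Proof. exact: conn_cls. Qed.

Lemma les_mid n : exact_seq (homology_map f n) (homology_map g n).
Proof.
case: (fg n) => fi E gs p; split.
  have [y Zy ->] := subquotP p; rewrite homology_mapE //.
  move/(cls_eq0 _ (map_cycles g Zy)) => [z dz].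
  case: (fg n.+1) => _ _ gs'; have [y' gy'] := gs' z.
  have /E[x fx] : g n (y - cc_d Y n y') = 0.
    by rewrite linearB cm_comm gy' dz subrr.
  have Zx : cycles X n x.
    apply: cycles_inj; rewrite fx; apply: smemB => //; exact: d_cycles.
  exists (hcls X n x); rewrite homology_mapE //.
  apply/cls_eq => //; first exact: map_cycles.
  by rewrite fx; exists (- y'); rewrite linearN addrAC subrr add0r.
case=> q <-; have [x Zx ->] := subquotP q.
rewrite !homology_mapE //; last exact: map_cycles.
by apply/cls_eq0; rewrite gf0; [apply: smem0|exists 0; rewrite linear0].
Qed.

Lemma les_right n : exact_seq (homology_map g n.+1) (conn n).
Proof.
move=> p; split.
  have [z Zz ->] := subquotP p; have [x Hx] := snake_ex Zz.
  rewrite (connE Zz Hx) => /(cls_eq0 _ (snake_cycle Hx))[x' dx'].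
  case: Hx => y gy fx; exists (hcls Y n.+1 (y - f n.+1 x')).
  rewrite homology_mapE; first by rewrite linearB gf0 gy subr0.
  by rewrite /= linearB -cm_comm dx' fx subrr.
case=> q <-; have [y Zy ->] := subquotP q.
rewrite homology_mapE // (@connE _ _ 0); last first.
- by exists y; rewrite ?linear0 // Zy.
- exact: map_cycles.
apply/cls_eq0; [exact: smem0 | by exists 0; rewrite linear0].
Qed.

Lemma les_left n : exact_seq (conn n) (homology_map f n).
Proof.
move=> p; split.
  have [x Zx ->] := subquotP p; rewrite homology_mapE //.
  move=> /(cls_eq0 _ (map_cycles f Zx))[y dy].
  have Zz : cycles Z n.+1 (g n.+1 y) by rewrite /= -cm_comm dy gf0.
  by exists (hcls Z n.+1 (g n.+1 y)); rewrite (@connE _ _ x) //; exists y.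
case=> q <-; have [z Zz ->] := subquotP q; have [x Hx] := snake_ex Zz.
rewrite (connE Zz Hx) homology_mapE; last exact: snake_cycle Hx.
apply/cls_eq0; first exact/map_cycles/(snake_cycle Hx).
by case: Hx => y _ fx; exists y.
Qed.

Lemma les_surj : forall p, exists q, homology_map g 0 q = p.
Proof.
move=> p; have [z Zz ->] := subquotP p; case: (fg 0) => _ _ gs.
by have [y <-] := gs z; exists (hcls Y 0 y); rewrite homology_mapE.
Qed.

End Connecting.

Lemma conn_natural X Y Z (f : chain_map X Y) (g : chain_map Y Z)
    (fg : forall n, short_exact (f n) (g n)) X' Y' Z'
    (f' : chain_map X' Y') (g' : chain_map Y' Z')
    (fg' : forall n, short_exact (f' n) (g' n))
    (a : chain_map X X') (b : chain_map Y Y') (c : chain_map Z Z') :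
  (forall n x, b n (f n x) = f' n (a n x)) ->
  (forall n x, c n (g n x) = g' n (b n x)) ->
  forall n z, conn fg' n (homology_map c n.+1 z)
              = homology_map a n (conn fg n z).
Proof.
move=> bf cg n p; have [z Zz ->] := subquotP p; have [x Hx] := snake_ex fg Zz.
rewrite (connE fg Zz Hx) homology_mapE // homology_mapE; last first.
  exact: (snake_cycle fg Hx).
apply: (connE fg' (map_cycles c Zz)).
case: Hx => y gy fx; exists (b n.+1 y); first by rewrite -cg gy.
by rewrite -bf fx cm_comm.
Qed.

End Complexes.

Section Tor.
Variables (k : comPzRingType) (R : kalgebra k) (M : lmodType R^c).
Variable P : projective_resolution M.

Section Object.
Variable N : lmodType R.

Definition tor_d n : {linear tensor (P n.+1) N -> tensor (P n) N} :=
  tensor_map (lr_d P n) (idfun : {linear N -> N}).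

Lemma tor_dd n x : tor_d n (tor_d n.+1 x) = 0.
Proof.
elim/tensor_ind: x => [|p x|x y Hx Hy]; first by rewrite !linear0.
  rewrite /= !tensor_mapE.
  suff -> : lr_d P n (lr_d P n.+1 p) = 0 by apply: pure0l.
  by apply/(@lr_exact _ _ _ P); exists p.
by rewrite !linearD Hx Hy addr0.
Qed.

(* P (x) N *)
Definition tor_complex : chain_complex k :=
  @ChainComplex k (fun n => tensor (P n) N) tor_d tor_dd.

End Object.

Section Map.
Variables (N N' : lmodType R) (f : {linear N -> N'}).

Lemma tor_comm n x :
  tensor_map (idfun : {linear P n -> P n}) f (cc_d (tor_complex N) n x)
  = cc_d (tor_complex N') n
      (tensor_map (idfun : {linear P n.+1 -> P n.+1}) f x).
Proof.
elim/tensor_ind: x => [|p x|x y Hx Hy]; first by rewrite !linear0.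
  by rewrite /= /tor_d /= !tensor_mapE.
by move: Hx Hy; rewrite !linearD /= => -> ->.
Qed.

Definition tor_chain_map : chain_map (tor_complex N) (tor_complex N') :=
  @ChainMap k (tor_complex N) (tor_complex N')
    (fun n => tensor_map (idfun : {linear P n -> P n}) f) tor_comm.

End Map.

Definition tor_obj (i : int) (N : lmodType R) : lmodType k :=
  match i with
  | Posz n => homology (tor_complex N) n
  | Negz _ => 'rV[k]_0
  end.

Definition tor_map (i : int) (N N' : lmodType R) (f : {linear N -> N'}) :
    {linear tor_obj i N -> tor_obj i N'} :=
  match i with
  | Posz n => homology_map (tor_chain_map f) n
  | Negz _ => idfun
  end.

Lemma tor_map_id i (N : lmodType R) x : tor_map i (idfun : {linear N -> N}) x = x.
Proof.
case: i x => // n p; have [x Zx ->] := subquotP p.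
rewrite /tor_map homology_mapE //; congr cls; elim/tensor_ind: x {Zx} => [|q x|x y Hx Hy].
- by rewrite linear0.
- by rewrite /= tensor_mapE.
- by move: Hx Hy; rewrite linearD /= => -> ->.
Qed.

Lemma tor_map_comp i (A B C : lmodType R) (g : {linear B -> C})
    (f : {linear A -> B}) x :
  tor_map i (g \o f : {linear A -> C}) x = tor_map i g (tor_map i f x).
Proof.
case: i x => // n p; have [x Zx ->] := subquotP p.
rewrite /tor_map (homology_mapE (tor_chain_map f) Zx) !homology_mapE //.
  2: exact: map_cycles.
congr cls => /=; elim/tensor_ind: x {Zx} => [|q x|x y Hx Hy].
- by rewrite !linear0.
- by rewrite /= !tensor_mapE.
- by move: Hx Hy; rewrite !linearD /= => -> ->.
Qed.

Definition tor_functor (i : int) : functor R k :=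
  @Functor R k (tor_obj i) (tor_map i) (@tor_map_id i) (@tor_map_comp i).

Lemma tor_short_exact (A B C : lmodType R) (f : {linear A -> B})
    (g : {linear B -> C}) : short_exact f g ->
  forall n, short_exact (tor_chain_map f n) (tor_chain_map g n).
Proof. by move=> fg n; apply: proj_flat => //; apply: (lr_class P). Qed.

Lemma zero_linear (A B : lmodType k) : linear (fun _ : A => 0 : B).
Proof. by move=> a x y; rewrite scaler0 addr0. Qed.

Definition tor_conn (i : int) (A B C : lmodType R) (f : {linear A -> B})
    (g : {linear B -> C}) (fg : short_exact f g) :
    {linear tor_obj (1 + i) C -> tor_obj i A} :=
  match i with
  | Posz n => conn (tor_short_exact fg) n
  | Negz n => mk_linear (@zero_linear _ _)
  end.

Lemma tor_neg n N (x : tor_obj (Negz n) N) : x = 0.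
Proof. exact: thinmx0. Qed.

Lemma tor_conn_natural n (A B C A' B' C' : lmodType R)
    (f : {linear A -> B}) (g : {linear B -> C}) (fg : short_exact f g)
    (f' : {linear A' -> B'}) (g' : {linear B' -> C'})
    (fg' : short_exact f' g')
    (a : {linear A -> A'}) (b : {linear B -> B'}) (c : {linear C -> C'}) :
  (forall x, b (f x) = f' (a x)) -> (forall x, c (g x) = g' (b x)) ->
  forall z, tor_conn n fg' (tor_map (1 + n) c z)
            = tor_map n a (tor_conn n fg z).
Proof.
move=> bf cg; case: n => n z; last by rewrite [RHS]tor_neg [LHS]tor_neg.
apply: (@conn_natural _ _ _ _ _ _ _ _ _ _ _ _ _ _ (tor_chain_map b))
    => {z} m z /=.
  elim/tensor_ind: z => [|p x|x y Hx Hy]; first by rewrite !linear0.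
    by rewrite /= !tensor_mapE /= bf.
  by move: Hx Hy; rewrite !linearD /= => -> ->.
elim/tensor_ind: z => [|p x|x y Hx Hy]; first by rewrite !linear0.
  by rewrite /= !tensor_mapE /= cg.
by move: Hx Hy; rewrite !linearD /= => -> ->.
Qed.

Lemma tor_exact_mid n (A B C : lmodType R) (f : {linear A -> B})
    (g : {linear B -> C}) : short_exact f g ->
  exact_seq (tor_map n f) (tor_map n g).
Proof.
move=> fg; case: n => n; first exact: les_mid (tor_short_exact fg) n.
by move=> y; split=> _; [exists 0; rewrite [RHS]tor_neg linear0|apply: tor_neg].
Qed.

Lemma tor_surj n i (B C : lmodType R) (g : {linear B -> C}) (A : lmodType R)
    (f : {linear A -> B}) : short_exact f g -> i = 1 + Negz n ->
  forall z, exists y, tor_map i g y = z.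
Proof.
move=> fg; case: n => [|n] ->; first exact: les_surj (tor_short_exact fg).
have -> : 1 + Negz n.+1 = Negz n.
  by rewrite !NegzE -(addn1 n.+1) PoszD opprD addrCA addrN addr0.
by move=> z; exists 0; rewrite linear0 [RHS]tor_neg.
Qed.

Lemma tor_exact_right n (A B C : lmodType R) (f : {linear A -> B})
    (g : {linear B -> C}) (fg : short_exact f g) :
  exact_seq (tor_map (1 + n) g) (tor_conn n fg).
Proof.
case: n => n; first exact: les_right (tor_short_exact fg) n.
by move=> z; split=> _; [apply: tor_surj fg erefl _ | apply: tor_neg].
Qed.

Lemma tor_exact_left n (A B C : lmodType R) (f : {linear A -> B})
    (g : {linear B -> C}) (fg : short_exact f g) :
  exact_seq (tor_conn n fg) (tor_map n f).
Proof.
case: n => n; first exact: les_left (tor_short_exact fg) n.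
by move=> y; split=> _; [exists 0; rewrite [RHS]tor_neg linear0|apply: tor_neg].
Qed.

Definition Tor : homological_functor R k :=
  @HomologicalFunctor R k tor_functor tor_conn tor_conn_natural
    tor_exact_mid tor_exact_right tor_exact_left.

End Tor.

Section InjectiveComparison.
Variable S : pzRingType.

Lemma injective_extend (E A B : lmodType S) (u : {linear A -> B})
    (v : {linear A -> E}) : injective_module E ->
  (forall x, u x = 0 -> v x = 0) ->
  exists w : {linear B -> E}, forall x, w (u x) = v x.
Proof.
move=> injE uv; pose Q := subquot subT (kerS u).
have repK (W : lmodType S) (g : {linear A -> W}) x :
    (forall y, u y = 0 -> g y = 0) -> g (rep (cls subT (kerS u) x)) = g x.
  move=> ug; apply/subr0_eq; rewrite -linearB; apply: ug.
  by have := @rep_cls _ _ subT (kerS u) x I.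
have lin (W : lmodType S) (g : {linear A -> W}) :
    (forall y, u y = 0 -> g y = 0) -> linear (fun q : Q => g (rep q)).
  move=> ug a p q; have [x _ ->] := subquotP p; have [y _ ->] := subquotP q.
  by rewrite -cls_lin // !repK // linearP.
have uinj : injective (mk_linear (lin _ u (fun _ => id))).
  apply: raddf_inj => p /=; have [x _ ->] := subquotP p; rewrite repK //.
  by move=> ux; apply/cls_eq0.
have [w Hw] := injE _ _ _ (mk_linear (lin _ v uv)) uinj.
exists w => x; have /= := Hw (cls subT (kerS u) x).
by rewrite !repK.
Qed.

Variables (N N' : lmodType S).
Variables (I : injective_resolution N) (I' : injective_resolution N').

(* a lift of f : N -> N' to a morphism of complexes I -> I' *)
Record cochain_lift (f : {linear N -> N'}) := CochainLift {
  lift_map :> forall n, {linear I n -> I' n};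
  lift_comm : forall n x, lift_map n.+1 (ir_d I n x) = ir_d I' n (lift_map n x);
  lift_aug : forall x, lift_map 0 (ir_aug I x) = ir_aug I' (f x) }.

Lemma ir_dd (N0 : lmodType S) (J : injective_resolution N0) n x :
  ir_d J n.+1 (ir_d J n x) = 0.
Proof. by apply/(@ir_exact _ _ J); exists x. Qed.

Section Existence.
Variable f : {linear N -> N'}.

Let L n := {g : {linear I n -> I' n} |
  forall x, ir_d I n x = 0 -> ir_d I' n (g x) = 0}.

Let L0 : {g : L 0 | forall x, sval g (ir_aug I x) = ir_aug I' (f x)}.
Proof.
apply: cid; have [|g Hg] := @injective_extend (I' 0) _ _ (ir_aug I)
  (ir_aug I' \o f : {linear N -> I' 0}) (@ir_injective _ _ I' 0).
  by move=> x Hx; have -> : x = 0;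
    [apply: (@ir_aug_inj _ _ I); rewrite Hx linear0 | rewrite linear0].
have Pg x : ir_d I 0 x = 0 -> ir_d I' 0 (g x) = 0.
  move/(@ir_exact_aug _ _ I) => [y <-]; rewrite Hg.
  by apply/(@ir_exact_aug _ _ I'); exists (f y).
by exists (exist _ g Pg).
Qed.

Let Lstep n (g : L n) :
  {h : L n.+1 | forall x, sval h (ir_d I n x) = ir_d I' n (sval g x)}.
Proof.
apply: cid; case: g => g Pg /=.
have [|h Hh] := @injective_extend (I' n.+1) _ _ (ir_d I n)
  (ir_d I' n \o g : {linear I n -> I' n.+1}) (@ir_injective _ _ I' n.+1).
  exact: Pg.
have Ph x : ir_d I n.+1 x = 0 -> ir_d I' n.+1 (h x) = 0.
  by move/(@ir_exact _ _ I) => [y <-]; rewrite Hh /= ir_dd.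
by exists (exist _ h Ph).
Qed.

Let Lseq := fix Lseq n : L n :=
  if n is m.+1 return L n then sval (Lstep (Lseq m)) else sval L0.

Lemma lift_exists : exists _ : cochain_lift f, True.
Proof.
have c n x : sval (Lseq n.+1) (ir_d I n x) = ir_d I' n (sval (Lseq n) x).
  by rewrite /=; case: Lstep.
have a x : sval (Lseq 0) (ir_aug I x) = ir_aug I' (f x).
  by rewrite /=; case: L0.
by exists (CochainLift c a).
Qed.

End Existence.

Section Homotopy.
Variables (f : {linear N -> N'}) (phi psi : cochain_lift f).

Let theta n : {linear I n -> I' n} := phi n \- psi n.
Let thetaE n x : theta n x = phi n x - psi n x. Proof. by []. Qed.
Let theta_comm n x : theta n.+1 (ir_d I n x) = ir_d I' n (theta n x).
Proof. by rewrite !thetaE !lift_comm linearB. Qed.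

Let H n := {h : {linear I n.+1 -> I' n} |
  forall x, theta n.+1 (ir_d I n x) = ir_d I' n (h (ir_d I n x))}.

Let H0 : {h : H 0 | forall x, theta 0 x = sval h (ir_d I 0 x)}.
Proof.
apply: cid; have [|h Hh] := @injective_extend (I' 0) _ _ (ir_d I 0) (theta 0)
  (@ir_injective _ _ I' 0).
  move=> x /(@ir_exact_aug _ _ I) [y <-].
  by rewrite thetaE !lift_aug subrr.
have Ph x : theta 1 (ir_d I 0 x) = ir_d I' 0 (h (ir_d I 0 x)).
  by rewrite Hh theta_comm.
by exists (exist _ h Ph).
Qed.

Let Hstep n (h : H n) : {h' : H n.+1 |
  forall x, theta n.+1 x = ir_d I' n (sval h x) + sval h' (ir_d I n.+1 x)}.
Proof.
apply: cid; case: h => h Ph /=.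
pose v : {linear I n.+1 -> I' n.+1} := theta n.+1 \- (ir_d I' n \o h).
have vE x : v x = theta n.+1 x - ir_d I' n (h x) by [].
have [|h' Hh'] := @injective_extend (I' n.+1) _ _ (ir_d I n.+1) v
  (@ir_injective _ _ I' n.+1).
  by move=> x /(@ir_exact _ _ I) [y <-]; rewrite vE Ph subrr.
have Ph' x : theta n.+2 (ir_d I n.+1 x)
             = ir_d I' n.+1 (h' (ir_d I n.+1 x)).
  by rewrite Hh' vE linearB ir_dd subr0 theta_comm.
exists (exist _ h' Ph') => x.
change (theta n.+1 x = ir_d I' n (h x) + h' (ir_d I n.+1 x)).
by rewrite Hh' vE [RHS]addrC subrK.
Qed.

Let Hseq := fix Hseq n : H n :=
  if n is m.+1 return H n then sval (Hstep (Hseq m)) else sval H0.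

Lemma lift_homotopy : exists h : forall n, {linear I n.+1 -> I' n},
  (forall x, phi 0 x - psi 0 x = h 0 (ir_d I 0 x)) /\
  (forall n x, phi n.+1 x - psi n.+1 x
               = ir_d I' n (h n x) + h n.+1 (ir_d I n.+1 x)).
Proof.
exists (fun n => sval (Hseq n)); split=> [x|n x].
  exact: (proj2_sig H0 x).
exact: (proj2_sig (Hstep (Hseq n)) x).
Qed.

End Homotopy.

End InjectiveComparison.

Section IntComplexes.
Variable S : pzRingType.

(* The differential C_(n+1) -> C_n; the index n + 1 is written 1 + n. *)
Record int_complex := IntComplex {
  ic_obj :> int -> lmodType S;
  ic_d : forall n, {linear ic_obj (1 + n) -> ic_obj n};
  ic_dd : forall n x, ic_d n (ic_d (1 + n) x) = 0 }.

Record int_chain_map (X Y : int_complex) := IntChainMap {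
  ic_map :> forall n, {linear X n -> Y n};
  ic_comm : forall n x, ic_map n (ic_d X n x) = ic_d Y n (ic_map (1 + n) x) }.

(* homology in degree 1 + n *)
Definition int_homology1 (X : int_complex) n : lmodType S :=
  subquot (kerS (ic_d X n)) (imS (ic_d X (1 + n))).

Section Map.
Variables (X Y : int_complex) (f : int_chain_map X Y).

Lemma ic_map_ker n x : kerS (ic_d X n) x -> kerS (ic_d Y n) (f (1 + n) x).
Proof. by move=> /= Hx; rewrite -ic_comm Hx linear0. Qed.

Lemma ic_map_im n x : kerS (ic_d X n) x -> imS (ic_d X (1 + n)) x ->
  imS (ic_d Y (1 + n)) (f (1 + n) x).
Proof. by move=> _ [y <-]; exists (f (1 + (1 + n)) y); rewrite ic_comm. Qed.

Definition int_homology1_map n :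
    {linear int_homology1 X n -> int_homology1 Y n} :=
  sqmap (@ic_map_ker n) (@ic_map_im n).

End Map.
End IntComplexes.

Section Stable.
Variables (k : comPzRingType) (R : kalgebra k) (M : lmodType R^c).
Variable P : projective_resolution M.

(* The pairs (a, b) with a - b = n; they index the summands P_a (x) I^b of
   degree n (a = i + n, b = i). *)
Definition idx (n : int) := {ab : nat * nat | ab.1%:Z - ab.2%:Z == n}.

Lemma idx_succ n a b : a%:Z - b%:Z == n -> a.+1%:Z - b%:Z == 1 + n.
Proof. by move/eqP <-; rewrite intS -addrA. Qed.

Lemma idx_pred n a b : a%:Z - b.+1%:Z == n -> a%:Z - b%:Z == 1 + n.
Proof. by move/eqP <-; rewrite intS opprD addrCA addNKr. Qed.

Lemma idx_pred' n a b : a%:Z - b%:Z == 1 + n -> a%:Z - b.+1%:Z == n.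
Proof. by move/eqP => E; rewrite intS opprD addrCA E addKr. Qed.

Section Object.
Variables (N : lmodType R) (I : injective_resolution N).

Definition tot (n : int) : lmodType k :=
  dprod (fun p : idx n => tensor (P (val p).1) (I (val p).2)).

Definition tot_at n (x : tot n) a b (h : a%:Z - b%:Z == n) :
    tensor (P a) (I b) :=
  (x : dprod _) (exist _ (a, b) h).

(* component (a, b) of the image of x under id (x) d_I *)
Definition tot_dI n (x : tot (1 + n)) a b :
    a%:Z - b%:Z == n -> tensor (P a) (I b) :=
  match b return a%:Z - b%:Z == n -> tensor (P a) (I b) with
  | 0 => fun _ => 0
  | b'.+1 => fun h => tensor_map (idfun : {linear P a -> P a}) (ir_d I b')
                        (tot_at x (idx_pred h))
  end.

Definition tot_d_fun n (x : tot (1 + n)) : tot n :=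
  (fun p => tensor_map (lr_d P (val p).1)
              (idfun : {linear I (val p).2 -> I (val p).2})
              (tot_at x (idx_succ (proj2_sig p)))
            + (-1) ^+ (val p).1 *: tot_dI x (proj2_sig p)) : dprod _.

Lemma tot_dE n (x : tot (1 + n)) a b (h : a%:Z - b%:Z == n) :
  tot_at (tot_d_fun x) h =
  tensor_map (lr_d P a) (idfun : {linear I b -> I b})
    (tot_at x (idx_succ h)) + (-1) ^+ a *: tot_dI x h.
Proof. by []. Qed.

Lemma tot_ext n (x y : tot n) :
  (forall a b (h : a%:Z - b%:Z == n), tot_at x h = tot_at y h) -> x = y.
Proof.
by move=> H; apply: functional_extensionality_dep => -[[a b] h]; apply: H.
Qed.

Lemma tot_at_lin n c (x y : tot n) a b (h : a%:Z - b%:Z == n) :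
  tot_at (c *: x + y) h = c *: tot_at x h + tot_at y h.
Proof. by []. Qed.

Lemma tot_dI_lin n c (x y : tot (1 + n)) a b (h : a%:Z - b%:Z == n) :
  tot_dI (c *: x + y) h = c *: tot_dI x h + tot_dI y h.
Proof.
case: b h => [|b] h /=; first by rewrite scaler0 addr0.
by rewrite tot_at_lin linearP.
Qed.

Lemma tot_d_linear n : linear (@tot_d_fun n).
Proof.
move=> c x y; apply: tot_ext => a b h.
rewrite tot_at_lin !tot_dE tot_at_lin tot_dI_lin linearP !scalerDr.
by rewrite addrACA !scalerA mulrC.
Qed.

Definition tot_d n : {linear tot (1 + n) -> tot n} :=
  mk_linear (@tot_d_linear n).

Lemma tot_at_irr n (x : tot n) a b (h h' : a%:Z - b%:Z == n) :
  tot_at x h = tot_at x h'.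
Proof. by rewrite (Prop_irrelevance h h'). Qed.

Lemma tensor_map_swap a b t :
  tensor_map (lr_d P a) (idfun : {linear I b.+1 -> I b.+1})
    (tensor_map (idfun : {linear P a.+1 -> P a.+1}) (ir_d I b) t)
  = tensor_map (idfun : {linear P a -> P a}) (ir_d I b)
      (tensor_map (lr_d P a) (idfun : {linear I b -> I b}) t).
Proof.
elim/tensor_ind: t => [|p x|x y Hx Hy]; first by rewrite !linear0.
  by rewrite /= !tensor_mapE.
by move: Hx Hy; rewrite !linearD /= => -> ->.
Qed.

Lemma tensor_map_dI a b t :
  tensor_map (idfun : {linear P a -> P a}) (ir_d I b.+1)
    (tensor_map (idfun : {linear P a -> P a}) (ir_d I b) t) = 0.
Proof.
elim/tensor_ind: t => [|p x|x y Hx Hy]; first by rewrite !linear0.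
  rewrite /= !tensor_mapE ir_dd.
  by apply: (addrI (pure p 0)); rewrite -pureDr !addr0.
by move: Hx Hy; rewrite !linearD /= => -> ->; rewrite addr0.
Qed.

Lemma tot_dd n x : tot_d n (tot_d (1 + n) x) = 0.
Proof.
apply: tot_ext => a b h; rewrite [LHS]tot_dE tot_dE linearD linearZ /=.
have := @tor_dd _ _ _ P (I b) a; rewrite /tor_d /= => ->; rewrite add0r.
case: b h => [|b] h; first by rewrite /= linear0 !scaler0 addr0.
rewrite {2}/tot_dI tot_dE linearD linearZ /=.
rewrite tensor_map_swap -(tot_at_irr x (idx_succ (idx_pred h))).
rewrite exprS mulN1r scaleNr scalerDr addrA addNr add0r.
case: b h => [|b] h /=; first by rewrite linear0 !scaler0.
by rewrite tensor_map_dI !scaler0.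
Qed.

(* the product totalization of P (x) I *)
Definition bar_complex : int_complex k := IntComplex tot_dd.

(* the component of degree n of the coproduct totalization *)
Definition tot_fin n : submodule (tot n) := finsupp _.

Lemma tot_finP n (x : tot n) : tot_fin n x <->
  exists s : seq (nat * nat), forall a b (h : a%:Z - b%:Z == n),
    (a, b) \notin s -> tot_at x h = 0.
Proof.
split=> [[s Hs]|[s Hs]].
  exists [seq val p | p <- s] => a b h Hab.
  apply: (Hs (exist _ (a, b) h)).
  by apply: contra Hab => Hp; apply/mapP; exists (exist _ (a, b) h).
exists (pmap insub s) => -[[a b] h]; rewrite mem_pmap_sub => Hab.
exact: Hs.
Qed.

Lemma tot_fin_d n x : tot_fin (1 + n) x -> tot_fin n (tot_d n x).
Proof.
move=> /tot_finP[s Hs]; apply/tot_finP.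
exists ([seq (ab.1.-1, ab.2) | ab <- s] ++ [seq (ab.1, ab.2.+1) | ab <- s]).
move=> a b h; rewrite mem_cat negb_or => /andP[H1 H2].
rewrite [LHS]tot_dE Hs ?linear0 ?add0r; last first.
  by apply: contra H1 => H; apply/mapP; exists (a.+1, b).
case: b h H1 H2 => [|b] h H1 H2 /=; first by rewrite scaler0.
rewrite Hs ?linear0 ?scaler0 //.
by apply: contra H2 => H; apply/mapP; exists (a, b).
Qed.

Definition tilde_obj n : lmodType k := subquot subT (tot_fin n).

Definition tilde_d n : {linear tilde_obj (1 + n) -> tilde_obj n} :=
  @sqmap k _ _ subT (tot_fin (1 + n)) subT (tot_fin n) (tot_d n)
    (fun _ _ => Logic.I) (fun x _ => @tot_fin_d n x).

Lemma tilde_dE n x :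
  tilde_d n (cls subT (tot_fin (1 + n)) x) = cls subT (tot_fin n) (tot_d n x).
Proof.
exact: (@sqmap_cls k _ _ subT (tot_fin (1 + n)) subT (tot_fin n) (tot_d n)
  (fun _ _ => Logic.I) (fun x _ => @tot_fin_d n x)).
Qed.

Lemma tilde_dd n x : tilde_d n (tilde_d (1 + n) x) = 0.
Proof.
have [y _ ->] := subquotP x; rewrite !tilde_dE tot_dd.
by apply/cls_eq0 => //; apply: smem0.
Qed.

(* the quotient of the product totalization by the coproduct totalization *)
Definition tilde_complex : int_complex k := IntComplex tilde_dd.

Definition stable_tor_obj (i : int) : lmodType k :=
  int_homology1 tilde_complex i.

End Object.

Section Map.
Variables (N N' : lmodType R).
Variables (I : injective_resolution N) (I' : injective_resolution N').
Variables (f : {linear N -> N'}) (phi : cochain_lift I I' f).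

Definition tot_map_fun n (x : tot I n) : tot I' n :=
  (fun p => tensor_map (idfun : {linear P (val p).1 -> P (val p).1})
              (phi (val p).2) ((x : dprod _) p)) : dprod _.

Lemma tot_mapE n (x : tot I n) a b (h : a%:Z - b%:Z == n) :
  tot_at (tot_map_fun x) h =
  tensor_map (idfun : {linear P a -> P a}) (phi b) (tot_at x h).
Proof. by []. Qed.

Lemma tot_map_linear n : linear (@tot_map_fun n).
Proof.
move=> c x y; apply: tot_ext => a b h.
by rewrite tot_at_lin !tot_mapE tot_at_lin linearP.
Qed.

Definition tot_map n : {linear tot I n -> tot I' n} :=
  mk_linear (@tot_map_linear n).

Lemma tot_map_comm n x :
  tot_map n (tot_d I n x) = tot_d I' n (tot_map (1 + n) x).
Proof.
apply: tot_ext => a b h; rewrite [LHS]tot_mapE [RHS]tot_dE !tot_dE.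
rewrite linearD linearZ /= [in RHS]tot_mapE; congr (_ + _ *: _).
  move: (tot_at x _) => t.
  elim/tensor_ind: t => [|p y|y z Hy Hz]; first by rewrite !linear0.
    by rewrite /= !tensor_mapE.
  by move: Hy Hz; rewrite !linearD /= => -> ->.
case: b h => [|b] h /=; first by rewrite linear0.
rewrite tot_mapE; move: (tot_at x _) => t.
elim/tensor_ind: t => [|p y|y z Hy Hz]; first by rewrite !linear0.
  by rewrite /= !tensor_mapE lift_comm.
by move: Hy Hz; rewrite !linearD /= => -> ->.
Qed.

Lemma tot_map_fin n x : tot_fin I n x -> tot_fin I' n (tot_map n x).
Proof.
move=> /tot_finP[s Hs]; apply/tot_finP; exists s => a b h /Hs Hab.
by rewrite [LHS]tot_mapE Hab linear0.
Qed.

Definition tilde_map n : {linear tilde_complex I n -> tilde_complex I' n} :=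
  @sqmap k _ _ subT (tot_fin I n) subT (tot_fin I' n) (tot_map n)
    (fun _ _ => Logic.I) (fun x _ => @tot_map_fin n x).

Lemma tilde_mapE n x :
  tilde_map n (cls subT (tot_fin I n) x) = cls subT (tot_fin I' n) (tot_map n x).
Proof.
exact: (@sqmap_cls k _ _ subT (tot_fin I n) subT (tot_fin I' n) (tot_map n)
  (fun _ _ => Logic.I) (fun x _ => @tot_map_fin n x)).
Qed.

Lemma tilde_comm n x :
  tilde_map n (ic_d (tilde_complex I) n x)
  = ic_d (tilde_complex I') n (tilde_map (1 + n) x).
Proof.
have [y _ ->] := subquotP x.
by rewrite tilde_mapE [ic_d _ _]/(tilde_d _ _) !tilde_dE tilde_mapE tot_map_comm.
Qed.

Definition tilde_chain_map :
    int_chain_map (tilde_complex I) (tilde_complex I') :=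
  IntChainMap tilde_comm.

Definition stable_tor_lift (i : int) :
    {linear stable_tor_obj I i -> stable_tor_obj I' i} :=
  int_homology1_map tilde_chain_map i.

End Map.
End Stable.

Section StableFunctor.
Variables (k : comPzRingType) (R : kalgebra k) (M : lmodType R^c).
Variable P : projective_resolution M.

Local Notation tcls I n x := (cls subT (tot_fin P I n) x).
Local Notation hcls I n y :=
  (cls (kerS (ic_d (tilde_complex P I) n))
       (imS (ic_d (tilde_complex P I) (1 + n))) y).

Lemma stable_torP N (I : injective_resolution N) i (q : stable_tor_obj P I i) :
  exists2 x, tilde_d P I i (tcls I (1 + i) x) = 0
           & q = hcls I i (tcls I (1 + i) x).
Proof.
have [y Hy ->] := subquotP q; have [x _ Ex] := subquotP y.
by exists x; rewrite -Ex.
Qed.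

Lemma stable_tor_lift_cls (N N' : lmodType R) (I : injective_resolution N)
    (I' : injective_resolution N') (f : {linear N -> N'}) (phi : cochain_lift I I' f) i x :
  tilde_d P I i (tcls I (1 + i) x) = 0 ->
  stable_tor_lift P phi i (hcls I i (tcls I (1 + i) x))
  = hcls I' i (tcls I' (1 + i) (tot_map P phi (1 + i) x)).
Proof.
move=> Hx; rewrite -tilde_mapE.
exact: (sqmap_cls (@ic_map_ker _ _ _ (tilde_chain_map P phi) i)
                  (@ic_map_im _ _ _ (tilde_chain_map P phi) i) Hx).
Qed.

Section Independence.
Variables (N N' : lmodType R) (I : injective_resolution N).
Variables (I' : injective_resolution N') (f : {linear N -> N'}).
Variables phi psi : cochain_lift I I' f.
Variable h : forall n, {linear I n.+1 -> I' n}.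
Hypothesis h0 : forall x, phi 0 x - psi 0 x = h 0 (ir_d I 0 x).
Hypothesis hS : forall n x,
  phi n.+1 x - psi n.+1 x = ir_d I' n (h n x) + h n.+1 (ir_d I n.+1 x).

Let tot_h n (x : tot P I n) : tot P I' (1 + n) :=
  (fun p => (-1) ^+ (val p).1 *:
     tensor_map (idfun : {linear P (val p).1 -> P (val p).1}) (h (val p).2)
       (tot_at x (idx_pred' (proj2_sig p)))) : dprod _.

Let tot_hE n (x : tot P I n) a b (e : a%:Z - b%:Z == 1 + n) :
  tot_at (tot_h x) e = (-1) ^+ a *:
    tensor_map (idfun : {linear P a -> P a}) (h b) (tot_at x (idx_pred' e)).
Proof. by []. Qed.

Let tot_h_fin n x : tot_fin P I n x -> tot_fin P I' (1 + n) (tot_h x).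
Proof.
move=> /tot_finP[s Hs]; apply/tot_finP.
exists [seq (ab.1, ab.2.-1) | ab <- s] => a b e Hab.
rewrite tot_hE Hs ?linear0 ?scaler0 //.
by apply: contra Hab => H; apply/mapP; exists (a, b.+1).
Qed.

Let pure0r (N0 : lmodType R) a (p : P a) : pure p 0 = 0 :> tensor (P a) N0.
Proof. by apply: (addrI (pure p 0)); rewrite -pureDr !addr0. Qed.

Let h_swap a b t :
  tensor_map (idfun : {linear P a -> P a}) (h b)
    (tensor_map (lr_d P a) (idfun : {linear I b.+1 -> I b.+1}) t)
  = tensor_map (lr_d P a) (idfun : {linear I' b -> I' b})
      (tensor_map (idfun : {linear P a.+1 -> P a.+1}) (h b) t).
Proof.
elim/tensor_ind: t => [|p x|x y Hx Hy]; first by rewrite !linear0.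
  by rewrite /= !tensor_mapE.
by move: Hx Hy; rewrite !linearD /= => -> ->.
Qed.

Let h_diff0 a t :
  tensor_map (idfun : {linear P a -> P a}) (phi 0) t
  - tensor_map (idfun : {linear P a -> P a}) (psi 0) t
  = tensor_map (idfun : {linear P a -> P a}) (h 0)
      (tensor_map (idfun : {linear P a -> P a}) (ir_d I 0) t).
Proof.
elim/tensor_ind: t => [|p x|x y Hx Hy]; first by rewrite !linear0 ?subrr ?addr0.
  rewrite /= !tensor_mapE -h0; apply/eqP; rewrite subr_eq -pureDr subrK.
  exact/eqP.
by move: Hx Hy; rewrite !linearD /= addrACA => -> ->.
Qed.

Let h_diffS a n t :
  tensor_map (idfun : {linear P a -> P a}) (phi n.+1) t
  - tensor_map (idfun : {linear P a -> P a}) (psi n.+1) t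
  = tensor_map (idfun : {linear P a -> P a}) (ir_d I' n)
      (tensor_map (idfun : {linear P a -> P a}) (h n) t)
    + tensor_map (idfun : {linear P a -> P a}) (h n.+1)
      (tensor_map (idfun : {linear P a -> P a}) (ir_d I n.+1) t).
Proof.
elim/tensor_ind: t => [|p x|x y Hx Hy].
- by rewrite !linear0 ?subrr ?addr0.
- rewrite /= !tensor_mapE /= -pureDr -hS; apply/eqP.
  by rewrite subr_eq -pureDr subrK.
- move: Hx Hy; rewrite !linearD /= => E1 E2.
  by rewrite addrACA E1 E2 addrACA.
Qed.

Let tot_homotopy i (x : tot P I (1 + i)) :
  tot_map P phi (1 + i) x - tot_map P psi (1 + i) x
  = tot_d P I' (1 + i) (tot_h x) + tot_h (tot_d P I i x).
Proof.
apply: tot_ext => a b e.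
rewrite -[LHS]/(tot_at (tot_map P phi _ x) e - tot_at (tot_map P psi _ x) e).
rewrite -[RHS]/(tot_at (tot_d P I' _ (tot_h x)) e + tot_at (tot_h _) e).
rewrite [tot_at (tot_map P phi _ x) e]tot_mapE.
rewrite [tot_at (tot_map P psi _ x) e]tot_mapE.
rewrite [tot_at (tot_d _ _ _ _) e]tot_dE !tot_hE.
rewrite [tot_at (tot_d _ _ _ _) _]tot_dE.
rewrite (tot_at_irr x (idx_succ (idx_pred' e)) (idx_pred' (idx_succ e))).
rewrite [tot_dI x _]/= (tot_at_irr x (idx_pred (idx_pred' e)) e).
move: (tot_at x (idx_pred' (idx_succ e))) => T.
rewrite [tensor_map idfun (h b) (_ + _)]linearD /= h_swap !linearZ /=.
rewrite exprS mulN1r scaleNr scalerDr addrACA addNr add0r.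
rewrite scalerA -expr2 sqrr_sign scale1r.
case: b e T => [|b] e T; first by rewrite h_diff0 /= scaler0 add0r.
rewrite h_diffS [tot_dI _ _]/= tot_hE linearZ /= scalerA -expr2 sqrr_sign.
by rewrite scale1r (tot_at_irr x _ e).
Qed.

Lemma stable_tor_lift_homotopy i :
  stable_tor_lift P phi i =1 stable_tor_lift P psi i.
Proof.
move=> q; have [x dx ->] := stable_torP q.
have fin : tot_fin P I i (tot_d P I i x).
  by move: dx; rewrite tilde_dE => /cls_eq0; apply.
have K (chi : cochain_lift I I' f) :
    tilde_d P I' i (tcls I' (1 + i) (tot_map P chi (1 + i) x)) = 0.
  rewrite -tilde_mapE -[LHS](tilde_comm chi).
  by rewrite [ic_d _ _ _]dx linear0.
rewrite !stable_tor_lift_cls //; apply/cls_eq; try exact: K.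
exists (tcls I' (1 + (1 + i)) (tot_h x)).
rewrite [LHS]tilde_dE -cls_sub // tot_homotopy.
apply/cls_eq => //; rewrite opprD addrA subrr add0r.
exact/smemN/tot_h_fin.
Qed.

End Independence.

Lemma stable_tor_lift_indep (N N' : lmodType R) (I : injective_resolution N)
    (I' : injective_resolution N') (f : {linear N -> N'})
    (phi psi : cochain_lift I I' f) i :
  stable_tor_lift P phi i =1 stable_tor_lift P psi i.
Proof.
have [h [h0 hS]] := lift_homotopy phi psi.
exact: stable_tor_lift_homotopy h0 hS i.
Qed.

Variable I : forall N : lmodType R, injective_resolution N.

Definition stable_tor_map i (N N' : lmodType R) (f : {linear N -> N'}) :
    {linear stable_tor_obj P (I N) i -> stable_tor_obj P (I N') i} :=
  stable_tor_lift P (projT1 (cid (lift_exists (I N) (I N') f))) i.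

(* The action on f is induced by any lift of f. *)
Lemma stable_tor_mapE i (N N' : lmodType R) (f : {linear N -> N'})
    (phi : cochain_lift (I N) (I N') f) :
  stable_tor_map i f =1 stable_tor_lift P phi i.
Proof. exact: stable_tor_lift_indep. Qed.

Lemma stable_tor_map_id i (N : lmodType R) x :
  stable_tor_map i (idfun : {linear N -> N}) x = x.
Proof.
pose phi : cochain_lift (I N) (I N) idfun :=
  @CochainLift _ _ _ (I N) (I N) idfun (fun n => idfun) (fun _ _ => erefl)
    (fun _ => erefl).
rewrite (stable_tor_mapE phi).
have [y dy ->] := stable_torP x; rewrite stable_tor_lift_cls //.
congr (cls _ _ (cls _ _ _)); apply: tot_ext => a b h; rewrite [LHS]tot_mapE.
move: (tot_at y h) => t; elim/tensor_ind: t => [|p n|u v Hu Hv].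
- by rewrite linear0.
- by rewrite /= tensor_mapE.
- by move: Hu Hv; rewrite linearD /= => -> ->.
Qed.

Lemma stable_tor_map_comp i (A B C : lmodType R) (g : {linear B -> C})
    (f : {linear A -> B}) x :
  stable_tor_map i (g \o f : {linear A -> C}) x
  = stable_tor_map i g (stable_tor_map i f x).
Proof.
have [phi _] := lift_exists (I A) (I B) f.
have [psi _] := lift_exists (I B) (I C) g.
have cc n y : (psi n.+1 \o phi n.+1) (ir_d (I A) n y)
              = ir_d (I C) n ((psi n \o phi n) y).
  by rewrite /= !lift_comm.
have ca y : (psi 0 \o phi 0) (ir_aug (I A) y) = ir_aug (I C) ((g \o f) y).
  by rewrite /= !lift_aug.
pose chi : cochain_lift (I A) (I C) (g \o f) :=
  @CochainLift _ _ _ (I A) (I C) (g \o f) (fun n => psi n \o phi n) cc ca.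
rewrite (stable_tor_mapE phi) (stable_tor_mapE psi) (stable_tor_mapE chi).
have [y dy ->] := stable_torP x.
have dy' : tilde_d P (I B) i (tcls (I B) (1 + i) (tot_map P phi (1 + i) y)) = 0.
  rewrite -tilde_mapE -[LHS](tilde_comm phi).
  by rewrite [ic_d _ _ _]dy linear0.
rewrite !stable_tor_lift_cls //.
congr (cls _ _ (cls _ _ _)); apply: tot_ext => a b h.
rewrite [LHS]tot_mapE [RHS]tot_mapE [in RHS]tot_mapE.
move: (tot_at y h) => t; elim/tensor_ind: t => [|p n|u v Hu Hv].
- by rewrite !linear0.
- by rewrite /= !tensor_mapE.
- by move: Hu Hv; rewrite !linearD /= => -> ->.
Qed.

Definition stable_Tor (i : int) : functor R k :=
  @Functor R k (fun N => stable_tor_obj P (I N) i) (@stable_tor_map i)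
    (@stable_tor_map_id i) (@stable_tor_map_comp i).

End StableFunctor.

(* Main.v *)
(** Write T for stable homology.  It vanishes on an injective module, which has
    an injective resolution concentrated in degree 0, and shifting injective
    resolutions gives natural isomorphisms T_(i+1)(SN) = T_i(N), where SN is the
    cosyzygy of N.  If every injective module has flat dimension at most d, then
    the columns of P (x) I are exact in degrees > d, so the product totalization
    is acyclic in these degrees; the coproduct totalization computes Tor, and
    hence T_i = Tor_i for i > d, compatibly with connecting maps.

    Thus T_i is half exact for i > d.  For a half-exact functor F that vanishes
    on injectives, rotating a short exact sequence A -> B -> C shows that
    F(C) -> F(SA) -> F(SB) -> F(SC) is exact; by descending induction every T_i
    is half exact, and T is a homological functor with connecting maps
    T_(i+1)(C) -> T_(i+1)(SA) = T_i(A).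

    A morphism from a homological functor that vanishes on injectives extends
    uniquely from high degrees to all degrees.  So T -> Tor extends the
    isomorphisms in degrees > d, it factors through the J-completion cTor, and
    cTor -> Tor lifts to cTor -> T; uniqueness makes these mutually inverse. *)

From HB Require Import structures.
From mathcomp Require Import all_boot all_order all_algebra.
From mathcomp Require Import boolp zify.
Require Import Defs.

Set Implicit Arguments.
Unset Strict Implicit.
Unset Printing Implicit Defensive.

Import GRing.Theory.
Local Open Scope ring_scope.

(** * Half-exact functors vanishing on injectives *)

Lemma inj_surj_bij (A B : Type) (f : A -> B) :
  injective f -> (forall y, exists x, f x = y) -> bijective f.
Proof.
move=> fi fs; exists (fun y => sval (cid (fs y))) => [x|y].
  by apply: fi; case: cid.
by case: cid.
Qed.

Section Cokernels.
Variable S : pzRingType.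

Lemma eq_linear (A B : lmodType S) (f g : {linear A -> B}) :
  f =1 g -> f = g.
Proof.
case: f g => [f [[m1] [m2]]] [g [[m3] [m4]]] /= /funext E; subst g.
by rewrite (Prop_irrelevance m1 m3) (Prop_irrelevance m2 m4).
Qed.

(** Two values over one point differ by a value over 0, so the relation is single-valued, and its
    linearity passes to the chosen function. Diagram chases thereby become linear maps. *)
Lemma linear_choice (A B : lmodType S) (G : A -> B -> Prop) :
  (forall c x y x' y', G x y -> G x' y' -> G (c *: x + x') (c *: y + y')) ->
  (forall x, exists y, G x y) -> (forall y, G 0 y -> y = 0) ->
  exists f : {linear A -> B}, forall x y, G x y <-> f x = y.
Proof.
move=> GL Gtot G0.
have uni x y y' : G x y -> G x y' -> y = y'.
  move=> /(GL (-1)) H /H; rewrite !scaleN1r addNr => /G0/eqP.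
  by rewrite addrC subr_eq0 => /eqP.
have lin : linear (fun x => sval (cid (Gtot x))).
  move=> c x x'; apply: uni (svalP (cid (Gtot _))) _.
  by apply: GL; [case: (cid (Gtot x)) | case: (cid (Gtot x'))].
exists (mk_linear lin) => x y; split=> [H|<-]; last exact: svalP (cid (Gtot x)).
exact: uni (svalP (cid (Gtot x))) H.
Qed.

Lemma factor_through_surj (A B C : lmodType S) (g : {linear A -> B})
    (u : {linear A -> C}) :
  (forall z, exists y, g y = z) -> (forall y, g y = 0 -> u y = 0) ->
  exists w : {linear B -> C}, forall y, w (g y) = u y.
Proof.
move=> gs gu.
have [||y [x [/gu]]|w Hw] :=
    @linear_choice B C (fun z c => exists y, g y = z /\ u y = c); last first.
- by exists w => y; apply/Hw; exists y.
- by move=> -> ->.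
- by move=> z; have [y <-] := gs z; exists (u y), y.
- move=> c _ _ _ _ [x [<- <-]] [y [<- <-]].
  by exists (c *: x + y); rewrite !linearP.
Qed.

Lemma short_exact0 (A B C : lmodType S) (f : {linear A -> B})
  (g : {linear B -> C}) : short_exact f g -> forall x, g (f x) = 0.
Proof. by case=> _ E _ x; apply/E; exists x. Qed.

Section Coker.
Variables (A B : lmodType S) (f : {linear A -> B}).

Definition coker : lmodType S := subquot subT (imS f).

Lemma coker_proj_linear : linear (fun x : B => cls subT (imS f) x : coker).
Proof. by move=> a x y; apply: cls_lin. Qed.

Definition coker_proj : {linear B -> coker} := mk_linear coker_proj_linear.

Lemma coker_proj_surj q : exists x, coker_proj x = q.
Proof. by have [x _ ->] := subquotP q; exists x. Qed.

Lemma coker_exact : exact_seq f coker_proj.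
Proof. by move=> y; apply: cls_eq0. Qed.

Lemma coker_short_exact : injective f -> short_exact f coker_proj.
Proof. by move=> fi; split=> //; [apply: coker_exact | apply: coker_proj_surj]. Qed.

End Coker.

(** Exactness identifies the kernel of [g] with the image of [f]. With [coker_resolution] this cuts
    exact sequences into short exact ones, the form in which flatness applies. *)
Lemma coker_embedding (A B C : lmodType S) (f : {linear A -> B})
    (g : {linear B -> C}) : exact_seq f g ->
  exists w : {linear coker f -> C},
    injective w /\ forall y, w (coker_proj f y) = g y.
Proof.
move=> fg; have [|w Hw] := factor_through_surj (u := g) (@coker_proj_surj _ _ f).
  by move=> y /coker_exact/fg.
have wi q : w q = 0 -> q = 0.
  by have [y <-] := coker_proj_surj q; rewrite Hw => /fg/coker_exact.
by exists w; split=> //; apply: raddf_inj.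
Qed.

Lemma coker_resolution (A B C : lmodType S) (f : {linear A -> B})
    (g : {linear B -> C}) : exact_seq f g ->
  exists w : {linear coker f -> C}, short_exact w (coker_proj g) /\
    forall y, w (coker_proj f y) = g y.
Proof.
move=> fg; have [w [wi Hw]] := coker_embedding fg; exists w; split=> //.
split=> [//|y|]; last exact: coker_proj_surj.
rewrite coker_exact; split=> -[u Eu]; first by exists (coker_proj f u); rewrite Hw.
by move: Eu; have [v <-] := coker_proj_surj u; rewrite Hw => Ev; exists v.
Qed.

Lemma injective_prod (E E' : lmodType S) : injective_module E ->
  injective_module E' -> injective_module (E * E')%type.
Proof.
move=> iE iE' A B u v ui.
have l1 : linear (fun x => (v x).1) by move=> a x y; rewrite linearP.
have l2 : linear (fun x => (v x).2) by move=> a x y; rewrite linearP.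
have [w1 H1] := iE _ _ u (mk_linear l1) ui.
have [w2 H2] := iE' _ _ u (mk_linear l2) ui.
have lw : linear (fun x => (w1 x, w2 x) : (E * E')%type).
  by move=> a x y; rewrite !linearP.
by exists (mk_linear lw) => a /=; rewrite H1 H2 /=; case: (v a).
Qed.

End Cokernels.

Section HalfExact.
Variables (R : pzRingType) (k : comPzRingType).

Definition half_exact (F : functor R k) : Prop :=
  forall (A B C : lmodType R) (f : {linear A -> B}) (g : {linear B -> C}),
    short_exact f g -> exact_seq (fmap F f) (fmap F g).

Lemma half_exact_bijective (F G : functor R k) (t : nat_trans F G) :
  (forall N, bijective (t N)) -> half_exact G -> half_exact F.
Proof.
move=> tb Gh A B C f g /Gh E y; have bi N := bij_inj (tb N).
split=> [Hy|[x <-]].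
  have /E[z Ez] : fmap G g (t B y) = 0 by rewrite -nt_natural Hy linear0.
  have [h _ hK] := tb A; exists (h z); apply: bi.
  by rewrite nt_natural hK.
by apply: bi; rewrite !nt_natural linear0; apply/E; exists (t A x).
Qed.

Variable F : functor R k.
Hypothesis F_half : half_exact F.
Hypothesis F_inj : forall E, injective_module E -> forall x : F E, x = 0.

Lemma fmapE (A B C : lmodType R) (g : {linear B -> C}) (f : {linear A -> B})
    (h : {linear A -> C}) : (forall x, h x = g (f x)) ->
  forall x, fmap F h x = fmap F g (fmap F f x).
Proof.
move=> E x; rewrite -fmap_comp.
by have -> : h = (g \o f : {linear A -> C}) by apply: eq_linear.
Qed.

Lemma fmapK (A B : lmodType R) (g : {linear B -> A}) (f : {linear A -> B}) :
  cancel f g -> cancel (fmap F f) (fmap F g).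
Proof.
by move=> fK x; rewrite -(@fmapE _ _ _ g f idfun) ?fmap_id.
Qed.

Lemma fmap0 (A B E : lmodType R) (g : {linear E -> B}) (f : {linear A -> E})
    (h : {linear A -> B}) : injective_module E -> (forall x, h x = g (f x)) ->
  forall x, fmap F h x = 0.
Proof. by move=> iE E' x; rewrite (fmapE E') (F_inj iE (fmap F f x)) linear0. Qed.

Section ProductWithInjective.
Variables (C E : lmodType R) (iE : injective_module E).

Lemma pair_fst_linear : linear (fun x : (C * E)%type => x.1).
Proof. by []. Qed.
Lemma pair_snd_linear : linear (fun x : (C * E)%type => x.2).
Proof. by []. Qed.
Lemma pair_inl_linear : linear (fun x : C => (x, 0) : (C * E)%type).
Proof. by move=> a x y; congr pair; rewrite /= ?scaler0 ?addr0. Qed.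
Lemma pair_inr_linear : linear (fun x : E => (0, x) : (C * E)%type).
Proof. by move=> a x y; congr pair; rewrite /= ?scaler0 ?addr0. Qed.

Definition pair_fst := mk_linear pair_fst_linear.
Definition pair_snd := mk_linear pair_snd_linear.
Definition pair_inl := mk_linear pair_inl_linear.
Definition pair_inr := mk_linear pair_inr_linear.

(** [F] kills the kernel [E] of the projection, so half-exactness leaves no kernel. *)
Lemma fmap_fst_inj : injective (fmap F pair_fst).
Proof.
have se : short_exact pair_inr pair_fst.
  split=> [x y []|[x y]|x] //; last by exists (x, 0).
  by split=> /= [->|[z [<- _]]]; first by exists y.
have fi x : fmap F pair_fst x = 0 -> x = 0.
  by move/(F_half se) => [y <-]; rewrite (F_inj iE y) linear0.
exact: raddf_inj.
Qed.

Lemma fmap_inlK : cancel (fmap F pair_inl) (fmap F pair_fst).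
Proof. exact: fmapK. Qed.

Lemma fmap_fstK : cancel (fmap F pair_fst) (fmap F pair_inl).
Proof. by move=> x; apply: fmap_fst_inj; rewrite fmap_inlK. Qed.

End ProductWithInjective.

Lemma pair_linear (Y C E : lmodType R) (g : {linear Y -> C})
  (j : {linear Y -> E}) : linear (fun y => (g y, j y) : (C * E)%type).
Proof. by move=> a x y; congr pair; rewrite /= linearP. Qed.
Definition pair_map Y C E g j := mk_linear (@pair_linear Y C E g j).

Lemma diff_linear (C E B : lmodType R) (d : {linear C -> B})
  (p : {linear E -> B}) : linear (fun x : (C * E)%type => d x.1 - p x.2).
Proof. move=> a [x x'] [y y'] /=; rewrite (linearP d) (linearP p).
by rewrite scalerBr opprD addrACA. Qed.
Definition diff_map C E B d p := mk_linear (@diff_linear C E B d p).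

(* Additivity of F is not needed: F inverts the projection C * E -> C, so it
   identifies the sections (id, 0) and (id, h). *)
Lemma fmap_homotopic (C E B : lmodType R) (iE : injective_module E)
    (d d' : {linear C -> B}) (h : {linear C -> E}) (p : {linear E -> B}) :
  (forall z, d z = d' z - p (h z)) -> fmap F d =1 fmap F d'.
Proof.
move=> E1 x.
rewrite (@fmapE _ _ _ (diff_map d' p) (pair_map idfun h) d) //.
rewrite (@fmapE _ _ _ (diff_map d' p) (pair_inl C E) d') //; last first.
  by move=> y /=; rewrite linear0 subr0.
congr (fmap F _ _); apply: (fmap_fst_inj iE).
by rewrite -!(@fmapE _ _ _ _ _ idfun).
Qed.

Section Rotation.
Variables (X Y Z : lmodType R) (f : {linear X -> Y}) (g : {linear Y -> Z}).
Variables (E S : lmodType R) (i : {linear X -> E}) (p : {linear E -> S}).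
Variables (j : {linear Y -> E}) (d : {linear Z -> S}).
Hypotheses (fg : short_exact f g) (ip : short_exact i p).
Hypotheses (jf : forall x, j (f x) = i x) (dg : forall y, d (g y) = p (j y)).

(* As F kills E, applying F to 0 -> Y -> Z * E -> S -> 0 continues the exact
   sequence of 0 -> X -> Y -> Z -> 0 by one step, with S in the role of the
   suspension of X. *)
Lemma rotate_short_exact : short_exact (pair_map g j) (diff_map d p).
Proof.
case: (fg) (ip) => fi fge gs [ii ipe ps]; split.
- apply: raddf_inj => y [/fge[x <-]]; rewrite jf => E0.
  by have -> : x = 0; [apply: ii; rewrite E0 linear0 | rewrite linear0].
- move=> [z e]; split=> /= [|[y [<- <-]]]; last by rewrite dg subrr.
  have [y <-] := gs z; rewrite dg -linearB => /ipe[x Ex].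
  exists (y - f x) => /=; rewrite !linearB jf Ex (short_exact0 fg) subr0.
  by rewrite opprB addrC subrK.
- move=> s; have [e <-] := ps s; exists (0, - e) => /=.
  by rewrite linear0 linearN opprK add0r.
Qed.

Hypothesis iE : injective_module E.

(** Half-exactness of the rotated sequence gives exactness at [Z * E], and [pair_fst] and [pair_inl]
    carry it to [Z]. The composite vanishes because [d \o g] factors through [E]. *)
Lemma rotate_exact1 : exact_seq (fmap F g) (fmap F d).
Proof.
have dE x : d x = diff_map d p (pair_inl Z E x) by rewrite /= linear0 subr0.
move=> z; split=> [|[y <-]].
  rewrite (fmapE dE) => /(F_half rotate_short_exact)[y Ey]; exists y.
  by rewrite (@fmapE _ _ _ (pair_fst Z E) (pair_map g j)) // Ey fmap_inlK.
rewrite -(@fmapE _ _ _ d g (d \o g)) //.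
by apply: (fmap0 (f := j) (g := p)).
Qed.

End Rotation.

Lemma oppr_short_exact (A B C : lmodType R) (f : {linear A -> B})
  (g : {linear B -> C}) : short_exact f g -> short_exact f (\- g).
Proof.
case=> fi E gs; split=> // [y|z].
  by rewrite -E /=; split=> [/eqP|->]; rewrite ?oppr0 // oppr_eq0 => /eqP.
by have [y Ey] := gs (- z); exists y; rewrite /= Ey opprK.
Qed.

Section Rotation2.
Variables (X Y Z : lmodType R) (f : {linear X -> Y}) (g : {linear Y -> Z}).
Variables (E S : lmodType R) (i : {linear X -> E}) (p : {linear E -> S}).
Variables (j : {linear Y -> E}) (d : {linear Z -> S}).
Hypotheses (fg : short_exact f g) (ip : short_exact i p).
Hypotheses (jf : forall x, j (f x) = i x) (dg : forall y, d (g y) = p (j y)).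
Hypothesis iE : injective_module E.
Variables (E' S' : lmodType R) (i' : {linear Y -> E'}) (p' : {linear E' -> S'}).
Hypotheses (ip' : short_exact i' p') (iE' : injective_module E').
Variables (e : {linear E -> E'}) (h : {linear S -> S'}).
Hypotheses (ei : forall x, e (i x) = i' (f x)) (hp : forall x, h (p x) = p' (e x)).

(** The sequence [Y -> Z * E -> S] is to be rotated again, with [i'] as the embedding. The extension
    of [i'] sends [(z, x)] to [m z + e x], where [m \o g] is [i' - e \o j]. The square with [h]
    commutes only up to sign, hence [\- p']. *)
Lemma rotate_compatible : exists j' : {linear (Z * E)%type -> E'},
  (forall y, j' (pair_map g j y) = i' y) /\
  (forall w, h (diff_map d p w) = (\- p') (j' w)).
Proof.
case: (fg) => _ fge gs.
have [|m Hm] := factor_through_surj (u := i' \- (e \o j)) gs.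
  by move=> y /fge[x <-] /=; rewrite jf ei subrr.
exists (diff_map m (\- e)); split=> [y|[z x]] /=.
  by rewrite Hm /= opprK subrK.
have [y <-] := gs z; rewrite Hm /= opprK dg linearB !hp linearD linearB.
by rewrite (short_exact0 ip') sub0r opprD opprK.
Qed.

(** [rotate_exact1] for the rotated sequence gives exactness for [diff_map d p] and [h]; the factor
    [E] is then removed by the mutually inverse images of [pair_inl] and [pair_fst]. *)
Lemma rotate_exact2 : exact_seq (fmap F d) (fmap F h).
Proof.
have [j' [j'E hE]] := rotate_compatible.
have H := rotate_exact1 (rotate_short_exact fg ip jf dg) (oppr_short_exact ip')
  j'E hE iE'.
have dE x : d x = diff_map d p (pair_inl Z E x) by rewrite /= linear0 subr0.
move=> s; rewrite H; split=> -[z Ez]; [exists (fmap F (pair_fst Z E) z)|].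
  by rewrite (fmapE dE) fmap_fstK.
by exists (fmap F (pair_inl Z E) z); rewrite -(fmapE dE).
Qed.

End Rotation2.

Section Rotation3.
Variables (X Y Z : lmodType R) (f : {linear X -> Y}) (g : {linear Y -> Z}).
Variables (E S : lmodType R) (i : {linear X -> E}) (p : {linear E -> S}).
Hypotheses (fg : short_exact f g) (ip : short_exact i p).
Hypothesis iE : injective_module E.
Variables (E' S' : lmodType R) (i' : {linear Y -> E'}) (p' : {linear E' -> S'}).
Hypotheses (ip' : short_exact i' p') (iE' : injective_module E').
Variables (e : {linear E -> E'}) (h : {linear S -> S'}).
Hypotheses (ei : forall x, e (i x) = i' (f x)) (hp : forall x, h (p x) = p' (e x)).
Variables (E2 S2 : lmodType R) (i2 : {linear Z -> E2}) (p2 : {linear E2 -> S2}).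
Hypotheses (ip2 : short_exact i2 p2) (iE2 : injective_module E2).
Variables (e' : {linear E' -> E2}) (h' : {linear S' -> S2}).
Hypotheses (ei' : forall x, e' (i' x) = i2 (g x)).
Hypotheses (hp' : forall x, h' (p' x) = p2 (e' x)).

(** This is [rotate_exact2] for the rotated sequence. Its middle term [Z * E] embeds in the
    injective [E2 * E] with cokernel [S2] again, as the factor [E] is mapped identically. *)
Lemma rotate_exact3 : exact_seq (fmap F h) (fmap F h').
Proof.
have [fi _ gs] := fg; have [i'i _ _] := ip'; have [i2i _ _] := ip2.
(* [l] is the [E]-component of the map [E' -> E2 * E] that extends [pair_map g j]. *)
have [j jf] := @iE _ _ f i fi; have [l li] := @iE _ _ i' j i'i.
have [|d dg] := factor_through_surj (u := p \o j) gs.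
  by case: fg => _ E1 _ y /E1[x <-] /=; rewrite jf (short_exact0 ip).
have [j' [j'E hE]] := rotate_compatible fg jf dg ip' ei hp.
pose I := pair_map (i2 \o pair_fst Z E) (pair_snd Z E).
pose Q := \- p2 \o pair_fst E2 E.
have IQ : short_exact I Q.
  split.
  - by move=> [z x] [z' x'] /= [/i2i-> ->].
  - move=> [y x] /=; split=> [/eqP|[z [<- _]]].
      rewrite oppr_eq0 => /eqP; have [_ E1 _] := ip2.
      by move=> /E1[z <-]; exists (z, x).
    by rewrite (short_exact0 ip2) oppr0.
  - move=> s; have [_ _ p2s] := ip2; have [y Ey] := p2s (- s).
    by exists (y, 0); rewrite /= Ey opprK.
apply: (rotate_exact2 (rotate_short_exact fg ip jf dg) (oppr_short_exact ip')
  j'E hE iE' IQ (injective_prod iE2 iE) (e := pair_map e' l)) => [y|y] /=.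
  by rewrite ei' li.
by rewrite linearN hp'.
Qed.

End Rotation3.
End HalfExact.

(** * Homological functors from cosyzygy shifts *)

Section Cosyzygy.
Variable R : pzRingType.
Variable I : forall N : lmodType R, injective_resolution N.

Local Notation aug N := (ir_aug (I N)).

Definition cosyzygy (N : lmodType R) : lmodType R := coker (aug N).
Definition cosyzygy_proj N : {linear I N 0%N -> cosyzygy N} := coker_proj (aug N).

Lemma cosyzygy_short_exact N : short_exact (aug N) (cosyzygy_proj N).
Proof. exact/coker_short_exact/(@ir_aug_inj _ _ (I N)). Qed.

Lemma injective_hull_injective N : injective_module (I N 0%N).
Proof. exact: (@ir_injective _ _ (I N)). Qed.

(** A relation rather than a function: [h] depends on the extension [e], and two choices differ by a
    map through [I N' 0]. *)
Definition cosyzygy_lift (N N' : lmodType R) (f : {linear N -> N'})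
    (h : {linear cosyzygy N -> cosyzygy N'}) : Prop :=
  exists e : {linear I N 0%N -> I N' 0%N}, (forall x, e (aug N x) = aug N' (f x)) /\
    (forall y, h (cosyzygy_proj N y) = cosyzygy_proj N' (e y)).

(** Up to maps through [I A 0], [d] is the class of the extension in [Ext^1(C, A)], computed as the
    cokernel of [Hom(C, I A 0) -> Hom(C, cosyzygy A)]. *)
Definition classifies (A B C : lmodType R) (f : {linear A -> B})
    (g : {linear B -> C}) (d : {linear C -> cosyzygy A}) : Prop :=
  exists j : {linear B -> I A 0%N}, (forall x, j (f x) = aug A x) /\
    (forall y, d (g y) = cosyzygy_proj A (j y)).

Lemma cosyzygy_lift_exists (N N' : lmodType R) (f : {linear N -> N'}) :
  exists h, cosyzygy_lift f h.
Proof.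
have [ai _ _] := cosyzygy_short_exact N.
have [e He] := injective_hull_injective (aug N' \o f : {linear N -> I N' 0%N}) ai.
have [|h Hh] := factor_through_surj (u := cosyzygy_proj N' \o e)
  (@coker_proj_surj _ _ _ (aug N)).
  move=> _ /coker_exact[x <-]; rewrite -[LHS]/(cosyzygy_proj N' (e _)) He.
  exact: short_exact0 (cosyzygy_short_exact _) _.
by exists h, e.
Qed.

Lemma classifies_exists (A B C : lmodType R) (f : {linear A -> B})
  (g : {linear B -> C}) : short_exact f g -> exists d, classifies f g d.
Proof.
move=> [fi fg gs].
have [j jf] := injective_hull_injective (aug A) fi.
have [|d Hd] := factor_through_surj (u := cosyzygy_proj A \o j) gs.
  move=> _ /fg[x <-]; rewrite -[LHS]/(cosyzygy_proj A (j _)) jf.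
  exact: short_exact0 (cosyzygy_short_exact _) _.
by exists d, j.
Qed.

Definition classifying (A B C : lmodType R) (f : {linear A -> B})
    (g : {linear B -> C}) (fg : short_exact f g) : {linear C -> cosyzygy A} :=
  sval (cid (classifies_exists fg)).

Lemma classifyingP (A B C : lmodType R) (f : {linear A -> B})
    (g : {linear B -> C}) (fg : short_exact f g) : classifies f g (classifying fg).
Proof. exact: (svalP (cid (classifies_exists fg))). Qed.

Section Functors.
Variable k : comPzRingType.

(** The two composites differ by a map through the injective [I A' 0]: [e \o j - j' \o b] vanishes
    on the image of [f] and descends to [m]. By [fmap_homotopic], [F] does not see this
    difference. *)
Lemma fmap_classifies (F : functor R k) : half_exact F ->
  (forall E, injective_module E -> forall x : F E, x = 0) ->
  forall (A B C A' B' C' : lmodType R) (f : {linear A -> B})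
    (g : {linear B -> C}) (f' : {linear A' -> B'}) (g' : {linear B' -> C'})
    (a : {linear A -> A'}) (b : {linear B -> B'}) (c : {linear C -> C'}) d d' h,
  short_exact f g ->
  (forall x, b (f x) = f' (a x)) -> (forall x, c (g x) = g' (b x)) ->
  classifies f g d -> classifies f' g' d' -> cosyzygy_lift a h ->
  forall z, fmap F d' (fmap F c z) = fmap F h (fmap F d z).
Proof.
move=> Fh Fi A B C A' B' C' f g f' g' a b c d d' h [fi fg gs] bf cg
  [j [jf dg]] [j' [jf' dg']] [e [ea he]] z.
have [|m Hm] := factor_through_surj (u := (e \o j) \- (j' \o b)) gs.
  by move=> _ /fg[x <-] /=; rewrite bf jf' jf ea subrr.
rewrite -!fmap_comp; apply: (fmap_homotopic Fh Fi
  (@injective_hull_injective A') (h := m) (p := cosyzygy_proj A')) => y.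
have [w <-] := gs y; have {}Hm : m (g w) = e (j w) - j' (b w) by exact: Hm.
rewrite -[LHS]/(d' (c (g w))) -[RHS]/(h (d (g w)) - cosyzygy_proj A' (m (g w))).
rewrite cg dg' dg he Hm linearB.
by rewrite opprB addrC subrK.
Qed.

Definition zero_nat_trans (F G : functor R k) : nat_trans F G.
Proof.
exists (fun N => \0 : {linear F N -> G N}) => A B f x.
by rewrite linear0.
Defined.

Lemma inverse_nat_trans (F G : functor R k) (t : nat_trans F G) :
  (forall N, bijective (t N)) ->
  exists r : nat_trans G F, forall N x, t N (r N x) = x.
Proof.
move=> tb.
have H N : exists r : {linear G N -> F N}, forall x, t N (r x) = x.
  have [|||r Hr] := @linear_choice k (G N) (F N) (fun x y => t N y = x).
  - by move=> c x y x' y' <- <-; rewrite linearP.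
  - by move=> x; have [g _ gK] := tb N; exists (g x).
  - by move=> y E; apply: (bij_inj (tb N)); rewrite E linear0.
  by exists r => x; apply/Hr.
pose r N := sval (cid (H N)).
have rK N x : t N (r N x) = x by exact: (svalP (cid (H N)) x).
have rn (A B : lmodType R) (f : {linear A -> B}) x :
    r B (fmap G f x) = fmap F f (r A x).
  by apply: (bij_inj (tb B)); rewrite nt_natural !rK.
by exists (NatTrans rn).
Qed.

Section Compositions.
Variables U V W : homological_functor R k.

Definition comp_nat_trans (F G H : functor R k) (u : nat_trans G H)
    (v : nat_trans F G) : nat_trans F H.
Proof.
exists (fun N => u N \o v N : {linear F N -> H N}) => A B f x.
by rewrite /= !nt_natural.
Defined.

Definition id_nat_trans (F : functor R k) : nat_trans F F.
Proof. by exists (fun N => idfun : {linear F N -> F N}). Defined.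

Definition comp_hf (u : hf_morphism V W) (v : hf_morphism U V) : hf_morphism U W.
Proof.
exists (fun n => comp_nat_trans (u n) (v n)) => n A B C f g fg z.
by rewrite /= !hm_conn.
Defined.

Definition id_hf : hf_morphism U U.
Proof. by exists (fun n => id_nat_trans (U n)). Defined.

End Compositions.

(** * Descending extension of morphisms of homological functors *)

Section ExtendDown.
Variables U W : homological_functor R k.
Hypothesis U_inj : vanishes_on_injectives U.

Local Notation se := cosyzygy_short_exact.

Lemma conn_cosyzygy_inj n N : injective (hf_conn U n (se N)).
Proof.
have H x : hf_conn U n (se N) x = 0 -> x = 0.
  move/(hf_exact_right (se N)) => [y <-].
  by rewrite (U_inj (@injective_hull_injective N) y) linear0.
exact: raddf_inj.
Qed.

Lemma conn_cosyzygy_surj n N x : exists y, hf_conn U n (se N) y = x.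
Proof.
by apply/(hf_exact_left (se N))/(U_inj (@injective_hull_injective N)).
Qed.

(** [j] and [d] form a morphism to the cosyzygy sequence that is the identity on [A]. By naturality,
    the connecting maps of cosyzygy sequences determine all others. *)
Lemma conn_classifies (V : homological_functor R k) n (A B C : lmodType R)
    (f : {linear A -> B}) (g : {linear B -> C}) (fg : short_exact f g) d :
  classifies f g d ->
  forall z, hf_conn V n fg z = hf_conn V n (se A) (fmap (V (1 + n)) d z).
Proof.
move=> [j [jf dg]] z.
rewrite (hf_natural fg (se A) (a := idfun) (b := j) (c := d)) //.
by rewrite fmap_id.
Qed.

(** The connecting map of [U] at a cosyzygy sequence is bijective because [U] kills the middle term.
    This forces [t'], and naturality of connecting maps makes it natural. *)
Lemma shift_down_exists n (t : nat_trans (U (1 + n)) (W (1 + n))) :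
  exists t' : nat_trans (U n) (W n), forall N x,
    t' N (hf_conn U n (se N) x) = hf_conn W n (se N) (t _ x).
Proof.
have H N : exists t' : {linear U n N -> W n N}, forall x,
    t' (hf_conn U n (se N) x) = hf_conn W n (se N) (t _ x).
  have [|t' Ht'] := factor_through_surj (u := hf_conn W n (se N) \o t _)
     (@conn_cosyzygy_surj n N).
    move=> y E; have -> : y = 0 by apply: conn_cosyzygy_inj; rewrite E linear0.
    by rewrite !linear0.
  by exists t'.
pose t' N := sval (cid (H N)).
have t'E N x : t' N (hf_conn U n (se N) x) = hf_conn W n (se N) (t _ x).
  exact: (svalP (cid (H N)) x).
have t'nat (N N' : lmodType R) (f : {linear N -> N'}) x :
    t' N' (fmap (U n) f x) = fmap (W n) f (t' N x).
  have [y <-] := conn_cosyzygy_surj x; have [h [e [ea he]]] := cosyzygy_lift_exists f.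
  rewrite t'E -!(hf_natural (se N) (se N') ea he) t'E.
  by rewrite nt_natural.
by exists (NatTrans t'nat).
Qed.

Definition shift_down n (t : nat_trans (U (1 + n)) (W (1 + n))) :=
  sval (cid (shift_down_exists t)).

Lemma shift_downE n t N x : @shift_down n t N (hf_conn U n (se N) x)
  = hf_conn W n (se N) (t _ x).
Proof. exact: (svalP (cid (shift_down_exists t)) N x). Qed.

(** Every element of [U n N] is a connecting image from degree [1 + n], so agreement descends one
    degree at a time. *)
Lemma hf_morphism_unique (u v : hf_morphism U W) n0 :
  (forall n, n0 <= n -> forall N x, u n N x = v n N x) ->
  forall n N x, u n N x = v n N x.
Proof.
move=> H; suff K m n : n0 - m%:Z <= n -> forall N x, u n N x = v n N x.
  by move=> n; apply: (K `|n0 - n|%N); lia.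
elim: m n => [|m IH] n Hn N x; first by apply: H; lia.
have [y <-] := conn_cosyzygy_surj x.
by rewrite !hm_conn IH //; lia.
Qed.

Variables (n0 : int) (t : forall n, nat_trans (U n) (W n)).
Hypothesis t_conn : forall n, n0 <= n ->
  forall (A B C : lmodType R) (f : {linear A -> B})
    (g : {linear B -> C}) (fg : short_exact f g) z,
    t n A (hf_conn U n fg z) = hf_conn W n fg (t (1 + n) C z).

Fixpoint extend_down_by m n : nat_trans (U n) (W n) :=
  if m is m'.+1 then shift_down (extend_down_by m' (1 + n)) else t n.

(** The number of steps makes the recursion read [t] in degree [n0] when [n] is smaller, and never
    below [n0]. *)
Definition extend_down n :=
  extend_down_by (if n0 <= n then 0%N else absz (n0 - n)) n.

Lemma extend_down_high n : n0 <= n -> extend_down n = t n.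
Proof. by rewrite /extend_down => ->. Qed.

Lemma extend_down_conn n (A B C : lmodType R) (f : {linear A -> B})
    (g : {linear B -> C}) (fg : short_exact f g) z :
  extend_down n A (hf_conn U n fg z) = hf_conn W n fg (extend_down (1 + n) C z).
Proof.
case: (boolP (n0 <= n)) => Hn.
  by rewrite !extend_down_high ?t_conn //; lia.
have E : extend_down n = shift_down (extend_down (1 + n)).
  rewrite /extend_down (negbTE Hn).
  (* From degree [1 + n] one step fewer is needed, so the recursion unfolds to [shift_down]. *)
  have -> : absz (n0 - n) = (if (n0 <= 1 + n)%R then 0%N else absz (n0 - (1 + n))%R).+1.
    by case: (boolP (n0 <= 1 + n)); lia.
  by [].
have [d Hd] := classifies_exists fg.
rewrite !(conn_classifies _ Hd) E shift_downE nt_natural //.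
Qed.

Lemma extend_down_exists : exists u : hf_morphism U W,
  forall n, n0 <= n -> u n = t n.
Proof.
exists (HfMorphism extend_down_conn) => n; exact: extend_down_high.
Qed.

End ExtendDown.

(** * Homological functors by dimension shifting *)

Section DimensionShifting.
Variable T : int -> functor R k.
Hypothesis T_inj : forall i E, injective_module E -> forall x : T i E, x = 0.
Variable s : forall i N, {linear T (1 + i) (cosyzygy N) -> T i N}.
Hypothesis s_inj : forall i N, injective (@s i N).
Hypothesis s_surj : forall i N x, exists y, @s i N y = x.
Hypothesis s_natural : forall i (N N' : lmodType R) (f : {linear N -> N'}) h,
  cosyzygy_lift f h ->
  forall x, s i N' (fmap (T (1 + i)) h x) = fmap (T i) f (s i N x).

(* The third rotation of 0 -> A -> B -> C -> 0 is the sequence of cosyzygies. *)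
Lemma half_exact_descends i : half_exact (T (1 + i)) -> half_exact (T i).
Proof.
move=> Th A B C f g fg y.
have [h1 [e1 [ea1 he1]]] := cosyzygy_lift_exists f.
have [h2 [e2 [ea2 he2]]] := cosyzygy_lift_exists g.
have H1 := @s_natural i _ _ _ _ (ex_intro _ e1 (conj ea1 he1)).
have H2 := @s_natural i _ _ _ _ (ex_intro _ e2 (conj ea2 he2)).
have := rotate_exact3 Th (@T_inj (1 + i)) fg (cosyzygy_short_exact A)
  (@injective_hull_injective A) (cosyzygy_short_exact B)
  (@injective_hull_injective B) ea1 he1 (cosyzygy_short_exact C)
  (@injective_hull_injective C) ea2 he2.
have [z <-] := s_surj y; move/(_ z) => E; split=> [|[x]].
  rewrite -H2 => E1; have /E[x Ex] : fmap (T (1 + i)) h2 z = 0.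
    by apply: (@s_inj i C); rewrite E1 linear0.
  by exists (s i A x); rewrite -H1 Ex.
have [w <-] := s_surj x; rewrite -H1 => /s_inj Ew.
by rewrite -H2 (_ : fmap _ h2 z = 0) ?linear0 //; apply/E; exists w.
Qed.

Variable n0 : int.
Hypothesis T_half_high : forall i, n0 <= i -> half_exact (T i).

Lemma half_exact_all i : half_exact (T i).
Proof.
suff K m j : n0 - m%:Z <= j -> half_exact (T j).
  by apply: (K `|n0 - i|%N); lia.
elim: m j => [|m IH] j Hj; first by apply: T_half_high; lia.
by apply/half_exact_descends/IH; lia.
Qed.

(** The choice of classifying map is immaterial: by [fmap_classifies] for identity maps, all of them
    induce the same map. *)
Definition shift_conn i (A B C : lmodType R) (f : {linear A -> B})
    (g : {linear B -> C}) (fg : short_exact f g) :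
    {linear T (1 + i) C -> T i A} :=
  s i A \o fmap (T (1 + i)) (classifying fg).

Lemma shift_conn_natural n (A B C A' B' C' : lmodType R)
    (f : {linear A -> B}) (g : {linear B -> C}) (fg : short_exact f g)
    (f' : {linear A' -> B'}) (g' : {linear B' -> C'})
    (fg' : short_exact f' g')
    (a : {linear A -> A'}) (b : {linear B -> B'}) (c : {linear C -> C'}) :
    (forall x, b (f x) = f' (a x)) -> (forall x, c (g x) = g' (b x)) ->
    forall z, @shift_conn n _ _ _ _ _ fg' (fmap (T (1 + n)) c z)
              = fmap (T n) a (@shift_conn n _ _ _ _ _ fg z).
Proof.
move=> bf cg z; have [h Hh] := cosyzygy_lift_exists a.
rewrite /= -(s_natural Hh); congr (s _ _ _).
exact: (fmap_classifies (half_exact_all (i := 1 + n)) (@T_inj _) fg bf cg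
  (classifyingP fg) (classifyingP fg') Hh).
Qed.

Lemma shift_exact_right n (A B C : lmodType R) (f : {linear A -> B})
    (g : {linear B -> C}) (fg : short_exact f g) :
  exact_seq (fmap (T (1 + n)) g) (@shift_conn n _ _ _ _ _ fg).
Proof.
have [j [jf dg]] := classifyingP fg.
have H := rotate_exact1 (half_exact_all (i := 1 + n)) (@T_inj _) fg
  (cosyzygy_short_exact A) jf dg (@injective_hull_injective A).
move=> z; rewrite -H /=; split=> [E|->]; last by rewrite linear0.
by apply: (@s_inj n A); rewrite E linear0.
Qed.

(** Under the bijections [s], the map induced by [f] becomes the one induced by its cosyzygy lift
    [h], and [rotate_exact2] applies. *)
Lemma shift_exact_left n (A B C : lmodType R) (f : {linear A -> B})
    (g : {linear B -> C}) (fg : short_exact f g) :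
  exact_seq (@shift_conn n _ _ _ _ _ fg) (fmap (T n) f).
Proof.
have [j [jf dg]] := classifyingP fg.
have [h [e [ea he]]] := cosyzygy_lift_exists f.
have H1 := @s_natural n _ _ _ _ (ex_intro _ e (conj ea he)).
have H := rotate_exact2 (half_exact_all (i := 1 + n)) (@T_inj _) fg
  (cosyzygy_short_exact A) jf dg (@injective_hull_injective A)
  (cosyzygy_short_exact B) (@injective_hull_injective B) ea he.
move=> z; have [y <-] := s_surj z; rewrite -H1; split=> [E|[x /s_inj Ex]].
  have /H[x Ex] : fmap (T (1 + n)) h y = 0.
    by apply: (@s_inj n B); rewrite E linear0.
  by exists x; rewrite /= Ex.
by rewrite (_ : fmap _ h y = 0) ?linear0 //; apply/H; exists x.
Qed.

Definition shift_homological_functor : homological_functor R k :=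
  @HomologicalFunctor R k T shift_conn shift_conn_natural
    (fun n A B C f g fg => half_exact_all fg) shift_exact_right shift_exact_left.

(** * Comparison with a J-completion *)

Section Comparison.
Variable W : homological_functor R k.
Variable t : forall i, nat_trans (T i) (W i).
Hypothesis t_bij : forall i, n0 <= i -> forall N, bijective (t i N).
Hypothesis t_conn : forall i, n0 <= i -> forall N x,
  t i N (s i N x) = hf_conn W i (cosyzygy_short_exact N) (t (1 + i) (cosyzygy N) x).

Lemma J_completion_iso (V : homological_functor R k) (tau : hf_morphism V W) :
  is_J_completion tau -> forall i, functor_iso (V i) (T i).
Proof.
move=> [V_inj univ].
pose U := shift_homological_functor.
have U_inj : vanishes_on_injectives U by exact: T_inj.
have tc n : n0 <= n -> forall (A B C : lmodType R) (f : {linear A -> B})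
    (g : {linear B -> C}) (fg : short_exact f g) z,
    t n A (hf_conn U n fg z) = hf_conn W n fg (t (1 + n) C z).
  move=> Hn A B C f g fg z; rewrite /= t_conn // nt_natural.
  by rewrite -(conn_classifies _ (classifyingP fg)).
(* [ups] extends [t] to all degrees and lifts to [sig] by the universal property. *)
have [ups Hups] := extend_down_exists U_inj tc.
have [sig [Hsig _]] := univ U ups U_inj.
have r_ex n : exists r : nat_trans (V n) (T n),
    n0 <= n -> forall N x, t n N (r N x) = tau n N x.
  (* Below [n0] the zero map is a default: the extension reads only degrees from [n0] on. *)
  case: (boolP (n0 <= n)) => [Hn|_]; last by exists (zero_nat_trans _ _).
  have [r Hr] := inverse_nat_trans (t_bij Hn).
  exists (comp_nat_trans r (tau n)) => _ N x; exact: Hr.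
pose r n : nat_trans (V n) (U n) := sval (cid (r_ex n)).
have rE n : n0 <= n -> forall N x, t n N (r n N x) = tau n N x.
  exact: (svalP (cid (r_ex n))).
have rc n : n0 <= n -> forall (A B C : lmodType R) (f : {linear A -> B})
    (g : {linear B -> C}) (fg : short_exact f g) z,
    r n A (hf_conn V n fg z) = hf_conn U n fg (r (1 + n) C z).
  move=> Hn A B C f g fg z; apply: (bij_inj (t_bij Hn A)).
  by rewrite rE // tc // rE ?hm_conn //; lia.
have [rho Hrho] := extend_down_exists (U := V) (W := U) V_inj (t := r) rc.
have E1 n N x : ups n N (rho n N x) = tau n N x.
  apply: (hf_morphism_unique V_inj (u := comp_hf ups rho) (v := tau) (n0 := n0)).
  by move=> m Hm A y; rewrite /= Hups // Hrho // rE.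
(* The composite of [sig] and [rho] and the identity both lift [tau] through itself, so uniqueness
   identifies them. *)
have [sig' [_ Hsig']] := univ V tau V_inj.
have E2 n N x : sig n N (rho n N x) = x.
  rewrite [LHS](Hsig' (comp_hf sig rho)) => [|m A y]; last by rewrite /= Hsig E1.
  by rewrite -(Hsig' (id_hf V)).
(* From [n0] on, [ups] is the injective [t] and sends both sides to the same element; lower degrees
   follow by descent. *)
have E3 n N x : rho n N (sig n N x) = x.
  apply: (hf_morphism_unique U_inj (u := comp_hf rho sig) (v := id_hf U) (n0 := n0)).
  move=> m Hm A y; apply: (bij_inj (t_bij Hm A)).
  by rewrite -Hups //= E1 Hsig.
by move=> i; exists (rho i) => N; exists (sig i N) => x; [apply: E2 | apply: E3].
Qed.
End Comparison.
End DimensionShifting.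
End Functors.
End Cosyzygy.

(** * Flat dimension and the vanishing of Tor *)

Section Syzygy.
Variables (S : pzRingType) (Q : lmodType S -> Prop) (N : lmodType S).
Variable F : left_resolution Q N.

Lemma syzygy_short_exact :
  exists w : {linear coker (lr_d F 1) -> F 0%N}, short_exact w (lr_aug F).
Proof.
have [w [wi Hw]] := coker_embedding (@lr_exact _ _ _ F 0%N).
exists w; split=> // [y|]; last exact: (@lr_aug_surj _ _ _ F).
rewrite (@lr_exact_aug _ _ _ F); split=> -[u Eu].
  by exists (coker_proj _ u); rewrite Hw.
by move: Eu; have [v <-] := coker_proj_surj u; rewrite Hw => Ev; exists v.
Qed.

Definition syzygy_resolution : left_resolution Q (coker (lr_d F 1)) :=
  @LeftResolution _ Q _ (fun n => F n.+1) (fun n => lr_d F n.+1)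
    (coker_proj (lr_d F 1)) (fun n => lr_class F n.+1)
    (@coker_proj_surj _ _ _ (lr_d F 1)) (@coker_exact _ _ _ (lr_d F 1))
    (fun n => @lr_exact _ _ _ F n.+1).

End Syzygy.

Section TensorFacts.
Variables (k : comPzRingType) (R : kalgebra k).

Lemma pure0r (M : lmodType R^c) (N : lmodType R) (m : M) :
  pure m 0 = 0 :> tensor M N.
Proof. by apply: (addrI (pure m 0)); rewrite -pureDr !addr0. Qed.

Lemma tensor_map_comp (M M' M2 : lmodType R^c) (N N' N2 : lmodType R)
    (g : {linear M -> M'}) (g' : {linear M' -> M2}) (g2 : {linear M -> M2})
    (h : {linear N -> N'}) (h' : {linear N' -> N2}) (h2 : {linear N -> N2}) t :
  (forall x, g' (g x) = g2 x) -> (forall x, h' (h x) = h2 x) ->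
  tensor_map g' h' (tensor_map g h t) = tensor_map g2 h2 t.
Proof.
move=> Hg Hh; elim/tensor_ind: t => [|p n|u v Hu Hv].
- by rewrite !linear0.
- by rewrite !tensor_mapE Hg Hh.
- by move: Hu Hv; rewrite !linearD /= => -> ->.
Qed.

Lemma tensor_map_id (M : lmodType R^c) (N : lmodType R) (t : tensor M N) :
  tensor_map (idfun : {linear M -> M}) (idfun : {linear N -> N}) t = t.
Proof.
elim/tensor_ind: t => [|p n|u v Hu Hv]; first by rewrite linear0.
  by rewrite tensor_mapE.
by move: Hu Hv; rewrite linearD /= => -> ->.
Qed.

Lemma tensor_map_eq0 (M M' : lmodType R^c) (N N' : lmodType R)
    (g : {linear M -> M'}) (h : {linear N -> N'}) t :
  (forall x, h x = 0) -> tensor_map g h t = 0.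
Proof.
move=> H; elim/tensor_ind: t => [|p n|u v Hu Hv]; first by rewrite linear0.
  by rewrite tensor_mapE H pure0r.
by move: Hu Hv; rewrite linearD /= => -> ->; rewrite addr0.
Qed.

Lemma tensor_map_surj (M M' : lmodType R^c) (N N' : lmodType R)
    (g : {linear M -> M'}) (h : {linear N -> N'}) :
  (forall y, exists x, g x = y) -> (forall y, exists x, h x = y) ->
  forall t, exists u, tensor_map g h u = t.
Proof.
move=> gs hs t; elim/tensor_ind: t => [|p n|u v [u' <-] [v' <-]].
- by exists 0; rewrite linear0.
- have [p' <-] := gs p; have [n' <-] := hs n.
  by exists (pure p' n'); rewrite tensor_mapE.
- by exists (u' + v'); rewrite linearD.
Qed.

Variables (M : lmodType R^c) (P : projective_resolution M).

(** The resolution is cut at the cokernels of its differentials, and flatness of [F] preserves each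
    piece. *)
Lemma flat_tor_exact (F : lmodType R) : flat_module F ->
  forall n, exact_seq (tor_d P F n.+1) (tor_d P F n).
Proof.
move=> flatF n x; split=> [dx|[y <-]]; last exact: tor_dd.
have [z [zi Hz]] := coker_embedding (@lr_exact _ _ _ P n).
have [w [se Hw]] := coker_resolution (@lr_exact _ _ _ P n.+1).
have [zi' _ _] := flatF _ _ _ _ _ (coker_short_exact zi).
have [_ E _] := flatF _ _ _ _ _ se.
have /E[kappa Ek] : tensor_map (coker_proj (lr_d P n.+1)) idfun x = 0.
  by apply: zi'; rewrite linear0 -[RHS]dx; apply: tensor_map_comp.
have [y Ey] := tensor_map_surj (h := (idfun : {linear F -> F}))
  (@coker_proj_surj _ _ _ (lr_d P n.+2)) (fun y => ex_intro _ y erefl) kappa.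
by exists y; rewrite -Ek -Ey; apply/esym; apply: tensor_map_comp.
Qed.

Lemma flat_tor_eq0 (F : lmodType R) : flat_module F ->
  forall n (x : homology (tor_complex P F) n.+1), x = 0.
Proof.
move=> flatF n q; have [x Zx ->] := subquotP q.
by apply/(cls_eq0 _ Zx)/(flat_tor_exact flatF).
Qed.

(** Dimension shifting along [0 -> K -> F 0 -> N -> 0]: as the flat [F 0] has no higher [Tor], the
    connecting map embeds [Tor] of [N] in degree [n + 1] into [Tor] of the syzygy [K] in degree [n],
    and [K] has a flat resolution shorter by one. For [d = 0], [K] is a quotient of [F 1 = 0]. *)
Lemma flat_dim_tor_eq0 d N : flat_dim_le N d ->
  forall n, (d <= n)%N -> forall x : homology (tor_complex P N) n.+1, x = 0.
Proof.
elim: d N => [|d IH] N [F Fd] n Hn x; have [w se] := syzygy_short_exact F;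
  suff E0 : conn (tor_short_exact P se) n x = 0.
- have /(les_right (tor_short_exact P se))[y <-] := E0.
  by rewrite (flat_tor_eq0 (lr_class F 0) y) linear0.
- move: (conn _ _ _) => q; have [y Zy ->] := subquotP q.
  suff -> : y = 0 by apply/cls_eq0; exact: smem0.
  rewrite -[LHS]tensor_map_id; apply: tensor_map_eq0 => u.
  by have [v <-] := coker_proj_surj u; rewrite (Fd 1%N isT v) linear0.
- have /(les_right (tor_short_exact P se))[y <-] := E0.
  by rewrite (flat_tor_eq0 (lr_class F 0) y) linear0.
- case: n Hn x => // n Hn x; apply: IH => //.
  by exists (syzygy_resolution F) => m Hm; apply: Fd.
Qed.

End TensorFacts.

(** * Stable homology under shifts of injective resolutions *)

Section TrivialResolution.
Variables (S : pzRingType) (E : lmodType S).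
Hypothesis iE : injective_module E.

Definition trivial_resolution : injective_resolution E.
Proof.
refine (@InjectiveResolution _ E
  (fun n => if n is 0%N then E else ('rV[S]_0 : lmodType S))
  (fun n => \0) (idfun : {linear E -> E}) _ _ _ _).
- case=> [|n] //= A B u v _; exists \0 => a.
  exact: etrans (thinmx0 _) (esym (thinmx0 _)).
- by [].
- by move=> y; split=> // _; exists y.
- by move=> n y; split=> // _; exists 0; rewrite linear0 [y]thinmx0.
Defined.

End TrivialResolution.

Section ShiftedResolution.
Variables (S : pzRingType) (N : lmodType S) (I : injective_resolution N).

Lemma shift_aug_exists : exists w : {linear coker (ir_aug I) -> I 1%N},
  injective w /\ forall y, w (coker_proj (ir_aug I) y) = ir_d I 0 y.
Proof. exact: coker_embedding (@ir_exact_aug _ _ I). Qed.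

Definition shift_aug := sval (cid shift_aug_exists).

Lemma shift_augE y : shift_aug (coker_proj (ir_aug I) y) = ir_d I 0 y.
Proof. by case: (svalP (cid shift_aug_exists)). Qed.

Definition shift_resolution : injective_resolution (coker (ir_aug I)).
Proof.
refine (@InjectiveResolution _ _ (fun n => I n.+1) (fun n => ir_d I n.+1)
  shift_aug (fun n => @ir_injective _ _ I n.+1) _ _
  (fun n => @ir_exact _ _ I n.+1)).
- by case: (svalP (cid shift_aug_exists)).
- move=> y; rewrite (@ir_exact _ _ I 0 y); split=> -[x Ex].
    by exists (coker_proj _ x); rewrite shift_augE.
  by move: Ex; have [z <-] := coker_proj_surj x; rewrite shift_augE; exists z.
Defined.

End ShiftedResolution.

Section Stable.
Variables (k : comPzRingType) (R : kalgebra k) (M : lmodType R^c).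
Variable P : projective_resolution M.

Local Notation tcls I n x := (cls subT (tot_fin P I n) x).

Section Components.
Variables (N : lmodType R) (I : injective_resolution N) (n : int).
Variables (x y : tot P I n) (c : k) (a b : nat) (h : a%:Z - b%:Z == n).
Lemma tot_atD : tot_at (x + y) h = tot_at x h + tot_at y h. Proof. by []. Qed.
Lemma tot_atB : tot_at (x - y) h = tot_at x h - tot_at y h. Proof. by []. Qed.
Lemma tot_atZ : tot_at (c *: x) h = c *: tot_at x h. Proof. by []. Qed.
End Components.

(** All lifts of [h] induce the same map, so [chi] may be replaced by the composite of [psi] and
    [phi]. *)
Lemma stable_tor_lift_comp (A B C : lmodType R) (I : injective_resolution A)
    (J : injective_resolution B) (L : injective_resolution C)
    (f : {linear A -> B}) (g : {linear B -> C}) (h : {linear A -> C})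
    (phi : cochain_lift I J f) (psi : cochain_lift J L g)
    (chi : cochain_lift I L h) i :
  (forall x, h x = g (f x)) -> forall q,
  stable_tor_lift P chi i q = stable_tor_lift P psi i (stable_tor_lift P phi i q).
Proof.
move=> Eh q; have cc n y : (psi n.+1 \o phi n.+1) (ir_d I n y)
              = ir_d L n ((psi n \o phi n) y).
  by rewrite /= !lift_comm.
have ca y : (psi 0 \o phi 0) (ir_aug I y) = ir_aug L (h y).
  by rewrite /= !lift_aug Eh.
rewrite (stable_tor_lift_indep chi
  (@CochainLift _ _ _ I L h (fun n => psi n \o phi n) cc ca)).
have [x dx ->] := stable_torP q.
have dx' : tilde_d P J i (tcls J (1 + i) (tot_map P phi (1 + i) x)) = 0.
  rewrite -tilde_mapE -[LHS](tilde_comm phi).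
  by rewrite [ic_d _ _ _]dx linear0.
rewrite !stable_tor_lift_cls //.
congr (cls _ _ (cls _ _ _)); apply: tot_ext => a b e.
rewrite [LHS]tot_mapE [RHS]tot_mapE [in RHS]tot_mapE.
by apply/esym/tensor_map_comp.
Qed.

Lemma stable_tor_lift_id (A : lmodType R) (I : injective_resolution A)
    (phi : cochain_lift I I idfun) i q : stable_tor_lift P phi i q = q.
Proof.
pose id_lift : cochain_lift I I idfun :=
  @CochainLift _ _ _ I I idfun (fun n => idfun) (fun _ _ => erefl)
    (fun _ => erefl).
rewrite (stable_tor_lift_indep phi id_lift).
have [x dx ->] := stable_torP q; rewrite stable_tor_lift_cls //.
congr (cls _ _ (cls _ _ _)); apply: tot_ext => a b e; rewrite [LHS]tot_mapE.
exact: tensor_map_id.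
Qed.

(** Lifts of the identity compose to lifts of the identity, which act trivially. Thus stable
    homology may be computed with any convenient injective resolution. *)
Lemma stable_tor_lift_idK (A : lmodType R) (I J : injective_resolution A)
    (phi : cochain_lift I J idfun) (psi : cochain_lift J I idfun) i :
  cancel (stable_tor_lift P phi i) (stable_tor_lift P psi i).
Proof.
move=> q; have [chi _] := lift_exists I I idfun.
by rewrite -(stable_tor_lift_comp phi psi chi) // stable_tor_lift_id.
Qed.

Lemma idx0_mem n a : a%:Z - 0%:Z == n -> (a, 0%N) \in [:: (absz n, 0%N)].
Proof. by move=> /eqP <-; rewrite subr0 inE. Qed.

(** For the resolution concentrated in degree 0, each total degree has at most one nonzero
    component, so the product equals the coproduct and the quotient complex is zero. *)
Lemma stable_tor_injective (E : lmodType R) (I : injective_resolution E) i :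
  injective_module E -> forall q : stable_tor_obj P I i, q = 0.
Proof.
move=> iE q; pose J := trivial_resolution iE.
have [phi _] := lift_exists I J idfun; have [psi _] := lift_exists J I idfun.
have E1 := @stable_tor_lift_idK _ _ _ phi psi i q.
suff E0 : stable_tor_lift P phi i q = 0 by rewrite -E1 E0 linear0.
move: (stable_tor_lift P phi i q) => {E1}{}q; have [x dx ->] := stable_torP q.
apply/cls_eq0; [exact: dx | exists 0; rewrite linear0; apply/esym].
apply/cls_eq0 => //; apply/tot_finP; exists [:: (absz (1 + i), 0%N)].
move=> a [|b] h; last first.
  move=> _; rewrite -[LHS]tensor_map_id; apply: tensor_map_eq0 => y.
  exact: thinmx0.
by rewrite (idx0_mem h).
Qed.

Section Shift.
Variables (N : lmodType R) (I : injective_resolution N).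
Local Notation J := (shift_resolution I).

(* Row b of the double complex for J is row b.+1 of that for I; the missing row
   b = 0 contributes one component to each degree, hence nothing modulo tot_fin. *)
Definition tot_shift_at n (x : tot P J (1 + n)) a b :
    a%:Z - b%:Z == n -> tensor (P a) (I b) :=
  match b return a%:Z - b%:Z == n -> tensor (P a) (I b) with
  | 0 => fun _ => 0
  | b'.+1 => fun h => tot_at x (idx_pred h)
  end.

Definition tot_shift_fun n (x : tot P J (1 + n)) : tot P I n :=
  (fun p => tot_shift_at x (proj2_sig p)) : dprod _.

Lemma tot_shiftE0 n (x : tot P J (1 + n)) a (h : a%:Z - 0%:Z == n) :
  tot_at (tot_shift_fun x) h = 0.
Proof. by []. Qed.

Lemma tot_shiftES n (x : tot P J (1 + n)) a b (h : a%:Z - b.+1%:Z == n) :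
  tot_at (tot_shift_fun x) h = tot_at x (idx_pred h).
Proof. by []. Qed.

Lemma tot_shift_linear n : linear (@tot_shift_fun n).
Proof.
move=> c x y; apply: tot_ext => a [|b] h; rewrite tot_at_lin.
  by rewrite !tot_shiftE0 scaler0 addr0.
by rewrite !tot_shiftES tot_at_lin.
Qed.

Definition tot_shift n : {linear tot P J (1 + n) -> tot P I n} :=
  mk_linear (@tot_shift_linear n).

Lemma tot_shift_d n x :
  tot_shift n (tot_d P J (1 + n) x) = tot_d P I n (tot_shift (1 + n) x).
Proof.
apply: tot_ext => a [|b] h.
  by rewrite [LHS]tot_shiftE0 [RHS]tot_dE tot_shiftE0 linear0 scaler0 addr0.
rewrite [LHS]tot_shiftES [LHS]tot_dE [RHS]tot_dE tot_shiftES.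
rewrite (tot_at_irr x (idx_succ (idx_pred h)) (idx_pred (idx_succ h))).
congr (_ + _ *: _); case: b h => [|b] h /=; first by rewrite tot_shiftE0 linear0.
by rewrite tot_shiftES; congr (tensor_map _ _ _); apply: tot_at_irr.
Qed.

Lemma tot_shift_fin n x : tot_fin P I n (tot_shift n x) <-> tot_fin P J (1 + n) x.
Proof.
split=> /tot_finP[s Hs]; apply/tot_finP.
  exists [seq (ab.1, ab.2.-1) | ab <- s] => a b h Hab.
  rewrite (tot_at_irr x h (idx_pred (idx_pred' h))) -tot_shiftES Hs //.
  by apply: contra Hab => H; apply/mapP; exists (a, b.+1).
exists [seq (ab.1, ab.2.+1) | ab <- s] => a [|b] h Hab //.
rewrite [LHS]tot_shiftES Hs //.
by apply: contra Hab => H; apply/mapP; exists (a, b).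
Qed.

Lemma tot_unshift n (y : tot P I n) :
  exists x, tot_fin P I n (tot_shift n x - y).
Proof.
pose x : tot P J (1 + n) := (fun p => tot_at y (idx_pred' (proj2_sig p))) : dprod _.
exists x.
apply/tot_finP; exists [:: (absz n, 0%N)] => a [|b] h.
  by rewrite (idx0_mem h).
move=> _; rewrite tot_atB [X in X - _]tot_shiftES.
by rewrite [tot_at x _](tot_at_irr y _ h) subrr.
Qed.

Definition tilde_shift n : {linear tilde_obj P J (1 + n) -> tilde_obj P I n} :=
  @sqmap k _ _ subT (tot_fin P J (1 + n)) subT (tot_fin P I n) (tot_shift n)
    (fun _ _ => Logic.I) (fun x _ => proj2 (tot_shift_fin x)).

Lemma tilde_shiftE n x : tilde_shift n (tcls J (1 + n) x) = tcls I n (tot_shift n x).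
Proof.
exact: (@sqmap_cls k _ _ subT (tot_fin P J (1 + n)) subT (tot_fin P I n) (tot_shift n)
    (fun _ _ => Logic.I) (fun x _ => proj2 (tot_shift_fin x))).
Qed.

Lemma tilde_shift_inj n : injective (tilde_shift n).
Proof.
have H q : tilde_shift n q = 0 -> q = 0.
  have [x _ ->] := subquotP q; rewrite tilde_shiftE => /cls_eq0.
  by move/(_ Logic.I)/tot_shift_fin => Hx; apply/cls_eq0.
exact: raddf_inj.
Qed.

Lemma tilde_shift_surj n q : exists p, tilde_shift n p = q.
Proof.
have [y _ ->] := subquotP q; have [x Hx] := tot_unshift y.
by exists (tcls J (1 + n) x); rewrite tilde_shiftE; apply/cls_eq.
Qed.

Lemma tilde_shift_d n q :
  tilde_shift n (tilde_d P J (1 + n) q) = tilde_d P I n (tilde_shift (1 + n) q).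
Proof.
have [x _ ->] := subquotP q.
by rewrite tilde_dE !tilde_shiftE tilde_dE tot_shift_d.
Qed.

Lemma tilde_shift_ker i x : kerS (ic_d (tilde_complex P J) (1 + i)) x ->
  kerS (ic_d (tilde_complex P I) i) (tilde_shift (1 + i) x).
Proof.
move=> Hx; rewrite -[kerS _ _]/(tilde_d P I i (tilde_shift (1 + i) x) = 0).
by rewrite -tilde_shift_d [tilde_d _ _ _ _]Hx linear0.
Qed.

Lemma tilde_shift_im i x : kerS (ic_d (tilde_complex P J) (1 + i)) x ->
  imS (ic_d (tilde_complex P J) (1 + (1 + i))) x ->
  imS (ic_d (tilde_complex P I) (1 + i)) (tilde_shift (1 + i) x).
Proof.
move=> _ [y <-]; exists (tilde_shift (1 + (1 + i)) y); exact/esym/tilde_shift_d.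
Qed.

Definition stable_shift i :
    {linear stable_tor_obj P J (1 + i) -> stable_tor_obj P I i} :=
  sqmap (@tilde_shift_ker i) (@tilde_shift_im i).

Local Notation hcls I n y :=
  (cls (kerS (ic_d (tilde_complex P I) n))
       (imS (ic_d (tilde_complex P I) (1 + n))) y).

Lemma stable_shift_cls i y : tilde_d P J (1 + i) y = 0 ->
  stable_shift i (hcls J (1 + i) y) = hcls I i (tilde_shift (1 + i) y).
Proof. exact: (sqmap_cls (@tilde_shift_ker i) (@tilde_shift_im i)). Qed.

Lemma stable_shift_tcls i x : tilde_d P J (1 + i) (tcls J (1 + (1 + i)) x) = 0 ->
  stable_shift i (hcls J (1 + i) (tcls J (1 + (1 + i)) x))
  = hcls I i (tcls I (1 + i) (tot_shift (1 + i) x)).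
Proof. by move=> dx; rewrite stable_shift_cls // tilde_shiftE. Qed.

Lemma stable_shift_inj i : injective (stable_shift i).
Proof.
have H q : stable_shift i q = 0 -> q = 0.
  have [y Hy ->] := subquotP q => /(etrans (esym (stable_shift_cls Hy))).
  move/cls_eq0 => /(_ (tilde_shift_ker Hy))[z Ez]; apply/cls_eq0 => //.
  have [w Ew] := tilde_shift_surj z; exists w.
  by apply: tilde_shift_inj; rewrite -Ez -Ew; apply: tilde_shift_d.
exact: raddf_inj.
Qed.

Lemma stable_shift_surj i q : exists p, stable_shift i p = q.
Proof.
have [y Hy ->] := subquotP q; have [x Ex] := tilde_shift_surj y.
have Hx : tilde_d P J (1 + i) x = 0.
  by apply: tilde_shift_inj; rewrite tilde_shift_d Ex linear0.
by exists (hcls J (1 + i) x); rewrite stable_shift_cls // Ex.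
Qed.

End Shift.

Lemma stable_shift_natural (N N' : lmodType R) (I : injective_resolution N)
    (I' : injective_resolution N') (f : {linear N -> N'}) h
    (phi : cochain_lift I I' f)
    (psi : cochain_lift (shift_resolution I) (shift_resolution I') h) :
  (forall n, phi n.+1 = psi n) -> forall i q,
  stable_shift I' i (stable_tor_lift P psi (1 + i) q)
  = stable_tor_lift P phi i (stable_shift I i q).
Proof.
move=> E i q; have [x dx ->] := stable_torP q.
have dx' : tilde_d P (shift_resolution I') (1 + i)
    (tcls (shift_resolution I') (1 + (1 + i)) (tot_map P psi (1 + (1 + i)) x)) = 0.
  rewrite -tilde_mapE -[LHS](tilde_comm psi).
  by rewrite [ic_d _ _ _]dx linear0.
have dx2 : tilde_d P I i (tcls I (1 + i) (tot_shift I (1 + i) x)) = 0.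
  by rewrite -tilde_shiftE -tilde_shift_d dx linear0.
have E1 := congr1 (stable_shift I' i) (stable_tor_lift_cls psi dx).
have E2 := congr1 (stable_tor_lift P phi i) (stable_shift_tcls dx).
apply: (etrans E1); apply: (etrans (stable_shift_tcls dx')).
apply/esym/(etrans E2)/(etrans (stable_tor_lift_cls phi dx2)); apply/esym.
congr (cls _ _ (cls _ _ _)).
apply: tot_ext => a [|b] e.
  by rewrite [LHS]tot_shiftE0 [RHS]tot_mapE tot_shiftE0 linear0.
by rewrite [LHS]tot_shiftES [LHS]tot_mapE [RHS]tot_mapE tot_shiftES E.
Qed.

End Stable.

(** * The cosyzygy shift for the chosen resolutions *)

Section CosyzygyShift.
Variables (k : comPzRingType) (R : kalgebra k) (M : lmodType R^c).
Variable P : projective_resolution M.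
Variable I : forall N : lmodType R, injective_resolution N.

Lemma stable_shift_lift_surj (N : lmodType R) (L : injective_resolution N)
    (J : injective_resolution (coker (ir_aug L)))
    (phi : cochain_lift J (shift_resolution L) idfun) i :
  forall x, exists y, (stable_shift P L i \o stable_tor_lift P phi (1 + i)) y = x.
Proof.
have [psi _] := lift_exists (shift_resolution L) J idfun.
move=> x; have [y Ey] := stable_shift_surj x.
have E := @stable_tor_lift_idK _ _ _ P _ _ _ psi phi (1 + i) y.
exists (stable_tor_lift P psi (1 + i) y); apply: etrans Ey.
rewrite -[LHS]/(stable_shift P L i (stable_tor_lift P phi (1 + i)
  (stable_tor_lift P psi (1 + i) y))).
by rewrite E.
Qed.

Lemma stable_shift_lift_inj (N : lmodType R) (L : injective_resolution N)
    (J : injective_resolution (coker (ir_aug L)))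
    (phi : cochain_lift J (shift_resolution L) idfun) i :
  injective (stable_shift P L i \o stable_tor_lift P phi (1 + i)).
Proof.
have [psi _] := lift_exists (shift_resolution L) J idfun.
apply: (inj_comp (@stable_shift_inj _ _ _ P _ L i)).
exact: can_inj (@stable_tor_lift_idK _ _ _ P _ _ _ phi psi (1 + i)).
Qed.

Lemma stable_shift_lift_natural (N N' : lmodType R) (L : injective_resolution N)
    (L' : injective_resolution N') (J : injective_resolution (coker (ir_aug L)))
    (J' : injective_resolution (coker (ir_aug L')))
    (c : cochain_lift J (shift_resolution L) idfun)
    (c' : cochain_lift J' (shift_resolution L') idfun)
    (f : {linear N -> N'}) (h : {linear coker (ir_aug L) -> coker (ir_aug L')})
    (phi : cochain_lift L L' f) (chi : cochain_lift J J' h)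
    (psi : cochain_lift (shift_resolution L) (shift_resolution L') h) i :
  (forall n, phi n.+1 = psi n) -> forall q,
  stable_shift P L' i (stable_tor_lift P c' (1 + i) (stable_tor_lift P chi (1 + i) q))
  = stable_tor_lift P phi i (stable_shift P L i (stable_tor_lift P c (1 + i) q)).
Proof.
move=> E q; have [om _] := lift_exists J (shift_resolution L') h.
have E1 := @stable_tor_lift_comp _ _ _ P _ _ _ _ _ _ _ _ _ chi c' om (1 + i)
  (fun _ => erefl) q.
have E2 := @stable_tor_lift_comp _ _ _ P _ _ _ _ _ _ _ _ _ c psi om (1 + i)
  (fun _ => erefl) q.
rewrite -E1 E2; exact: stable_shift_natural.
Qed.

(** The chosen resolution of a cosyzygy is in general not the shifted one; a lift of the identity
    mediates between them. *)
Definition cosyzygy_comparison N :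
    cochain_lift (I (cosyzygy I N)) (shift_resolution (I N)) idfun :=
  projT1 (cid (lift_exists (I (cosyzygy I N)) (shift_resolution (I N)) idfun)).

Lemma scaled_linear (V W : lmodType k) (c : k) (f : {linear V -> W}) :
  linear (fun x => c *: f x).
Proof. by move=> a x y; rewrite linearP scalerDr !scalerA mulrC. Qed.

(* The sign makes this map compatible with the connecting maps of Tor; it comes
   from the sign (-1)^a of the horizontal differential. *)
Definition stable_cosyzygy i N :
    {linear stable_Tor P I (1 + i) (cosyzygy I N) -> stable_Tor P I i N} :=
  mk_linear (scaled_linear ((-1) ^+ absz i)
    (stable_shift P (I N) i \o stable_tor_lift P (cosyzygy_comparison N) (1 + i))).

Lemma stable_cosyzygyE i N (q : stable_tor_obj P (I (cosyzygy I N)) (1 + i)) :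
  stable_cosyzygy i N q = (-1) ^+ absz i *: stable_shift P (I N) i
    (stable_tor_lift P (cosyzygy_comparison N) (1 + i) q).
Proof. by []. Qed.

Lemma signr_scaleK (V : lmodType k) n (x : V) : (-1) ^+ n *: ((-1) ^+ n *: x) = x.
Proof. by rewrite scalerA -expr2 sqrr_sign scale1r. Qed.

Lemma signed_linear (V W : lmodType k) (f : {linear V -> W}) n y :
  f ((-1) ^+ n *: y) = (-1) ^+ n *: f y.
Proof. exact: linearZ. Qed.

Lemma signed_inj (V W : lmodType k) n (f : V -> W) :
  injective f -> injective (fun x => (-1) ^+ n *: f x).
Proof.
move=> fi x y /(congr1 ( *:%R ((-1) ^+ n))).
by rewrite !signr_scaleK => /fi.
Qed.

Lemma signed_surj (V W : lmodType k) n (f : V -> W) :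
  (forall y, exists x, f x = y) -> forall y, exists x, (-1) ^+ n *: f x = y.
Proof.
move=> fs y; have [x Ex] := fs ((-1) ^+ n *: y).
by exists x; rewrite Ex signr_scaleK.
Qed.

Lemma stable_cosyzygy_inj i N : injective (stable_cosyzygy i N).
Proof. exact/signed_inj/stable_shift_lift_inj. Qed.

Lemma stable_cosyzygy_surj i N x : exists y, stable_cosyzygy i N y = x.
Proof.
by apply: signed_surj; apply: stable_shift_lift_surj.
Qed.

Lemma stable_cosyzygy_natural i (N N' : lmodType R) (f : {linear N -> N'}) h :
  cosyzygy_lift f h -> forall x,
  stable_cosyzygy i N' (fmap (stable_Tor P I (1 + i)) h x)
  = fmap (stable_Tor P I i) f (stable_cosyzygy i N x).
Proof.
move=> [e [ea he]] x.
have [psi _] := lift_exists (shift_resolution (I N)) (shift_resolution (I N')) h.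
(* [e] in degree 0 and the lift [psi] of [h] in positive degrees glue to a lift of [f]; the square
   at the joint is the compatibility of [e] with [h]. *)
pose phi_map n : {linear I N n -> I N' n} :=
  if n is m.+1 return {linear I N n -> I N' n} then psi m else e.
have pc n y : phi_map n.+1 (ir_d (I N) n y) = ir_d (I N') n (phi_map n y).
  case: n y => [|n] y; last exact: (lift_comm psi).
  rewrite -(@shift_augE _ _ (I N) y) -(@shift_augE _ _ (I N')) -he.
  exact: (lift_aug psi).
pose phi : cochain_lift (I N) (I N') f := CochainLift pc ea.
have [chi _] := lift_exists (I (cosyzygy I N)) (I (cosyzygy I N')) h.
have E1 : stable_tor_map P I (1 + i) h x = stable_tor_lift P chi (1 + i) x.
  exact: stable_tor_mapE.
have E2 y : stable_tor_map P I i f y = stable_tor_lift P phi i y.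
  exact: stable_tor_mapE.
have E3 := @stable_shift_lift_natural _ _ _ _ _ _ (cosyzygy_comparison N)
  (cosyzygy_comparison N') _ _ phi chi psi i (fun n => erefl) x.
rewrite -[LHS]/(stable_cosyzygy i N' (stable_tor_map P I (1 + i) h x)) E1.
rewrite -[RHS]/(stable_tor_map P I i f (stable_cosyzygy i N x)) E2.
have E4 := signed_linear (stable_tor_lift P phi i) (absz i)
  (stable_shift P (I N) i (stable_tor_lift P (cosyzygy_comparison N) (1 + i) x)).

have E5 := congr1 (fun z : stable_tor_obj P (I N') i => (-1) ^+ absz i *: z) E3.
by rewrite (stable_cosyzygyE x) (stable_cosyzygyE (stable_tor_lift _ _ _ _)) E4.
Qed.

End CosyzygyShift.

(** * The double complex of a projective and an injective resolution *)

Section DoubleComplex.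
Variables (k : comPzRingType) (R : kalgebra k) (M : lmodType R^c).
Variable P : projective_resolution M.

(** Flatness of [Q] concerns short exact sequences, so the sequence is cut: the image of [f] is the
    cokernel of [e], and [g] factors through an embedding of the cokernel of [f]. *)
Lemma proj_tensor_exact (Q : lmodType R^c) (Z A B C : lmodType R)
    (e : {linear Z -> A}) (f : {linear A -> B}) (g : {linear B -> C}) :
  projective_module Q -> exact_seq e f -> exact_seq f g ->
  exact_seq (tensor_map (idfun : {linear Q -> Q}) f)
            (tensor_map (idfun : {linear Q -> Q}) g).
Proof.
move=> projQ ef fg t.
have [w [se Hw]] := coker_resolution ef.
have [z [zi Hz]] := coker_embedding fg.
have [zi' _ _] := proj_flat projQ (coker_short_exact zi).
have [_ E _] := proj_flat projQ se.
have C1 u : tensor_map idfun w (tensor_map (idfun : {linear Q -> Q}) (coker_proj e) u)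
    = tensor_map (idfun : {linear Q -> Q}) f u by apply: tensor_map_comp.
split=> [Ht|[u <-]].
  have /E[kappa <-] : tensor_map (idfun : {linear Q -> Q}) (coker_proj f) t = 0.
    by apply: zi'; rewrite linear0 -[RHS]Ht; apply: tensor_map_comp.
  have [u <-] := tensor_map_surj (g := (idfun : {linear Q -> Q}))
    (fun y => ex_intro _ y erefl) (@coker_proj_surj _ _ _ e) kappa.
  by exists u; apply/esym/C1.
have E0 : tensor_map (idfun : {linear Q -> Q}) (g \o f) u = 0.
  by apply: tensor_map_eq0 => x; apply/fg; exists x.
by apply: etrans E0; apply: tensor_map_comp.
Qed.

Section Object.
Variables (N : lmodType R) (I : injective_resolution N).

Local Notation dP a b := (tensor_map (lr_d P a) (idfun : {linear I b -> I b})).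
Local Notation dI a b := (tensor_map (idfun : {linear P a -> P a}) (ir_d I b)).
Local Notation eps a := (tensor_map (idfun : {linear P a -> P a}) (ir_aug I)).

Lemma dI_exact a b : exact_seq (dI a b) (dI a b.+1).
Proof.
have pa := lr_class P a; case: b => [|b].
  exact: proj_tensor_exact pa (@ir_exact_aug _ _ I) (@ir_exact _ _ I 0%N).
exact: proj_tensor_exact pa (@ir_exact _ _ I b) (@ir_exact _ _ I b.+1).
Qed.

Lemma eps_inj a : injective (eps a).
Proof.
by have [] := proj_flat (lr_class P a) (coker_short_exact (@ir_aug_inj _ _ I)).
Qed.

Lemma eps_exact a : exact_seq (eps a) (dI a 0).
Proof.
have e0 : exact_seq (\0 : {linear ('rV[R]_0 : lmodType R) -> N}) (ir_aug I).
  move=> y; split=> [E|[x <-]]; last by rewrite linear0.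
  by exists 0; apply: (@ir_aug_inj _ _ I); rewrite E !linear0.
exact: proj_tensor_exact (lr_class P a) e0 (@ir_exact_aug _ _ I).
Qed.

Lemma dI_dI a b t : dI a b.+1 (dI a b t) = 0.
Proof. by apply/dI_exact; exists t. Qed.

Definition bounded n B (x : tot P I n) : Prop :=
  forall a b (h : a%:Z - b%:Z == n), (B < b)%N -> tot_at x h = 0.

(** In degree [n] the index [b] determines [a = n + b], so a bound on [b] leaves finitely many
    components. *)
Lemma bounded_fin n B x : @bounded n B x -> tot_fin P I n x.
Proof.
move=> Hx; apply/tot_finP; exists [seq (absz (n + b%:Z), b) | b <- iota 0 B.+1].
move=> a b h Hab; apply: Hx; rewrite ltnNge; apply: contra Hab => Hb.
apply/mapP; exists b; first by rewrite mem_iota.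
by rewrite -(eqP h) subrK.
Qed.

Lemma fin_bounded n x : tot_fin P I n x -> exists B, @bounded n B x.
Proof.
move=> /tot_finP[s Hs]; exists (\max_(ab <- s) ab.2)%N => a b h HB.
apply: Hs; apply/negP => Hab; move: HB; rewrite ltnNge.
by rewrite (@leq_bigmax_seq _ s xpredT snd (a, b) Hab isT).
Qed.

(** At position [(a, B + 1)] the [dP] part of the differential reads a component beyond the bound,
    which leaves only [dI] of the top component, up to sign. *)
Lemma top_closed n B (y : tot P I (1 + n)) : bounded B y ->
  (forall a (h : a%:Z - B.+1%:Z == n), tot_at (tot_d P I n y) h = 0) ->
  forall a (h : a%:Z - B%:Z == 1 + n), dI a B (tot_at y h) = 0.
Proof.
move=> By Hy a h; have := Hy a (idx_pred' h).
rewrite [LHS]tot_dE (By _ _ (idx_succ _)) // linear0 add0r /= => E.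
rewrite -[LHS]scale1r -(sqrr_sign k a) expr2 -scalerA.
by rewrite (tot_at_irr y h (idx_pred (idx_pred' h))) E scaler0.
Qed.

(* The rows a -> P a (x) I are exact, so the top component of y can be killed. *)
Lemma lower_bound n B (y : tot P I n) : bounded B.+1 y ->
  (forall a (h : a%:Z - B.+1%:Z == n), dI a B.+1 (tot_at y h) = 0) ->
  exists w : tot P I (1 + n), bounded B w /\ bounded B (y - tot_d P I n w).
Proof.
move=> By Hy.
(* The guard [b = B] allows a choice at all pairs and avoids transporting elements along index
   equations. *)
have H a b : exists v, forall h : a%:Z - b.+1%:Z == n, b = B ->
    dI a b v = tot_at y h.
  case: (pselect (a%:Z - b.+1%:Z == n)) => [h|]; last by exists 0.
  case: (pselect (b = B)) => [E|]; last by exists 0.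
  have /dI_exact[v Ev] : dI a b.+1 (tot_at y h) = 0.
    by move: h; rewrite E => h; apply: Hy.
  by exists v => h' _; rewrite Ev; apply: tot_at_irr.
pose v a b := sval (cid (H a b)).
have vE a b h : b = B -> dI a b (v a b) = tot_at y h.
  exact: (svalP (cid (H a b)) h).
(* The sign cancels the one with which [dI] enters the differential. *)
pose w : tot P I (1 + n) := (fun p =>
  if (val p).2 == B then (-1) ^+ (val p).1 *: v (val p).1 (val p).2 else 0)
  : dprod _.
have wE a b h : tot_at w h = if b == B then (-1) ^+ a *: v a b else 0 by [].
exists w; split=> a [|b] h Hb //; first by rewrite wE gtn_eqF.
rewrite tot_atB [X in _ - X]tot_dE [tot_at w _]wE gtn_eqF // linear0 add0r.
rewrite [tot_dI w h]/= wE; case: (ltngtP b B) => Hc /=.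
- by exfalso; lia.
- by rewrite linear0 scaler0 subr0 By.
- rewrite [X in _ *: X]linearZ /= scalerA -expr2 sqrr_sign scale1r.
  by rewrite (vE _ _ h Hc) subrr.
Qed.

Section Base.
Variable n : nat.

(** The test on the index yields the equation along which [w] is cast to position [(n, 0)]. *)
Definition base_at (w : tensor (P n) (I 0%N)) a b : tensor (P a) (I b) :=
  match b with
  | 0%N => match n =P a with
           | ReflectT e => ecast a (tensor (P a) (I 0%N)) e w
           | ReflectF _ => 0
           end
  | _ => 0
  end.

Definition tot_base (w : tensor (P n) (I 0%N)) : tot P I n%:Z :=
  (fun p => base_at w (val p).1 (val p).2) : dprod _.

Lemma tot_baseE0 w (h : n%:Z - 0%:Z == n%:Z) : tot_at (tot_base w) h = w.
Proof.
rewrite -[LHS]/(base_at w n 0); rewrite /base_at; case: eqP => // e.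
by rewrite (eq_axiomK e).
Qed.

Lemma tot_baseES w a b (h : a%:Z - b.+1%:Z == n%:Z) : tot_at (tot_base w) h = 0.
Proof. by []. Qed.

Lemma tot_ext0 (x y : tot P I n%:Z) :
  (forall h : n%:Z - 0%:Z == n%:Z, tot_at x h = tot_at y h) ->
  (forall a b (h : a%:Z - b.+1%:Z == n%:Z), tot_at x h = tot_at y h) -> x = y.
Proof.
move=> H0 HS; apply: tot_ext => a [|b] h; last exact: HS.
have E : a = n by move: h; rewrite subr0 => /eqP[].
by move: h; rewrite E.
Qed.

End Base.

End Object.
End DoubleComplex.

(** * Homology of the two totalizations *)

Section TotalComplex.
Variables (k : comPzRingType) (R : kalgebra k) (M : lmodType R^c).
Variable P : projective_resolution M.
Variables (N : lmodType R) (I : injective_resolution N).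

Local Notation dP a b := (tensor_map (lr_d P a) (idfun : {linear I b -> I b})).
Local Notation dI a b := (tensor_map (idfun : {linear P a -> P a}) (ir_d I b)).
Local Notation eps a := (tensor_map (idfun : {linear P a -> P a}) (ir_aug I)).

Lemma dP_eps a t : dP a 0 (eps a.+1 t) = eps a (tor_d P N a t).
Proof.
have H u : tensor_map (lr_d P a) (ir_aug I) u = eps a (tor_d P N a u).
  by apply/esym/tensor_map_comp.
by rewrite -H; apply: tensor_map_comp.
Qed.

Lemma idx_diag0 n : n%:Z - 0%:Z == n%:Z.
Proof. by rewrite subr0. Qed.

(** The boundary lies in positions [(n, 0)] and [(n + 1, 1)]. The second is a base position for the
    shifted resolution, the form needed to compare the shift with connecting maps. *)
Lemma tot_d_base n (w : tensor (P n.+1) (I 0%N)) :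
  tot_d P I n%:Z (tot_base w) = tot_base (dP n 0 w) +
    (-1) ^+ n.+1 *: tot_shift P I n%:Z
      (tot_base (I := shift_resolution I) (n := n.+1) (dI n.+1 0 w)).
Proof.
apply: tot_ext0 => [h|a b h]; rewrite [RHS]tot_atD tot_atZ.
  have sh0 x : tot_at (tot_shift P I n%:Z x) h = 0 by [].
  rewrite [LHS]tot_dE tot_baseE0 sh0 !scaler0 !addr0.
  by rewrite (@tot_baseE0 _ _ _ P N I n.+1).
have shS x : tot_at (tot_shift P I n%:Z x) h = tot_at x (idx_pred h) by [].
rewrite [LHS]tot_dE tot_baseES add0r shS {shS}.
rewrite tot_baseES linear0 add0r.
case: b h => [|b] h; last by rewrite /= !tot_baseES linear0 !scaler0.
have E : a = n.+1 by move: h => /eqP; lia.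
rewrite /tot_dI; move: (idx_pred h); rewrite {}E => h'.
by rewrite (@tot_baseE0 _ _ _ P N I n.+1) (@tot_baseE0 _ _ _ P _ _ n.+1).
Qed.

(** This makes the augmentation from [P (x) N] to the coproduct totalization surjective on homology:
    [lower_bound] subtracts boundaries until only [b = 0] remains, where the kernel of [dI] is the
    image of the augmentation. *)
Lemma fin_cycle_base B n (y : tot P I (1 + n%:Z)) :
  bounded B y -> tot_d P I n%:Z y = 0 ->
  exists w z, tot_fin P I (1 + (1 + n%:Z)) w /\
    y = tot_base (n := n.+1) (eps n.+1 z) + tot_d P I (1 + n%:Z) w.
Proof.
elim: B y => [|B IH] y By dy.
  have := top_closed By (fun a h => congr1 (fun z => tot_at z h) dy).
  move/(_ n.+1 (idx_diag0 n.+1))/eps_exact => [z Ez].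
  exists 0, z; split; first exact: smem0.
  rewrite linear0 addr0; apply: (@tot_ext0 _ _ _ P N I n.+1) => [h|a b h].
    by rewrite tot_baseE0 Ez; apply: tot_at_irr.
  by rewrite tot_baseES; apply: By.
have [w [Bw By']] := lower_bound By
  (top_closed By (fun a h => congr1 (fun z => tot_at z h) dy)).
have [|w' [z [Fw' Ey]]] := IH _ By'; first by rewrite linearB dy tot_dd subrr.
exists (w' + w), z; split; first by apply: smemD => //; apply: bounded_fin Bw.
by rewrite linearD addrA -Ey subrK.
Qed.

(** The injectivity half, by the same descent: subtracting boundaries from [w] keeps its
    differential. At [B = 0], [w] comes from [P (x) N], and the injective augmentation reflects the
    equation. *)
Lemma fin_boundary_base B n (w : tot P I (1 + n.+1%:Z)) (z : tensor (P n.+1) N) :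
  bounded B w -> tot_d P I n.+1%:Z w = tot_base (eps n.+1 z) ->
  exists u, tor_d P N n.+1 u = z.
Proof.
elim: B w => [|B IH] w Bw dw.
  have top a (h : a%:Z - 1%:Z == n.+1%:Z) : tot_at (tot_d P I n.+1%:Z w) h = 0.
    by rewrite dw tot_baseES.
  have := top_closed Bw top (idx_diag0 n.+2) => /eps_exact [u Eu].
  exists u; apply: (@eps_inj _ _ _ P N I); rewrite -dP_eps.
  have := congr1 (fun x => tot_at x (idx_diag0 n.+1)) dw.
  rewrite [LHS]tot_dE tot_baseE0 /= scaler0 addr0 => <-.
  by congr (tensor_map _ _ _); rewrite Eu; apply: tot_at_irr.
have top a (h : a%:Z - B.+2%:Z == n.+1%:Z) : tot_at (tot_d P I n.+1%:Z w) h = 0.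
  by rewrite dw tot_baseES.
have [v [Bv Bw']] := lower_bound Bw (top_closed Bw top).
by apply: IH Bw' _; rewrite linearB tot_dd subr0.
Qed.

(** * Acyclicity of the product totalization in high degrees *)

Section Acyclicity.
Variables (d n : nat).
Hypothesis columns : forall a b, (d <= a)%N ->
  forall t : tensor (P a.+1) (I b), dP a b t = 0 -> exists s, dP a.+1 b s = t.
Hypothesis dn : (d <= n)%N.
Variable x : tot P I (1 + n%:Z).
Hypothesis dx : tot_d P I n%:Z x = 0.

(* A preimage y of x is built by induction on b: the invariant makes
   x - (+-) dI (y at b) a cycle of column b.+1. *)
Let state b := {Y : forall a, tensor (P a) (I b) |
  forall a (h : a%:Z - b%:Z == 1 + n%:Z),
    dI a b (dP a b (Y a.+1)) = dI a b (tot_at x h)}.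

(** [y] has degree [n + 2], so its first indices are positive and the value at [a = 0] is a
    default. *)
Let choose_column b (G : forall a, tensor (P a) (I b) -> Prop) :
  (forall a, exists t, G a.+1 t) ->
  exists Y : forall a, tensor (P a) (I b), forall a, G a.+1 (Y a.+1).
Proof.
move=> H; pose Y a : tensor (P a) (I b) :=
  if a is a'.+1 return tensor (P a) (I b) then sval (cid (H a')) else 0.
by exists Y => a; rewrite /Y; case: cid.
Qed.

Let idx_positive a b : a%:Z - b%:Z == 1 + n%:Z ->
  exists2 a', a = a'.+1 & (n <= a')%N.
Proof. by case: a => [|a] /eqP E; [lia | exists a => //; lia]. Qed.

Let start : {Y : state 0 |
  forall a (h : a%:Z - 0%:Z == 1 + n%:Z), dP a 0 (sval Y a.+1) = tot_at x h}.
Proof.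
apply: cid.
have [|Y HY] := @choose_column 0%N (fun a => if a is a'.+1
    return tensor (P a) (I 0%N) -> Prop then fun t =>
      forall h : a'%:Z - 0%:Z == 1 + n%:Z, dP a' 0 t = tot_at x h else fun _ => True).
  move=> a; case: (pselect (a%:Z - 0%:Z == 1 + n%:Z)) => [h|]; last by exists 0.
  have [a' Ea Ha'] := idx_positive h; subst a.
  have [|t Et] := columns (leq_trans dn Ha') (t := tot_at x h).
    have h' : a'%:Z - 0%:Z == n%:Z by move: h => /eqP; lia.
    have := congr1 (fun y => tot_at y h') dx.
    by rewrite [LHS]tot_dE /= scaler0 addr0 (tot_at_irr x _ h).
  by exists t => h'; rewrite Et; apply: tot_at_irr.
have HY' a (h : a%:Z - 0%:Z == 1 + n%:Z) :
    dI a 0 (dP a 0 (Y a.+1)) = dI a 0 (tot_at x h).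
  by rewrite (HY a h).
by exists (exist _ Y HY') => a h; apply: HY.
Qed.

Let step b (Y : state b) : {Y' : state b.+1 |
  forall a (h : a%:Z - b.+1%:Z == 1 + n%:Z), dP a b.+1 (sval Y' a.+1)
    = tot_at x h - (-1) ^+ a *: dI a b (sval Y a)}.
Proof.
apply: cid; case: Y => Y HY /=.
have [|Y' HY'] := @choose_column b.+1 (fun a => if a is a'.+1
    return tensor (P a) (I b.+1) -> Prop then fun t =>
      forall h : a'%:Z - b.+1%:Z == 1 + n%:Z, dP a' b.+1 t
        = tot_at x h - (-1) ^+ a' *: dI a' b (Y a') else fun _ => True).
  move=> a; case: (pselect (a%:Z - b.+1%:Z == 1 + n%:Z)) => [h|]; last by exists 0.
  have [a' Ea Ha'] := idx_positive h; subst a.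
  have [|t Et] := columns (leq_trans dn Ha')
      (t := tot_at x h - (-1) ^+ a'.+1 *: dI a'.+1 b (Y a'.+1)).
    (* By the invariant, [dP] of the element to be lifted is the component of [tot_d x] at
       [(a', b + 1)], which is 0. *)
    have h' : a'%:Z - b.+1%:Z == n%:Z by move: h => /eqP; lia.
    have := congr1 (fun y => tot_at y h') dx.
    rewrite [LHS]tot_dE /= (tot_at_irr x _ h) -(HY a' (idx_pred h')) => E.
    rewrite linearB [X in _ - X]linearZ /= tensor_map_swap exprS mulN1r scaleNr opprK.
    exact: E.
  by exists t => h'; rewrite Et (tot_at_irr x h h').
have HI a (h : a%:Z - b.+1%:Z == 1 + n%:Z) :
    dI a b.+1 (dP a b.+1 (Y' a.+1)) = dI a b.+1 (tot_at x h).
  by rewrite (HY' a h) linearB [X in _ - X]linearZ /= dI_dI scaler0 subr0.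
by exists (exist _ Y' HI) => a h; apply: HY'.
Qed.

Let columns_seq := fix columns_seq b : state b :=
  if b is b'.+1 return state b then sval (step (columns_seq b')) else sval start.

(** In degree [n + 1] all first indices exceed [d], where the columns are exact, so they can be
    solved one after another. The resulting [y] may have infinitely many nonzero components, as the
    product allows. *)
Lemma product_acyclic : exists y, tot_d P I (1 + n%:Z) y = x.
Proof.
pose y : tot P I (1 + (1 + n%:Z)) :=
  (fun p => sval (columns_seq (val p).2) (val p).1) : dprod _.
exists y; apply: tot_ext => a b h; rewrite [LHS]tot_dE.
rewrite -[tot_at y (idx_succ h)]/(sval (columns_seq b) a.+1).
case: b h => [|b] h.
  by rewrite /= scaler0 addr0; apply: (svalP start).
have := svalP (step (columns_seq b)) a h; rewrite -[sval (step _)]/(columns_seq b.+1).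
by move=> ->; rewrite subrK.
Qed.

End Acyclicity.
End TotalComplex.

(** * Comparison of stable homology with Tor *)

Section Relation.
Variables (k : comPzRingType) (R : kalgebra k) (M : lmodType R^c).
Variable P : projective_resolution M.

Local Notation tcls I n x := (cls subT (tot_fin P I n) x).
Local Notation hcls I n y :=
  (cls (kerS (ic_d (tilde_complex P I) n))
       (imS (ic_d (tilde_complex P I) (1 + n))) y).
Local Notation eps I a := (tensor_map (idfun : {linear P a -> P a}) (ir_aug I)).
Local Notation tor_cls N n z :=
  (cls (cycles (tor_complex P N) n) (boundaries (tor_complex P N) n) z).

Lemma sign_cancel (V : lmodType k) n (a b : V) :
  a - ((-1) ^+ n.+2 *: b + a) = (-1) ^+ n.+1 *: b.
Proof. by rewrite opprD addrCA subrr addr0 exprS mulN1r scaleNr opprK. Qed.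

Section Object.
Variables (N : lmodType R) (I : injective_resolution N).

Lemma tot_base0 n : tot_base (P := P) (I := I) (0 : tensor (P n) (I 0%N)) = 0.
Proof. by apply: tot_ext0 => [h|a b h]; rewrite ?tot_baseE0. Qed.

Lemma tot_base_fin n (w : tensor (P n) (I 0%N)) : tot_fin P I n%:Z (tot_base w).
Proof. by apply: (@bounded_fin _ _ _ _ _ _ _ 0%N) => a [|b] h. Qed.

Lemma tot_base_lin n c (w w' : tensor (P n) (I 0%N)) :
  tot_base (c *: w + w') = c *: tot_base w + tot_base w'.
Proof.
apply: tot_ext0 => [h|a b h]; rewrite tot_at_lin; first by rewrite !tot_baseE0.
by rewrite !tot_baseES scaler0 addr0.
Qed.

Lemma tot_base_inj n : injective (fun w : tensor (P n) (I 0%N) => tot_base w).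
Proof.
move=> w w' /(congr1 (fun x => tot_at x (idx_diag0 n))).
by rewrite !tot_baseE0.
Qed.

Lemma tot_d_base_eps n z : tot_d P I n%:Z (tot_base (n := n.+1) (eps I n.+1 z))
  = tot_base (eps I n (tor_d P N n z)).
Proof.
rewrite tot_d_base dP_eps.
have -> : tensor_map (idfun : {linear P n.+1 -> P n.+1}) (ir_d I 0) (eps I n.+1 z) = 0.
  by apply/eps_exact; exists z.
rewrite (_ : tot_base (0 : tensor (P n.+1) (shift_resolution I 0%N)) = 0).
  by rewrite linear0 scaler0 addr0.
by apply: tot_ext0 => [h|a b h]; rewrite ?(@tot_baseE0 _ _ _ P _ _ n.+1).
Qed.

Lemma stable_tor_closed i x : tot_fin P I i (tot_d P I i x) ->
  tilde_d P I i (tcls I (1 + i) x) = 0.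
Proof. by move=> fx; rewrite tilde_dE; apply/cls_eq0. Qed.

Lemma stable_tor_closedP i x : tilde_d P I i (tcls I (1 + i) x) = 0 ->
  tot_fin P I i (tot_d P I i x).
Proof. by rewrite tilde_dE => /cls_eq0; apply. Qed.

Lemma tcls_eq i x y : tcls I i x = tcls I i y <-> tot_fin P I i (x - y).
Proof. by split=> [/cls_eq|H]; [apply | apply/cls_eq]. Qed.

Lemma stable_cls_eq0 i x : tilde_d P I i (tcls I (1 + i) x) = 0 ->
  (hcls I i (tcls I (1 + i) x) = 0 <->
   exists v, tot_fin P I (1 + i) (x - tot_d P I (1 + i) v)).
Proof.
move=> dx; pose K := kerS (ic_d (tilde_complex P I) i).
pose B := imS (ic_d (tilde_complex P I) (1 + i)).
have kx : K (tcls I (1 + i) x) by exact: dx.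
have H0 := cls_eq0 B kx; split=> [/(proj1 H0)[v' Ev']|[v Fv]].
  have [v _ Ev] := subquotP v'; rewrite Ev in Ev'; exists v.
  apply/tcls_eq; apply: (etrans (esym Ev')); exact: tilde_dE.
apply/(proj2 H0); exists (tcls I (1 + (1 + i)) v).
by apply: etrans (tilde_dE _) _; apply/esym/tcls_eq.
Qed.

Lemma stable_clsZ i c x : tilde_d P I i (tcls I (1 + i) x) = 0 ->
  hcls I i (tcls I (1 + i) (c *: x)) = c *: hcls I i (tcls I (1 + i) x).
Proof.
move=> dx; have kx : kerS (ic_d (tilde_complex P I) i) (tcls I (1 + i) x) by exact: dx.
have E1 : tcls I (1 + i) (c *: x) = c *: tcls I (1 + i) x.
  exact: esym (@clsZ _ _ subT (tot_fin P I (1 + i)) c x Logic.I).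
rewrite E1; exact: esym (clsZ _ c kx).
Qed.

Lemma tor_cls_eq0 n z : tor_d P N n z = 0 ->
  (tor_cls N n.+1 z = 0 <-> exists v, tor_d P N n.+1 v = z).
Proof.
move=> dz; have kz : cycles (tor_complex P N) n.+1 z by exact: dz.
have H := cls_eq0 (boundaries (tor_complex P N) n.+1) kz; exact: H.
Qed.

(* The graph of the connecting map H (tot / tot_fin) -> H (tot_fin) followed by
   the inverse of the isomorphism from H (P (x) N) induced by the augmentation. *)
Definition stable_tor_rel n (t : stable_tor_obj P I n.+1%:Z)
    (u : homology (tor_complex P N) n.+1) : Prop :=
  exists (x : tot P I (1 + n.+1%:Z)) (z : tensor (P n.+1) N),
    [/\ tot_d P I n.+1%:Z x = tot_base (eps I n.+1 z), tor_d P N n z = 0,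
        t = hcls I n.+1%:Z (tcls I (1 + n.+1%:Z) x) & u = tor_cls N n.+1 z].

Lemma stable_tor_rel_lin n c t u t' u' :
  @stable_tor_rel n t u -> stable_tor_rel t' u' ->
  stable_tor_rel (c *: t + t') (c *: u + u').
Proof.
move=> [x [z [dx dz -> ->]]] [x' [z' [dx' dz' -> ->]]].
exists (c *: x + x'), (c *: z + z'); split.
- by rewrite !linearP dx dx' tot_base_lin.
- by rewrite linearP dz dz' scaler0 addr0.
- have E1 := @cls_lin _ _ subT (tot_fin P I (1 + n.+1%:Z)) c x x' Logic.I Logic.I.
  rewrite E1; apply/esym/cls_lin; apply: stable_tor_closed.
    by rewrite dx; apply: tot_base_fin.
  by rewrite dx'; apply: tot_base_fin.
- by rewrite cls_lin.
Qed.

(** A cycle modulo the coproduct has a finite differential; [fin_cycle_base] supplies a finite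
    correction [w] after which this differential comes from [P (x) N]. *)
Lemma stable_tor_rel_total n t : exists u, @stable_tor_rel n t u.
Proof.
have [x dx ->] := stable_torP t.
have [B HB] := fin_bounded (stable_tor_closedP dx).
have [w [z [Fw Ex]]] :=
  @fin_cycle_base _ _ _ P N I B n _ HB (@tot_dd _ _ _ P N I n%:Z x).
exists (tor_cls N n.+1 z), (x - w), z; split=> //.
- by rewrite linearB Ex addrK.
- apply: (@eps_inj _ _ _ P N I); rewrite linear0; apply: tot_base_inj.
  rewrite -tot_d_base_eps tot_base0.
  by rewrite (_ : tot_base _ = tot_d P I _ x - tot_d P I _ w) ?linearB ?tot_dd
    ?subrr // Ex addrK.
- by congr (hcls _ _ _); apply/tcls_eq; rewrite subKr.
Qed.

(** A representative of 0 is a boundary plus a finite element with the same differential, so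
    [fin_boundary_base] makes [z] a boundary. *)
Lemma stable_tor_rel0 n u : @stable_tor_rel n 0 u -> u = 0.
Proof.
move=> [x [z [dx dz /esym Ex ->]]]; apply/(proj2 (tor_cls_eq0 dz)).
have cx : tilde_d P I n.+1%:Z (tcls I (1 + n.+1%:Z) x) = 0.
  by apply: stable_tor_closed; rewrite dx; apply: tot_base_fin.
have [v Fv] := proj1 (stable_cls_eq0 cx) Ex.
have [B HB] := fin_bounded Fv.
apply: (fin_boundary_base HB); rewrite linearB tot_dd subr0.
exact: dx.
Qed.

Section Acyclic.
Variable d : nat.
Hypothesis columns : forall a b, (d <= a)%N -> forall t : tensor (P a.+1) (I b),
  tor_d P (I b) a t = 0 -> exists s, tor_d P (I b) a.+1 s = t.
Variable n : nat.
Hypothesis dn : (d <= n)%N.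

Lemma stable_tor_rel_surj u : exists t, @stable_tor_rel n t u.
Proof.
have [z Zz ->] := subquotP u.
have [|x dx] := product_acyclic columns dn (x := tot_base (n := n.+1) (eps I n.+1 z)).
  by rewrite tot_d_base_eps Zz linear0 tot_base0.
by exists (hcls I n.+1%:Z (tcls I (1 + n.+1%:Z) x)), x, z.
Qed.

(** Subtracting the image of [v] turns [x] into a cycle of the product, hence a boundary; the
    subtracted element is finite and vanishes in the quotient. *)
Lemma stable_tor_rel_inj t : @stable_tor_rel n t 0 -> t = 0.
Proof.
move=> [x [z [dx dz -> /esym Ez]]]; have [v Ev] := proj1 (tor_cls_eq0 dz) Ez.
have [|y dy] := product_acyclic columns (leqW dn)
    (x := x - tot_base (n := n.+2) (eps I n.+2 v)).
  by rewrite linearB dx tot_d_base_eps Ev subrr.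
have cx : tilde_d P I n.+1%:Z (tcls I (1 + n.+1%:Z) x) = 0.
  by apply: stable_tor_closed; rewrite dx; apply: tot_base_fin.
apply/(proj2 (stable_cls_eq0 cx)); exists y.
by rewrite dy subKr; apply: (@tot_base_fin n.+2).
Qed.

End Acyclic.
End Object.

Lemma stable_tor_rel_lift (N N' : lmodType R) (I : injective_resolution N)
    (I' : injective_resolution N') (f : {linear N -> N'})
    (phi : cochain_lift I I' f) n t u :
  @stable_tor_rel N I n t u ->
  stable_tor_rel (stable_tor_lift P phi n.+1%:Z t)
    (homology_map (tor_chain_map P f) n.+1 u).
Proof.
move=> [x [z [dx dz -> ->]]].
exists (tot_map P phi (1 + n.+1%:Z) x),
  (tensor_map (idfun : {linear P n.+1 -> P n.+1}) f z).
split.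
- rewrite -tot_map_comm dx; apply: tot_ext0 => [h|a b h].
    rewrite [LHS]tot_mapE !tot_baseE0.
    have H : tensor_map (idfun : {linear P n.+1 -> P n.+1}) (phi 0%N) (eps I n.+1 z)
        = tensor_map (idfun : {linear P n.+1 -> P n.+1}) (phi 0%N \o ir_aug I) z.
      exact: tensor_map_comp.
    apply: (etrans H); apply/esym/tensor_map_comp => // y.
    by rewrite /= lift_aug.
  by rewrite [LHS]tot_mapE !tot_baseES linear0.
- by have := tor_comm f z; rewrite [cc_d _ _ _]dz linear0.
- apply: stable_tor_lift_cls; apply: stable_tor_closed.
  by rewrite dx; apply: tot_base_fin.
- exact: homology_mapE.
Qed.

(** The snake construction gives [y] over [z] with [dP y] the augmentation of [z']. Placing [y], up
    to sign, at the base position missing from the shift of [x] cancels the differential at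
    [(n + 2, 1)] and leaves the augmentation of [z'] at [(n + 1, 0)], with sign [(-1)^(n + 1)]. *)
Lemma stable_tor_rel_shift (N : lmodType R) (I : injective_resolution N)
    (se : short_exact (ir_aug I) (coker_proj (ir_aug I))) n t u :
  @stable_tor_rel _ (shift_resolution I) n.+1 t u ->
  stable_tor_rel ((-1) ^+ n.+1 *: stable_shift P I n.+1%:Z t)
    (conn (tor_short_exact P se) n.+1 u).
Proof.
move=> [x [z [dx dz Et ->]]].
have cx : tilde_d P (shift_resolution I) n.+2%:Z
    (tcls (shift_resolution I) (1 + n.+2%:Z) x) = 0.
  by apply: stable_tor_closed; rewrite dx; apply: tot_base_fin.
have [z' sn] := snake_ex (tor_short_exact P se) (n := n.+1) (z := z) dz.
have dz' := snake_cycle (tor_short_exact P se) sn.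
have Ec : conn (tor_short_exact P se) n.+1 (tor_cls _ n.+2 z) = tor_cls N n.+1 z'.
  exact: connE.
rewrite Ec; case: sn => y Ey Ez'.
pose b : tot P I (1 + n.+1%:Z) := tot_base (n := n.+2) y.
pose x' : tot P I (1 + n.+1%:Z) := tot_shift P I (1 + n.+1%:Z) x - (-1) ^+ n.+2 *: b.
have db : tot_d P I n.+1%:Z b = tot_base (eps I n.+1 z') +
    (-1) ^+ n.+2 *: tot_shift P I n.+1%:Z (tot_d P (shift_resolution I) n.+2%:Z x).
  have Hd : tensor_map (idfun : {linear P n.+2 -> P n.+2}) (ir_d I 0) y
      = tensor_map (idfun : {linear P n.+2 -> P n.+2}) (ir_aug (shift_resolution I)) z.
    rewrite -Ey; apply/esym/tensor_map_comp => // w; exact: shift_augE.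
  by rewrite tot_d_base Hd dx Ez'.
have dx' : tot_d P I n.+1%:Z x' = (-1) ^+ n.+1 *: tot_base (eps I n.+1 z').
  rewrite linearB signed_linear db -tot_shift_d scalerDr signr_scaleK.
  exact: sign_cancel.
exists ((-1) ^+ n.+1 *: x'), z'; split; [|exact: dz'| |by []].
  by rewrite signed_linear dx' signr_scaleK.
have cx' : tilde_d P I n.+1%:Z (tcls I (1 + n.+1%:Z) x') = 0.
  apply: stable_tor_closed; rewrite dx'; apply: smemZ; exact: tot_base_fin.
have E1 : stable_shift P I n.+1%:Z t
    = hcls I n.+1%:Z (tcls I (1 + n.+1%:Z) (tot_shift P I (1 + n.+1%:Z) x)).
  rewrite Et; exact (@stable_shift_tcls _ _ _ P _ I n.+1%:Z x cx).
have E2 : tcls I (1 + n.+1%:Z) x'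
    = tcls I (1 + n.+1%:Z) (tot_shift P I (1 + n.+1%:Z) x).
  apply/tcls_eq; rewrite /x' addrAC subrr add0r.
  by apply/smemN/smemZ/(@tot_base_fin _ _ n.+2).
have E3 := stable_clsZ ((-1) ^+ n.+1) cx'.
rewrite E2 in E3.
rewrite E1; exact: esym E3.
Qed.

End Relation.

(** * The comparison map and the conclusion *)

Section Comparison.
Variables (k : comPzRingType) (R : kalgebra k) (M : lmodType R^c).
Variable P : projective_resolution M.
Variable I : forall N : lmodType R, injective_resolution N.
Variable d : nat.
Hypothesis sfliR : sfli_le R d.

Lemma columns_exact (E : lmodType R) : injective_module E ->
  forall a, (d <= a)%N -> forall t : tensor (P a.+1) E,
  tor_d P E a t = 0 -> exists s, tor_d P E a.+1 s = t.
Proof.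
move=> iE a Ha t dt; apply/(proj1 (tor_cls_eq0 dt)).
exact: flat_dim_tor_eq0 (sfliR iE) _ Ha _.
Qed.

Lemma stable_to_tor_exists n :
  exists th : nat_trans (stable_Tor P I n.+1%:Z) (Tor P n.+1%:Z),
  forall N t u, stable_tor_rel t u <-> th N t = u.
Proof.
have H N : exists f : {linear stable_Tor P I n.+1%:Z N -> Tor P n.+1%:Z N},
    forall t u, stable_tor_rel t u <-> f t = u.
  apply: linear_choice.
  - move=> c x y x' y'; exact: stable_tor_rel_lin.
  - exact: stable_tor_rel_total.
  - exact: stable_tor_rel0.
pose f N := sval (cid (H N)).
have fE N t u : stable_tor_rel t u <-> f N t = u by exact: (svalP (cid (H N)) t u).
have fn (A B : lmodType R) (g : {linear A -> B}) x :
    f B (fmap (stable_Tor P I n.+1%:Z) g x) = fmap (Tor P n.+1%:Z) g (f A x).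
  apply/fE; apply: stable_tor_rel_lift; exact/fE.
by exists (NatTrans fn).
Qed.

(* The zero map in degrees i <= 0 is a junk value: only degrees i > d are used. *)
Definition stable_to_tor (i : int) : nat_trans (stable_Tor P I i) (Tor P i) :=
  match i return nat_trans (stable_Tor P I i) (Tor P i) with
  | Posz m.+1 => sval (cid (stable_to_tor_exists m))
  | j => zero_nat_trans (stable_Tor P I j) (Tor P j)
  end.

Lemma stable_to_torE n N t u :
  @stable_tor_rel _ _ _ P N (I N) n t u <-> stable_to_tor n.+1%:Z N t = u.
Proof. exact: (svalP (cid (stable_to_tor_exists n)) N t u). Qed.

Lemma stable_to_tor_bij i : d.+1%:Z <= i -> forall N, bijective (stable_to_tor i N).
Proof.
case: i => [[|n]|n] //; rewrite lez_nat ltnS => dn N.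
have col a b (Ha : (d <= a)%N) := columns_exact (@ir_injective _ _ (I N) b) Ha.
apply: inj_surj_bij => [|u].
  apply: raddf_inj => t /stable_to_torE.
  exact: (stable_tor_rel_inj (fun a b Ha => @col a b Ha) dn).
have [t /stable_to_torE Ht] := stable_tor_rel_surj (fun a b Ha => @col a b Ha) dn u.
by exists t.
Qed.

Lemma stable_to_tor_conn i : d.+1%:Z <= i -> forall N x,
  stable_to_tor i N (stable_cosyzygy P I i N x)
  = hf_conn (Tor P) i (cosyzygy_short_exact I N)
      (stable_to_tor (1 + i) (cosyzygy I N) x).
Proof.
case: i => [[|n]|n] // _ N x; apply/stable_to_torE.
have rel_x : stable_tor_rel x (stable_to_tor n.+2%:Z (cosyzygy I N) x).
  exact/stable_to_torE.
move: (stable_to_tor n.+2%:Z (cosyzygy I N) x) rel_x => u rel_x.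
(* The comparison of resolutions lifts the identity, so it leaves the class [u] in [Tor]
   unchanged. *)
have := stable_tor_rel_lift (cosyzygy_comparison I N) rel_x.
have -> : homology_map (tor_chain_map P (idfun : {linear cosyzygy I N -> cosyzygy I N}))
    n.+2 u = u by exact: (@tor_map_id _ _ _ P n.+2%:Z _ u).
by move/(stable_tor_rel_shift (cosyzygy_short_exact I N)); apply.
Qed.

Lemma J_completion_iso_stable_Tor (cTor : homological_functor R k)
    (tau : hf_morphism cTor (Tor P)) (cTorP : is_J_completion tau) (i : int) :
  functor_iso (cTor i) (stable_Tor P I i).
Proof.
apply: (J_completion_iso (I := I) (T := stable_Tor P I) (s := stable_cosyzygy P I)
  (n0 := d.+1%:Z) _ _ _ _ _ (t := stable_to_tor) _ _ cTorP).
- move=> j E iE; exact: stable_tor_injective.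
- move=> j N; exact: stable_cosyzygy_inj.
- move=> j N x; exact: stable_cosyzygy_surj.
- move=> j N N' f h H x; exact: stable_cosyzygy_natural.
(* Above [d], half-exactness is inherited from [Tor]. *)
- move=> j Hj; apply: half_exact_bijective (stable_to_tor_bij Hj) _ => A B C f g.
  exact: hf_exact_mid.
- exact: stable_to_tor_bij.
- exact: stable_to_tor_conn.
Qed.

End Comparison.

Theorem corollary2p11 (k : comPzRingType) (R : kalgebra k)
    (sfliR : sfli_finite R)
    (M : lmodType R^c) (P : projective_resolution M)
    (I : forall N : lmodType R, injective_resolution N)
    (cTor : homological_functor R k) (tau : hf_morphism cTor (Tor P))
    (cTorP : is_J_completion tau) (i : int) :
  functor_iso (cTor i) (stable_Tor P I i).
Proof.
case: sfliR => d Hd; exact: (J_completion_iso_stable_Tor I Hd cTorP).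
Qed.
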